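(* Let $\Xi,\Sigma$ be compact subsets of $(0,\infty)$ and $\mathcal{H}$ a compact subset of $(0,1)$. Consider the one-dimensional fractional Ornstein-Uhlenbeck processes $$dU^\theta_t=-\xi U^\theta_t\,dt+\sigma\,dB_t,\qquad U^\theta_0=0,$$ where $B$ is a fractional Brownian motion with Hurst parameter $H$, and assume that one of the three parameters $\xi\in\Xi$, $\sigma\in\Sigma$, $H\in\mathcal{H}$ is known (fixed), so that $\theta$ denotes the pair formed by the two remaining parameters and $\Theta$ is the product of the two corresponding sets. Let $p>1$ and, for $h>0$, let $\mu_\theta$ denote the stationary measure of $(U^\theta_{\cdot},U^\theta_{\cdot+h}-U^\theta_{\cdot})$. Then there exists $h_0>0$ such that for all $h\in(0,h_0)$, $$\forall\theta_1,\theta_2\in\Theta,\qquad d_{CF,p}(\mu_{\theta_1},\mu_{\theta_2})=0\iff\theta_1=\theta_2.$$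
   Context: The fractional Brownian motion is the standard one, with $\mathbb{E}[B_t^2]=|t|^{2H}$, so that the stationary solution $\bar U^\theta$ has marginal law $\mathcal{N}(0,\sigma^2H\Gamma(2H)\xi^{-2H})$; $\mu_\theta$ is the law on $\mathbb{R}^2$ of $(\bar U^\theta_t,\bar U^\theta_{t+h}-\bar U^\theta_t)$, which does not depend on $t$. For probability measures on $\mathbb{R}^2$, $d_{CF,p}(\mathcal{L}(X),\mathcal{L}(Y))=\Big(\int_{\mathbb{R}^2}\big|\mathbb{E}[e^{i\langle\chi,X\rangle}]-\mathbb{E}[e^{i\langle\chi,Y\rangle}]\big|^2g_p(\chi)\,d\chi\Big)^{1/2}$, with $g_p(\chi)=c_p(1+|\chi|^2)^{-p}$ and $c_p=\big(\int_{\mathbb{R}^2}(1+|\chi|^2)^{-p}d\chi\big)^{-1}$. *)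

(* Defs.v *)
From HB Require Import structures.
From mathcomp Require Import all_boot all_order all_algebra.
From mathcomp Require Import all_classical all_reals all_analysis.
From mathcomp.real_closed Require Import complex.

Set Implicit Arguments.
Unset Strict Implicit.
Unset Printing Implicit Defensive.

Import Order.TTheory GRing.Theory Num.Theory.
Import numFieldNormedType.Exports.

Local Open Scope classical_set_scope.
Local Open Scope ring_scope.

(* [normal_prob m 0] is not the point mass at m (its density is by convention
   the indicator of [0, 1]), so the degenerate case is treated apart. *)
Definition gaussian_law (R : realType) (nu : set R -> \bar R) : Prop :=
  exists m s : R, forall A : set R, measurable A ->
    nu A = if s == 0 then \d_m A else normal_prob m s A.

Definition gaussian_process (R : realType) (d : measure_display)
    (T : measurableType d) (P : probability T R)
    (X : R -> {RV P >-> R}) : Prop :=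
  forall (n : nat) (a t : 'I_n -> R),
    gaussian_law (pushforward P (fun w => \sum_(i < n) a i * X (t i) w)).

(* Two-sided fractional Brownian motion, normalised so that
   E[B_t ^ 2] = |t| ^ (2H). *)
Definition fractional_brownian_motion (R : realType) (d : measure_display)
    (T : measurableType d) (P : probability T R) (H : R)
    (B : R -> {RV P >-> R}) : Prop :=
  [/\ gaussian_process B,
      forall t, ('E_P[B t] = 0)%E,
      forall s t, covariance P (B s) (B t) =
        ((`|s| `^ (2 * H) + `|t| `^ (2 * H) - `|t - s| `^ (2 * H)) / 2)%:E
    & {ae P, forall w, continuous (fun t => B t w)}].

(* dU_t = - xi U_t dt + sigma dB_t on the whole real line. The noise being
   additive, the equation makes sense pathwise in integrated form. *)
Definition fOU_solution (R : realType) (d : measure_display)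
    (T : measurableType d) (P : probability T R) (xi sigma : R)
    (B U : R -> {RV P >-> R}) : Prop :=
  {ae P, forall w, continuous (fun t => U t w) /\
    forall s t : R, s <= t ->
      U t w - U s w =
        - xi * (\int[lebesgue_measure]_(r in `[s, t]) U r w)
        + sigma * (B t w - B s w)}.

Definition stationary_process (R : realType) (d : measure_display)
    (T : measurableType d) (P : probability T R)
    (U : R -> {RV P >-> R}) : Prop :=
  forall (n : nat) (t : 'I_n -> R) (tau : R) (A : set (n.-tuple R)),
    measurable A ->
    pushforward P (fun w => [tuple U (t i + tau) w | i < n]) A =
    pushforward P (fun w => [tuple U (t i) w | i < n]) A.

(* mu is the law, for every t, of (U_t, U_(t+h) - U_t), where U is a
   stationary solution driven by some fractional Brownian motion; the
   parameters (xi, sigma, H) are given as a triple. *)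
Definition stationary_measure (R : realType) (h : R) (par : R * R * R)
    (mu : probability (R * R)%type R) : Prop :=
  let: (xi, sigma, H) := par in
  exists (d : measure_display) (T : measurableType d) (P : probability T R)
         (B U : R -> {RV P >-> R}),
    [/\ fractional_brownian_motion H B,
        fOU_solution xi sigma B U,
        stationary_process U
      & forall (t : R) (A : set (R * R)), measurable A ->
          mu A = pushforward P (fun w => (U t w, U (t + h) w - U t w)) A].

Definition dotR2 (R : realType) (x y : R * R) : R := x.1 * y.1 + x.2 * y.2.

Definition lebesgue_measureR2 (R : realType) :=
  (@lebesgue_measure R \x @lebesgue_measure R)%E.

Definition char_fun (R : realType) (mu : probability (R * R)%type R)
    (chi : R * R) : R[i] :=
  ((\int[mu]_x cos (dotR2 chi x)) +i* (\int[mu]_x sin (dotR2 chi x)))%C.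

Definition c_ (R : realType) (p : R) : R :=
  (\int[@lebesgue_measureR2 R]_chi ((1 + dotR2 chi chi) `^ (- p)))^-1.

Definition g_ (R : realType) (p : R) (chi : R * R) : R :=
  c_ p * (1 + dotR2 chi chi) `^ (- p).

Definition d_CF (R : realType) (p : R)
    (mu nu : probability (R * R)%type R) : R :=
  Num.sqrt (\int[@lebesgue_measureR2 R]_chi
    (Normc.normc (char_fun mu chi - char_fun nu chi) ^+ 2 * g_ p chi)).

(* Which of the three parameters is known. *)
Variant parameter := drift | diffusion | hurst.

Definition known_range (R : realType) (Xi Sigma Hs : set R) (k : parameter) :
    set R :=
  match k with drift => Xi | diffusion => Sigma | hurst => Hs end.

Definition Theta (R : realType) (Xi Sigma Hs : set R) (k : parameter) :
    set (R * R) :=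
  match k with
  | drift => Sigma `*` Hs
  | diffusion => Xi `*` Hs
  | hurst => Xi `*` Sigma
  end.

(* The triple (xi, sigma, H) made of the known value c of the parameter k and
   of the pair theta of the two others, taken in the same order as in Theta. *)
Definition full_parameter (R : realType) (k : parameter) (c : R)
    (theta : R * R) : R * R * R :=
  match k with
  | drift => (c, theta.1, theta.2)
  | diffusion => (theta.1, c, theta.2)
  | hurst => (theta.1, theta.2, c)
  end.

(* Main.v *)
Require Import Defs.
From HB Require Import structures.
From mathcomp Require Import all_boot all_order all_algebra.
From mathcomp Require Import all_classical all_reals all_analysis.
From mathcomp Require Import measurable_realfun lebesgue_integral_under ring lra.
From mathcomp.real_closed Require Import complex.

Set Implicit Arguments.
Unset Strict Implicit.
Unset Printing Implicit Defensive.

Import Order.TTheory GRing.Theory Num.Theory.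
Import numFieldNormedType.Exports.

Local Open Scope classical_set_scope.
Local Open Scope ring_scope.

(** Let U be a stationary solution, R0 = E[U_0^2] and y(x) =
    E[(U_(x/xi) - U_0)^2] / (2 R0).  Letting s -> -oo in
    U_t = e^(-xi (t-s)) U_s + sigma * int_s^t e^(-xi (t-r)) dB_r, where the first
    term tends to 0 in probability by stationarity, shows that U belongs to the
    closed Gaussian space of B.  The law mu of (U_0, U_h - U_0) is thus centred
    Gaussian, determined by R0 and y(xi h), and d_CF(mu1, mu2) = 0 says that these
    two numbers agree.

    Taking variances in U_t - U_0 + xi * int_0^t U_r dr = sigma (B_t - B_0), the
    cross term vanishes by stationarity, and y solves the Volterra equation
    y(x) = k x^(2H) - A(x) with A'' = 1 - y, A(0) = A'(0) = 0 and
    k = sigma^2 xi^(-2H) / (2 R0).  Boundedness of y fixes k in terms of H (in fact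
    k = 1 / Gamma(2H+1)), hence also R0.  Moreover k_1 r^(2 H_1) > k_2 r^(2 H_2)
    whenever H_1 < H_2 and r <= e^(-2), and the positivity of the Volterra kernel
    transfers such comparisons to y.  This gives strict monotonicity of y near 0
    (H known), y_1 > y_2 at the same point (xi known), and, as equal variances then
    bound xi_1^2 - xi_2^2 by a multiple of H_2 - H_1 when H_1 < H_2,
    y_1(xi_1 h) > y_2(xi_2 h) (sigma known). *)

(** Of U only the pathwise equation and stationarity are known: no moment, no Gaussianity, no
    spectral formula. Convergence in probability is therefore the working notion; among Gaussian
    variables it already forces convergence of the variances, which replaces L2 estimates. Time
    integrals enter as Riemann sums, that is as finite combinations of values of the process.

    The constant k is controlled through e^(-t) (B + A), where B = A': it vanishes at 0 and at
    infinity for every solution. If k_1 and k_2 compared the wrong way at some r <= e^(-2), the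
    difference of these functions for two solutions would lose at most k_1 q r on [0, r], with q = 2
    (H_2 - H_1), and gain at least 2 k_1 q e^(-2) on [1, 2]; this is the origin of e^(-2).

    The delicate case is sigma known, where the variograms are read at the different points xi_1 h
    and xi_2 h. The gain due to H, at least of order (H_2 - H_1) u^2 |ln u|, and the loss due to the
    drift, of order (H_2 - H_1) u^2, are both proportional to H_2 - H_1. The logarithm decides, and
    the threshold on h is uniform over Theta. *)

Section real_calculus.
Context {R : realType}.
Implicit Types (f g A : R -> R) (x y a b : R).

(** The differentiation rules are restated on explicit functions of t, so that the derivative of a
    pointwise formula is assembled by unification and then adjusted by [is_derive_eq]. *)
Lemma is_derive_fD f g x df dg : is_derive x 1 f df -> is_derive x 1 g dg ->
  is_derive x 1 (fun t => f t + g t) (df + dg).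
Proof. exact: is_deriveD. Qed.

Lemma is_derive_fB f g x df dg : is_derive x 1 f df -> is_derive x 1 g dg ->
  is_derive x 1 (fun t => f t - g t) (df - dg).
Proof. exact: is_deriveB. Qed.

Lemma is_derive_fN f x df : is_derive x 1 f df ->
  is_derive x 1 (fun t => - f t) (- df).
Proof. exact: is_deriveN. Qed.

Lemma is_derive_fM f g x df dg : is_derive x 1 f df -> is_derive x 1 g dg ->
  is_derive x 1 (fun t => f t * g t) (f x * dg + g x * df).
Proof. exact: is_deriveM. Qed.

Lemma is_derive_fZ (c : R) f x df : is_derive x 1 f df ->
  is_derive x 1 (fun t => c * f t) (c * df).
Proof. exact: is_deriveZ. Qed.

Lemma is_derive_fcst (c x : R) : is_derive x 1 (fun=> c) 0.
Proof. exact: is_derive_cst. Qed.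

Lemma is_derive_fid x : is_derive x 1 (fun t : R => t) 1.
Proof. exact: is_derive_id. Qed.

Lemma is_derive_fcomp f g x a b : is_derive (g x) 1 f a -> is_derive x 1 g b ->
  is_derive x 1 (fun t => f (g t)) (a * b).
Proof. exact: is_derive1_comp. Qed.

Lemma is_derive_continuous f x df : is_derive x 1 f df -> {for x, continuous f}.
Proof.
by move=> dfx; apply/differentiable_continuous/derivable1_diffP; exact: ex_derive.
Qed.

Lemma le_of_derive f df a b : a <= b ->
  {within `[a, b], continuous f} ->
  (forall x, a < x < b -> is_derive x 1 f (df x)) ->
  (forall x, a < x < b -> 0 <= df x) -> f a <= f b.
Proof.
rewrite le_eqVlt => /predU1P[->|ab] cf dff df0; first by [].
have dff' x : x \in `]a, b[%R -> is_derive x 1 f (df x).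
  by rewrite in_itv/=; exact: dff.
have [c /[!in_itv]/= cab E] := MVT ab dff' cf.
by rewrite -subr_ge0 E mulr_ge0 ?subr_ge0 ?df0// ltW.
Qed.

(** The working form: most bounds on solutions come from the sign of a derivative rather than from
    an integral representation. *)
Lemma le_of_derive_cc f df a b : a <= b ->
  (forall x, a <= x <= b -> is_derive x 1 f (df x)) ->
  (forall x, a <= x <= b -> 0 <= df x) -> f a <= f b.
Proof.
move=> ab dff df0; apply: (@le_of_derive f df) => //.
- apply: continuous_in_subspaceT => x; rewrite inE/= in_itv/= => /dff.
  exact: is_derive_continuous.
- by move=> x /andP[ax xb]; apply: dff; rewrite !ltW.
- by move=> x /andP[ax xb]; apply: df0; rewrite !ltW.
Qed.

Lemma continuous_powR (s : R) x : 0 < x -> {for x, continuous (fun t => t `^ s)}.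
Proof. by move=> x0; apply: is_derive_continuous; exact: is_derive1_powR. Qed.

(** The power is differentiated at positive points only; one-sided continuity at 0 is what
    [le_of_derive] asks for on [[0, b]]. *)
Lemma within_continuous_powR (s b : R) : 0 < s -> 0 < b ->
  {within `[0, b], continuous (fun t : R => t `^ s)}.
Proof.
move=> s0 b0; apply/continuous_within_itvP => //; split.
- by move=> x; rewrite in_itv/= => /andP[x0 _]; exact: continuous_powR.
- by rewrite powR0 ?gt_eqF//; exact: powR_cvg0.
- by apply: cvg_at_left_filter; exact: continuous_powR.
Qed.

End real_calculus.

(** * The Volterra equation of the variogram *)

Section volterra.
Context {R : realType}.
Implicit Types (H k x t : R) (A B : R -> R).

(* A is twice differentiable with A'' = 1 - y and y = k x ^ (2H) - A, where
   0 <= y <= 2. *)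
Definition variogram_eq H k A B : Prop :=
  [/\ A 0 = 0, B 0 = 0,
      forall x, 0 <= x -> is_derive x 1 A (B x),
      forall x, 0 <= x -> is_derive x 1 B (1 - (k * x `^ (2 * H) - A x))
    & forall x, 0 <= x -> 0 <= k * x `^ (2 * H) - A x <= 2].

Section one_solution.
Variables (H k : R) (A B : R -> R).
Hypothesis Hgt0 : 0 < H.
Hypothesis sys : variogram_eq H k A B.

Let A0 : A 0 = 0. Proof. by case: sys. Qed.
Let B0 : B 0 = 0. Proof. by case: sys. Qed.
Let dA x : 0 <= x -> is_derive x 1 A (B x). Proof. by case: sys => _ _ + _ _; exact. Qed.
Let dB x : 0 <= x -> is_derive x 1 B (1 - (k * x `^ (2 * H) - A x)).
Proof. by case: sys => _ _ _ + _; exact. Qed.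
Let ybnd x : 0 <= x -> 0 <= k * x `^ (2 * H) - A x <= 2.
Proof. by case: sys => _ _ _ _; exact. Qed.

(** The bound 0 <= y <= 2 gives |B'| = |1 - y| <= 1. *)
Lemma variogram_eq_B_bound x : 0 <= x -> - x <= B x <= x.
Proof.
move=> x0; apply/andP; split.
- rewrite -subr_ge0; have <- : B 0 - - 0 = 0 by rewrite B0; lra.
  apply: (@le_of_derive_cc _ (fun t => B t - - t)
    (fun t => (1 - (k * t `^ (2 * H) - A t)) - - 1)) => // t /andP[t0 _].
    by apply: is_derive_fB; exact: dB.
  by have := ybnd t0; lra.
- rewrite -subr_ge0; have <- : 0 - B 0 = 0 by rewrite B0; lra.
  apply: (@le_of_derive_cc _ (fun t => t - B t)
    (fun t => 1 - (1 - (k * t `^ (2 * H) - A t)))) => // t /andP[t0 _].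
    exact: (is_derive_fB (is_derive_fid _) (dB t0)).
  by have := ybnd t0; lra.
Qed.

Lemma is_derive_half_sqr t : is_derive t 1 (fun u : R => u ^+ 2 / 2) t.
Proof.
apply: is_derive_eq; rewrite /GRing.scale/=; lra.
Qed.

(** Integration of |B(t)| <= t. For H < 1 this makes A negligible near 0 against k t^(2H). *)
Lemma variogram_eq_A_diff s x : 0 <= s <= x ->
  - ((x ^+ 2 - s ^+ 2) / 2) <= A x - A s <= (x ^+ 2 - s ^+ 2) / 2.
Proof.
move=> /andP[s0 sx].
have h1 : A s - - (s ^+ 2 / 2) <= A x - - (x ^+ 2 / 2).
  apply: (@le_of_derive_cc _ (fun t => A t - - (t ^+ 2 / 2))
    (fun t => B t - - t)) => // t /andP[st _].
    apply: (is_derive_fB (dA (le_trans s0 st))).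
    exact: (is_derive_fN (is_derive_half_sqr t)).
  by have := variogram_eq_B_bound (le_trans s0 st); lra.
have h2 : s ^+ 2 / 2 - A s <= x ^+ 2 / 2 - A x.
  apply: (@le_of_derive_cc _ (fun t => t ^+ 2 / 2 - A t)
    (fun t => t - B t)) => // t /andP[st _].
    exact: (is_derive_fB (is_derive_half_sqr t) (dA (le_trans s0 st))).
  by have := variogram_eq_B_bound (le_trans s0 st); lra.
by apply/andP; split; lra.
Qed.

Lemma variogram_eq_A_bound x : 0 <= x -> - (x ^+ 2 / 2) <= A x <= x ^+ 2 / 2.
Proof.
move=> x0; have /variogram_eq_A_diff : 0 <= (0 : R) <= x by rewrite lexx.
by rewrite A0 expr0n/=; lra.
Qed.

(* e^(-t) (B + A) has derivative e^(-t) (1 - k t^(2H)) and tends to 0; this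
   replaces the identity k * Gamma (2H + 1) = 1. *)
Definition laplace_primitive t : R := expR (- t) * (B t + A t).

(** The unknown A cancels: B' + A' - (B + A) = (1 - k t^(2H) + A) + B - (B + A). *)
Lemma is_derive_laplace_primitive t : 0 <= t ->
  is_derive t 1 laplace_primitive (expR (- t) * (1 - k * t `^ (2 * H))).
Proof.
move=> t0.
have dE : is_derive t 1 (fun u : R => expR (- u)) (expR (- t) * -1).
  exact: (is_derive_fcomp (is_derive_expR _) (is_derive_fN (is_derive_fid t))).
have := is_derive_fM dE (is_derive_fD (dB t0) (dA t0)).
by move=> /is_derive_eq; apply; ring.
Qed.

Lemma laplace_primitive0 : laplace_primitive 0 = 0.
Proof. by rewrite /laplace_primitive A0 B0 addr0 mulr0. Qed.

(** For T >= 2, |B + A| <= T + T^2 / 2 <= T^2, against e^T >= (1 + T / 3)^3 >= T^3 / 27. Only the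
    convergence to 0 matters. *)
Lemma laplace_primitive_bound T : 2 <= T -> `|laplace_primitive T| <= 54 / T.
Proof.
move=> T2; have T0 : 0 < T by lra.
have /andP[a1 a2] := variogram_eq_A_bound (ltW T0).
have /andP[b1 b2] := variogram_eq_B_bound (ltW T0).
have e3 : T ^+ 3 / 27 <= expR T.
  have -> : expR T = expR (T / 3) ^+ 3.
    by rewrite -expRM_natr; congr expR; lra.
  have -> : T ^+ 3 / 27 = (T / 3) ^+ 3 by field.
  rewrite lerXn2r ?nnegrE ?expR_ge0//; first lra.
  by have := expR_ge1Dx (T / 3); lra.
rewrite /laplace_primitive normrM ger0_norm ?expR_ge0//.
have BA : `|B T + A T| <= T ^+ 2.
  rewrite ler_norml; have : T <= T ^+ 2 / 2 by rewrite expr2; nra.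
  by move=> ?; apply/andP; split; lra.
apply: (@le_trans _ _ (expR (- T) * T ^+ 2)).
  by rewrite ler_wpM2l ?expR_ge0.
rewrite expRN mulrC ler_pdivrMr ?expR_gt0//.
apply: (@le_trans _ _ (54 / T * (T ^+ 3 / 27))).
  have -> : 54 / T * (T ^+ 3 / 27) = T ^+ 2 * 2 by field; rewrite gt_eqF.
  by have := sqr_ge0 T; lra.
by rewrite ler_wpM2l// divr_ge0// ltW.
Qed.

(** Crude bounds, uniform in H. Above: y(1) <= 2 and A(1) <= 1/2. Below: k < 1/8 would keep y <= 5/8
    on [0, 1], hence B' >= 1/4 and A(1) >= 1/8 > k, against y(1) >= 0. *)
Lemma variogram_eq_k_bounds : 8^-1 <= k <= 5 / 2.
Proof.
have := ybnd ler01; rewrite powR1 mulr1 => /andP[y0 y2].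
have /variogram_eq_A_bound := @ler01 R; rewrite expr1n => /andP[a1 a2].
apply/andP; split; last by lra.
rewrite leNgt; apply/negP => k8.
have hb x : 0 <= x <= 1 -> x / 4 <= B x.
  move=> /andP[x0 x1]; rewrite -subr_ge0.
  have <- : B 0 - 0 / 4 = 0 by rewrite B0; lra.
  apply: (@le_of_derive_cc _ (fun t => B t - t / 4)
    (fun t => (1 - (k * t `^ (2 * H) - A t)) - 1 / 4)) => // t /andP[t0 tx].
    apply: (is_derive_fB (dB t0)).
    have := is_derive_fM (is_derive_fid t) (is_derive_fcst (4^-1) t).
    by move/is_derive_eq; apply; lra.
  have /andP[aa _] := variogram_eq_A_bound t0.
  have H20 : 0 <= 2 * H by rewrite mulr_ge0// ltW.
  have tp : t `^ (2 * H) <= 1.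
    have [->|tn0] := eqVneq t 0; first by rewrite powR0// mulf_neq0// gt_eqF.
    have t01 : 0 < t <= 1 by rewrite lt_neqAle eq_sym tn0 t0 (le_trans tx x1).
    by have := ger_powR t01 H20; rewrite powRr0.
  have tp0 : 0 <= t `^ (2 * H) by exact: powR_ge0.
  have t2 : t ^+ 2 <= 1 by rewrite expr2; nra.
  have ky : k * t `^ (2 * H) <= 8^-1.
    have : 0 <= (8^-1 - k) * t `^ (2 * H) by rewrite mulr_ge0// subr_ge0 ltW.
    by lra.
  by lra.
have : 1 / 8 <= A 1.
  rewrite -subr_ge0.
  have <- : A 0 - 0 ^+ 2 / 8 = 0 by rewrite A0; lra.
  have -> : A 1 - 1 / 8 = A 1 - 1 ^+ 2 / 8 by lra.
  apply: (@le_of_derive_cc _ (fun t => A t - t ^+ 2 / 8)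
    (fun t => B t - t / 4)) => // t /andP[t0 t1].
    apply: (is_derive_fB (dA t0)).
    have := is_derive_fM (is_derive_half_sqr t) (is_derive_fcst (4^-1) t).
    have -> : (fun t : R => t ^+ 2 / 2 / 4) = (fun t => t ^+ 2 / 8).
      by apply/funext => u; lra.
    by move/is_derive_eq; apply; lra.
  by have := hb t; rewrite t0 t1; lra.
by lra.
Qed.

End one_solution.
End volterra.

(** * Comparison of the constants k for different Hurst parameters *)

Section comparison.
Context {R : realType}.
Implicit Types (H k x t r : R) (A B : R -> R).

Lemma powRD_gt0 (a x y : R) : 0 < a -> a `^ (x + y) = a `^ x * a `^ y.
Proof. by move=> a0; rewrite powRD// (gt_eqF a0) implybT. Qed.

Lemma powR_ge1Dln (u q : R) : 0 < u -> 1 + q * ln u <= u `^ q.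
Proof. by move=> u0; rewrite /powR gt_eqF// expR_ge1Dx. Qed.

Lemma powR_ge1 (u q : R) : 1 <= u -> 0 <= q -> 1 <= u `^ q.
Proof. by move=> u1 q0; have := ler_powR u1 q0; rewrite powRr0. Qed.

Lemma powR_le1 (u q : R) : 0 < u <= 1 -> 0 <= q -> u `^ q <= 1.
Proof. by move=> u1 q0; have := ger_powR u1 q0; rewrite powRr0. Qed.

(** Let Psi be the difference of the two Laplace primitives. It gains at least c e^(-2) on [1, 2],
    is nondecreasing afterwards and tends to 0, so Psi(1) <= - c e^(-2). *)
Lemma variogram_eq_late_gap H1 k1 A1 B1 H2 k2 A2 B2 (c m : R) :
  0 < H1 -> 0 < H2 ->
  variogram_eq H1 k1 A1 B1 -> variogram_eq H2 k2 A2 B2 -> 0 <= c ->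
  (forall t, 1 <= t -> c <= k2 * t `^ (2 * H2) - k1 * t `^ (2 * H1)) ->
  - m <= laplace_primitive A1 B1 1 - laplace_primitive A2 B2 1 ->
  c * expR (- 2) <= m.
Proof.
move=> H10 H20 s1 s2 c0 gap Psi1.
pose Psi t := laplace_primitive A1 B1 t - laplace_primitive A2 B2 t.
have dPsi t : 0 <= t -> is_derive t 1 Psi
    (expR (- t) * (k2 * t `^ (2 * H2) - k1 * t `^ (2 * H1))).
  move=> t0; have := is_derive_fB (is_derive_laplace_primitive s1 t0)
    (is_derive_laplace_primitive s2 t0).
  by move/is_derive_eq; apply; ring.
have Psi12 : Psi 1 - c * expR (- 2) * 1 <= Psi 2 - c * expR (- 2) * 2.
  apply: (@le_of_derive_cc _ (fun t => Psi t - c * expR (- 2) * t)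
    (fun t => expR (- t) * (k2 * t `^ (2 * H2) - k1 * t `^ (2 * H1)) -
      c * expR (- 2) * 1)); first by rewrite ler1n.
    move=> t /andP[t1 t2].
    exact: (is_derive_fB (dPsi t (le_trans ler01 t1))
      (is_derive_fZ _ (is_derive_fid t))).
  move=> t /andP[t1 t2]; rewrite mulr1 subr_ge0 mulrC.
  by apply: ler_pM; rewrite ?expR_ge0// ?ler_expR ?lerN2// gap.
have PsiT T : 2 <= T -> Psi 2 <= Psi T.
  move=> T2; apply: (@le_of_derive_cc _ Psi _ _ _ T2).
    by move=> t /andP[t1 _]; apply: dPsi; exact: le_trans t1.
  move=> t /andP[t1 _]; rewrite mulr_ge0 ?expR_ge0//.
  by rewrite (le_trans c0)// gap// (le_trans _ t1)// ler1n.
rewrite leNgt; apply/negP => gt0.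
pose g := c * expR (- 2) - m; have g0 : 0 < g by rewrite subr_gt0.
(* At this T the two tails, at most 54 / T each, add up to less than g. *)
pose T := 2 + 108 / g; have T2 : 2 <= T by rewrite lerDl divr_ge0// ltW.
have := PsiT T T2.
have := laplace_primitive_bound s1 T2; have := laplace_primitive_bound s2 T2.
rewrite !ler_norml => /andP[b1 b2] /andP[b3 b4].
have : 54 / T + 54 / T < g.
  rewrite -mulrDl ltr_pdivrMr ?(lt_le_trans _ T2)//.
  rewrite /T mulrDr mulrC mulrCA mulfV ?gt_eqF// mulr1; lra.
have : Psi 1 + c * expR (- 2) <= Psi 2 by lra.
rewrite /Psi /g => ? ? ?; lra.
Qed.

(** If k < k', the derivative e^(-t) (k' - k) t^(2H) of Psi is nonnegative, so Psi(1) >= Psi(0) = 0,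
    while the gap on [1, oo) is at least c = k' - k. [variogram_eq_late_gap] with m = 0 gives c
    e^(-2) <= 0. *)
Lemma variogram_eq_k_unique H k1 A1 B1 k2 A2 B2 : 0 < H ->
  variogram_eq H k1 A1 B1 -> variogram_eq H k2 A2 B2 -> k1 = k2.
Proof.
move=> H0; suff le12 k A B k' A' B' : variogram_eq H k A B ->
    variogram_eq H k' A' B' -> k' <= k.
  by move=> s1 s2; apply/eqP; rewrite eq_le (le12 _ _ _ _ _ _ s1 s2)
    (le12 _ _ _ _ _ _ s2 s1).
move=> s1 s2; rewrite leNgt; apply/negP => kk'.
have dPsi t : 0 <= t -> is_derive t 1
    (fun t => laplace_primitive A B t - laplace_primitive A' B' t)
    (expR (- t) * ((k' - k) * t `^ (2 * H))).
  move=> t0; have := is_derive_fB (is_derive_laplace_primitive s1 t0)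
    (is_derive_laplace_primitive s2 t0).
  by move/is_derive_eq; apply; ring.
have : (k' - k) * expR (- 2) <= 0.
  apply: (variogram_eq_late_gap H0 H0 s1 s2); first by rewrite subr_ge0 ltW.
    move=> t t1; rewrite -mulrBl ler_peMr ?subr_ge0 ?(ltW kk')//.
    by rewrite powR_ge1// mulr_ge0// ltW.
  have <- : laplace_primitive A B 0 - laplace_primitive A' B' 0 = - 0.
    by rewrite (laplace_primitive0 s1) (laplace_primitive0 s2) subrr oppr0.
  apply: (@le_of_derive_cc _
    (fun t => laplace_primitive A B t - laplace_primitive A' B' t) _ _ _ ler01).
    by move=> t /andP[t0 _]; exact: dPsi.
  move=> t _; rewrite mulr_ge0 ?expR_ge0// mulr_ge0 ?powR_ge0//.
  by rewrite subr_ge0 ltW.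
by rewrite leNgt mulr_gt0 ?expR_gt0// subr_gt0.
Qed.

(** Suppose the reverse inequality and put q = 2 (H_2 - H_1). On [0, r] Psi loses at most k_1 q r,
    on [r, 1] it does not decrease, and beyond 1 the gap is at least 2 k_1 q because ln (t / r) >=
    2. Hence 2 k_1 q e^(-2) <= k_1 q r, impossible for r <= e^(-2). In closed form k = 1 / Gamma(2H
    + 1), and any r <= e^(-gamma), with gamma Euler's constant, would do; the cruder e^(-2) avoids
    the digamma function. *)
Lemma variogram_eq_k_compare H1 k1 A1 B1 H2 k2 A2 B2 r :
  0 < H1 < H2 -> 0 < r <= expR (- 2) ->
  variogram_eq H1 k1 A1 B1 -> variogram_eq H2 k2 A2 B2 ->
  k2 * r `^ (2 * H2) < k1 * r `^ (2 * H1).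
Proof.
move=> /andP[H10 H12] /andP[r0 r2] s1 s2.
have H20 : 0 < H2 := lt_trans H10 H12.
have k10 : 0 < k1 by have := variogram_eq_k_bounds H10 s1; lra.
rewrite ltNge; apply/negP => kr.
pose q := 2 * (H2 - H1).
have q0 : 0 < q by rewrite mulr_gt0// subr_gt0.
have H2E : 2 * H2 = 2 * H1 + q by rewrite /q; ring.
clearbody q.
have r1 : r < 1 by rewrite (le_lt_trans r2)// expR_lt1 oppr_lt0.
have kq : k1 <= k2 * r `^ q.
  move: kr; rewrite H2E powRD_gt0// mulrCA mulrC ler_pM2l// powR_gt0//.
(* The reverse inequality reads k_1 <= k_2 r^q; it eliminates k_2 and leaves the sign of (t / r)^q -
   1. *)
have ratio t : 0 < t ->
    k1 * t `^ (2 * H1) * ((t / r) `^ q - 1) <=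
    k2 * t `^ (2 * H2) - k1 * t `^ (2 * H1).
  move=> t0; have tr : t `^ q = (t / r) `^ q * r `^ q.
    by rewrite -powRM ?divfK ?gt_eqF// ?divr_ge0 ?ltW.
  rewrite H2E powRD_gt0// tr mulrBr mulr1 lerD2r.
  rewrite -subr_ge0 (_ : _ - _ = t `^ (2 * H1) * (t / r) `^ q * (k2 * r `^ q - k1)).
    by rewrite !mulr_ge0 ?powR_ge0// subr_ge0.
  by ring.
have dPsi t : 0 <= t -> is_derive t 1
    (fun t => laplace_primitive A1 B1 t - laplace_primitive A2 B2 t)
    (expR (- t) * (k2 * t `^ (2 * H2) - k1 * t `^ (2 * H1))).
  move=> t0; have := is_derive_fB (is_derive_laplace_primitive s1 t0)
    (is_derive_laplace_primitive s2 t0).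
  by move/is_derive_eq; apply; ring.
pose Psi t := laplace_primitive A1 B1 t - laplace_primitive A2 B2 t.
pose s := 2 * H1 + 1.
have s0 : 1 < s by rewrite ltrDr mulr_gt0.
(* Primitive of k_1 t^(2 H_1) (1 - (t / r)^q), which dominates - Psi' on (0, r). Its exact value at
   r carries the factor q = s + q - s. *)
pose F t := k1 * (t `^ s / s - (r `^ q)^-1 * (t `^ (s + q) / (s + q))).
have rq0 : 0 < r `^ q by exact: powR_gt0.
have dF t : 0 < t ->
    is_derive t 1 F (k1 * (t `^ (2 * H1) * (1 - (t / r) `^ q))).
  move=> t0.
  have dp (a : R) : 0 < a -> is_derive t 1 (fun u => u `^ a / a) (t `^ (a - 1)).
    move=> a0; have := is_derive_fM (is_derive1_powR a t0) (is_derive_fcst a^-1 t).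
    by move/is_derive_eq; apply; rewrite mulr0 add0r mulrA mulVf ?gt_eqF// mul1r.
  have s00 : 0 < s by exact: lt_trans s0.
  have := is_derive_fZ k1 (is_derive_fB (dp s s00)
    (is_derive_fZ (r `^ q)^-1 (dp (s + q) (addr_gt0 s00 q0)))).
  move/is_derive_eq; apply; congr (_ * _).
  rewrite (_ : s + q - 1 = 2 * H1 + q); last by rewrite /s; ring.
  rewrite (_ : s - 1 = 2 * H1); last by rewrite /s; ring.
  rewrite powRD_gt0// mulrBr mulr1; congr (_ - _).
  rewrite (_ : t `^ q = (t / r) `^ q * r `^ q); last first.
    by rewrite -powRM ?divfK ?gt_eqF// ?divr_ge0 ?ltW.
  by field; rewrite gt_eqF.
have PsiF : 0 <= Psi r + F r.
  have <- : Psi 0 + F 0 = 0.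
    rewrite /Psi (laplace_primitive0 s1) (laplace_primitive0 s2) /F.
    by rewrite !powR0 ?gt_eqF//; [ring|lra|lra].
  apply: (@le_of_derive _ (fun t => Psi t + F t) (fun t =>
      expR (- t) * (k2 * t `^ (2 * H2) - k1 * t `^ (2 * H1)) +
      k1 * (t `^ (2 * H1) * (1 - (t / r) `^ q))) _ _ (ltW r0)).
  - have cP : {within `[0, r], continuous Psi}.
      apply: continuous_in_subspaceT => u; rewrite inE/= in_itv/= => /andP[u0 _].
      exact: (is_derive_continuous (dPsi u u0)).
    have c1 (a : R) : 0 < a -> {within `[0, r], continuous (fun u : R => u `^ a / a)}.
      move=> a0 u; apply: cvgM; first exact: (within_continuous_powR a0 r0).
      exact: cvg_cst.
    move=> u; apply: cvgD; first exact: cP.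
    apply: cvgM; first exact: cvg_cst.
    apply: cvgB; first by apply: c1; lra.
    by apply: cvgM; [exact: cvg_cst|apply: c1; lra].
  - by move=> t /andP[t0 _]; exact: (is_derive_fD (dPsi t (ltW t0)) (dF t t0)).
  - move=> t /andP[t0 tr].
    have tr1 : (t / r) `^ q <= 1.
      by apply: powR_le1; [rewrite divr_gt0//= ler_pdivrMr// mul1r ltW|exact: ltW].
    have := ratio t t0; set d := k2 * _ - _; set z := (t / r) `^ q.
    move=> hd; rewrite -/z in tr1.
    have e1 : expR (- t) <= 1 by rewrite expR_le1 oppr_le0 ltW.
    have e0 : 0 <= expR (- t) by exact: expR_ge0.
    have : - (k1 * (t `^ (2 * H1) * (1 - z))) <= d by rewrite -mulrA in hd; nra.
    have : 0 <= k1 * (t `^ (2 * H1) * (1 - z)).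
      by rewrite mulr_ge0 ?(ltW k10)// mulr_ge0 ?powR_ge0// subr_ge0.
    set p := k1 * _ => p0 pd; have [d0|d0] := leP 0 d; first by nra.
    nra.
have Fr : F r <= k1 * q * r.
  have -> : F r = k1 * (r `^ (2 * H1) * r * (s^-1 - (s + q)^-1)).
    rewrite /F /s !powRD_gt0// powRr1 ?ltW//; congr (_ * _).
    by field; rewrite !gt_eqF//; lra.
  rewrite -(mulrA k1 q r) ler_pM2l//.
  have -> : s^-1 - (s + q)^-1 = q / (s * (s + q)) by field; rewrite !gt_eqF//; lra.
  have rh : r `^ (2 * H1) <= 1 by apply: powR_le1; [rewrite r0 ltW|rewrite mulr_ge0// ltW].
  have D1 : 1 <= s * (s + q) by nra.
  have Xi : r `^ (2 * H1) * (s * (s + q))^-1 <= 1.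
    by rewrite mulr_ile1 ?powR_ge0 ?invr_ge0 ?invf_le1//; lra.
  rewrite (_ : _ * _ * _ = q * r * (r `^ (2 * H1) * (s * (s + q))^-1)); last by ring.
  by rewrite ger_pMr// mulr_gt0.
have : k1 * q * 2 * expR (- 2) <= k1 * q * r.
  apply: (variogram_eq_late_gap H10 H20 s1 s2).
  - by apply: mulr_ge0; [apply: mulr_ge0; exact: ltW|].
  - move=> t t1; have t0 : 0 < t by rewrite (lt_le_trans _ t1).
    apply: le_trans (ratio t t0).
    have lr : ln r <= - 2 by rewrite -(expRK (- 2)) ler_ln// posrE expR_gt0.
    have : 1 + q * ln (t / r) <= (t / r) `^ q by apply: powR_ge1Dln; rewrite divr_gt0.
    rewrite ln_div ?posrE// => h1.
    have t2 : 1 <= t `^ (2 * H1) by apply: powR_ge1 => //; rewrite mulr_ge0// ltW.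
    have lt0 : 0 <= ln t by rewrite ln_ge0.
    have : q * 2 <= (t / r) `^ q - 1 by nra.
    move=> h2; rewrite -!mulrA ler_pM2l//.
    have : 0 <= q * 2 by rewrite mulr_ge0// ltW.
    by nra.
  - apply: (@le_trans _ _ (Psi r)); first by lra.
    apply: (@le_of_derive_cc _ Psi _ _ _ (ltW r1)).
      by move=> t /andP[rt _]; apply: dPsi; rewrite (le_trans (ltW r0)).
    move=> t /andP[rt _]; have t0 : 0 < t := lt_le_trans r0 rt.
    rewrite mulr_ge0 ?expR_ge0// (le_trans _ (ratio t t0))//.
    rewrite !mulr_ge0 ?powR_ge0 ?(ltW k10)// subr_ge0 powR_ge1 ?(ltW q0)//.
    by rewrite ler_pdivlMr// mul1r.
rewrite -mulrA ler_pM2l ?mulr_gt0//.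
have := expR_gt0 (- 2 : R); lra.
Qed.

End comparison.

(** * Injectivity of the variogram, with H known or xi known *)

Section identifiability.
Context {R : realType}.
Implicit Types (H k x t r xi : R) (A B : R -> R).

Lemma convex_lower_bound (W DW w : R -> R) (m T : R) :
  W 0 = 0 -> DW 0 = 0 ->
  (forall t, 0 <= t <= T -> is_derive t 1 W (DW t)) ->
  (forall t, 0 <= t <= T -> is_derive t 1 DW (w t)) ->
  (forall t, 0 <= t <= T -> m <= w t) ->
  forall t, 0 <= t <= T -> m * (t ^+ 2 / 2) <= W t.
Proof.
move=> W0 DW0 dW dDW wm t /andP[t0 tT].
have sub u : 0 <= u <= t -> 0 <= u <= T.
  by move=> /andP[-> ut]/=; exact: le_trans tT.
have DWm u : 0 <= u <= t -> m * u <= DW u.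
  move=> /andP[u0 ut]; rewrite -subr_ge0.
  have <- : DW 0 - m * 0 = 0 by rewrite DW0; ring.
  apply: (@le_of_derive_cc _ (fun t => DW t - m * t) (fun t => w t - m * 1)) => //.
    move=> v /andP[v0 vu]; apply: (is_derive_fB (dDW v _) (is_derive_fZ _ (is_derive_fid v))).
    by apply: sub; rewrite v0 (le_trans vu).
  by move=> v /andP[v0 vu]; rewrite mulr1 subr_ge0 wm// sub// v0 (le_trans vu).
rewrite -subr_ge0.
have <- : W 0 - m * (0 ^+ 2 / 2) = 0 by rewrite W0; ring.
apply: (@le_of_derive_cc _ (fun t => W t - m * (t ^+ 2 / 2)) (fun t => DW t - m * t)) => //.
  move=> v vt; apply: (is_derive_fB (dW v (sub v vt)) (is_derive_fZ _ (is_derive_half_sqr v))).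
by move=> v vt; rewrite subr_ge0 DWm.
Qed.

(* The kernel of W'' |-> W is nonnegative, so w = e + c W with e > 0 cannot
   reach a negative minimum. *)
Lemma volterra_pos (W DW w e : R -> R) (c T : R) : 0 < T -> 0 <= c ->
  c * T ^+ 2 < 2 ->
  W 0 = 0 -> DW 0 = 0 ->
  (forall t, 0 <= t <= T -> is_derive t 1 W (DW t)) ->
  (forall t, 0 <= t <= T -> is_derive t 1 DW (w t)) ->
  {within `[0, T], continuous w} ->
  (forall t, 0 <= t <= T -> e t + c * W t <= w t) ->
  (forall t, 0 <= t <= T -> 0 <= e t) ->
  forall t, 0 <= t <= T -> e t <= w t.
Proof.
move=> T0 c0 cT W0 DW0 dW dDW cw wE e0.
have w0 t : 0 <= t <= T -> 0 <= w t.
  have [s sT smin] := EVT_min (ltW T0) cw.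
  move=> tT; apply: le_trans (smin t _); last by rewrite in_itv.
  rewrite in_itv/= in sT; rewrite leNgt; apply/negP => ws0.
  have := @convex_lower_bound W DW w (w s) T W0 DW0 dW dDW _ s sT.
  have wm u : 0 <= u <= T -> w s <= w u by move=> uT; apply: smin; rewrite in_itv.
  move=> /(_ wm) Ws.
  have := wE s sT; have := e0 s sT => es ws.
  case/andP: sT => s0 sT.
  have s2 : c * s ^+ 2 <= c * T ^+ 2 by rewrite ler_wpM2l// lerXn2r ?nnegrE ?(ltW T0).
  have : c * (w s * (s ^+ 2 / 2)) <= c * W s by rewrite ler_wpM2l.
  (* At a minimum s with w(s) < 0, W(s) >= w(s) s^2 / 2; since c s^2 / 2 < 1, the inequality w >= e
     + c W would put w(s) strictly above itself. *)
  have : w s < (c * s ^+ 2 / 2) * w s by rewrite -{1}[w s]mul1r ltr_nM2r//; lra.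
  by lra.
move=> t tT; apply: le_trans (wE t tT); rewrite lerDl mulr_ge0//.
have := @convex_lower_bound W DW w 0 T W0 DW0 dW dDW w0 t tT.
by rewrite mul0r.
Qed.

Lemma within_continuous_variogram H k A B (c b : R) : 0 < H -> 0 < c -> 0 < b ->
  variogram_eq H k A B ->
  {within `[0, b], continuous (fun t => k * (c * t) `^ (2 * H) - A (c * t))}.
Proof.
move=> H0 c0 b0 [_ _ dA _ _] x.
apply: cvgB.
  apply: cvgM; first exact: cvg_cst.
  have : {within `[0, b], continuous (fun t : R => c `^ (2 * H) * t `^ (2 * H))}.
    move=> t; apply: cvgM; first exact: cvg_cst.
    by apply: within_continuous_powR => //; rewrite mulr_gt0.
  have E : {in `[0, b]%classic, (fun t : R => c `^ (2 * H) * t `^ (2 * H)) =1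
      (fun t => (c * t) `^ (2 * H))}.
    by move=> t; rewrite inE/= in_itv/= => /andP[t0 _]; rewrite powRM// ltW.
  by move/(subspace_eq_continuous E); exact.
have : {within `[0, b], continuous (fun t => A (c * t))}.
  apply: continuous_in_subspaceT => t; rewrite inE/= in_itv/= => /andP[t0 _].
  apply: is_derive_continuous; apply: is_derive_fcomp (is_derive_fZ c (is_derive_fid t)).
  by apply: dA; rewrite mulr_ge0// ltW.
exact.
Qed.

Lemma within_continuous_variogram1 H k A B (b : R) : 0 < H -> 0 < b ->
  variogram_eq H k A B ->
  {within `[0, b], continuous (fun t => k * t `^ (2 * H) - A t)}.
Proof.
move=> H0 b0 sys; have := within_continuous_variogram H0 ltr01 b0 sys.
suff -> : (fun t : R => k * (1 * t) `^ (2 * H) - A (1 * t)) =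
    (fun t => k * t `^ (2 * H) - A t) by [].
by apply/funext => t; rewrite mul1r.
Qed.

Lemma is_derive_rescale (c : R) (F F' : R -> R) t : is_derive (c * t) 1 F (F' (c * t)) ->
  is_derive t 1 (fun u => F (c * u)) (c * F' (c * t)).
Proof.
move=> dF; have := is_derive_fcomp dF (is_derive_fZ c (is_derive_fid t)).
by move/is_derive_eq; apply; rewrite mulr1 mulrC.
Qed.

(** Since k_1 = k_2, the difference w of the variograms satisfies w = W with W'' = w, and
    [volterra_pos] with e = 0 applies in both directions. On [0, 1] the condition c T^2 < 2 holds;
    h_0 will keep xi h there. *)
Lemma variogram_eq_unique H k1 A1 B1 k2 A2 B2 : 0 < H ->
  variogram_eq H k1 A1 B1 -> variogram_eq H k2 A2 B2 ->
  forall x, 0 <= x <= 1 ->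
    k1 * x `^ (2 * H) - A1 x = k2 * x `^ (2 * H) - A2 x.
Proof.
move=> H0; suff le12 k A B k' A' B' : variogram_eq H k A B ->
    variogram_eq H k' A' B' -> forall x, 0 <= x <= 1 ->
    k' * x `^ (2 * H) - A' x <= k * x `^ (2 * H) - A x.
  move=> s1 s2 x x01; apply/eqP; rewrite eq_le.
  by rewrite (le12 _ _ _ _ _ _ s1 s2)// (le12 _ _ _ _ _ _ s2 s1).
move=> s1 s2 x x01; rewrite -subr_ge0.
have kk : k = k' := variogram_eq_k_unique H0 s1 s2.
have c1 := within_continuous_variogram1 H0 ltr01 s1.
have c2 := within_continuous_variogram1 H0 ltr01 s2.
case: s1 => A0 B0 dA dB _; case: s2 => A0' B0' dA' dB' _.
apply: (@volterra_pos (fun t => A' t - A t) (fun t => B' t - B t)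
  (fun t => k * t `^ (2 * H) - A t - (k' * t `^ (2 * H) - A' t))
  (fun=> 0) 1 1) => //.
- by rewrite expr1n mulr1 ltr1n.
- by rewrite A0 A0' subrr.
- by rewrite B0 B0' subrr.
- by move=> t /andP[t0 _]; exact: (is_derive_fB (dA' t t0) (dA t t0)).
- move=> t /andP[t0 _]; have := is_derive_fB (dB' t t0) (dB t t0).
  by move/is_derive_eq; apply; ring.
- by move=> t; apply: cvgB; [exact: c1|exact: c2].
- by move=> t _; rewrite kk; lra.
Qed.

(** Strict growth near 0: k (t^(2H) - s^(2H)) beats A(t) - A(s) <= (t^2 - s^2) / 2. By uniqueness
    both values are read on the same variogram. *)
Lemma variogram_eq_hurst_known H : 0 < H < 1 -> exists2 d : R, 0 < d &
  forall k1 A1 B1 k2 A2 B2 x1 x2,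
    variogram_eq H k1 A1 B1 -> variogram_eq H k2 A2 B2 ->
    0 < x1 <= d -> 0 < x2 <= d ->
    k1 * x1 `^ (2 * H) - A1 x1 = k2 * x2 `^ (2 * H) - A2 x2 -> x1 = x2.
Proof.
move=> /andP[H0 H1].
(* For t <= [d0], t^(2 - 2H) <= H / 8, that is t^(2H) >= (8 / H) t^2; the 8 compensates k >= 1/8. *)
pose d0 : R := (H / 8) `^ (2 - 2 * H)^-1.
have e0 : 0 < 2 - 2 * H by lra.
have d00 : 0 < d0 by apply: powR_gt0; lra.
exists (Num.min 1 d0) => [|k1 A1 B1 k2 A2 B2 x1 x2 s1 s2].
  by rewrite lt_min ltr01.
rewrite !le_min => /andP[x10 /andP[x11 x1d]] /andP[x20 /andP[x21 x2d]].
rewrite -(variogram_eq_unique H0 s1 s2); last by rewrite x21 ltW.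
move=> E.
have incr (s t : R) : 0 < s < t -> t <= d0 ->
    k1 * s `^ (2 * H) - A1 s < k1 * t `^ (2 * H) - A1 t.
  move=> /andP[s0 st] td; have t0 := lt_trans s0 st.
  have st0 : 0 < s / t by rewrite divr_gt0.
  (* Young's inequality with exponents 1 / H and 1 / (1 - H), applied to (s / t)^(2H) and 1. *)
  have b1 : (s / t) `^ (2 * H) <= 1 - H * (1 - (s / t) ^+ 2).
    have := @conjugate_powR R ((s / t) `^ (2 * H)) 1 (H^-1) (1 - H)^-1.
    rewrite powR_ge0 ler01 !invrK => /(_ isT isT).
    rewrite -!powRrM !mulr1 powR1 mul1r -mulrA mulfV ?gt_eqF//.
    rewrite mulr1 powR_mulrn ?(ltW st0)// !invr_gt0 subr_gt0 => h.
    have := h H0 H1; rewrite addrC subrK => /(_ erefl); lra.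
  have k10 := variogram_eq_k_bounds H0 s1.
  have sE : s `^ (2 * H) = (s / t) `^ (2 * H) * t `^ (2 * H).
    by rewrite -powRM ?divfK ?gt_eqF ?divr_ge0// ltW.
  have tE : t ^+ 2 * (H / 8)^-1 <= t `^ (2 * H).
    rewrite ler_pdivrMr; last by lra.
    have -> : t ^+ 2 = t `^ (2 * H) * t `^ (2 - 2 * H).
      by rewrite -powRD_gt0// (addrC _ (2 - _)) subrK powR_mulrn// ltW.
    rewrite ler_pM2l ?powR_gt0//.
    apply: (@le_trans _ _ (d0 `^ (2 - 2 * H))).
      by apply: ge0_ler_powR => //; rewrite ?nnegrE; exact: ltW.
    by rewrite /d0 -powRrM mulVf ?gt_eqF// powRr1//; lra.
  have /(variogram_eq_A_diff s1) /andP[_ A12] : 0 <= s <= t by rewrite !ltW.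
  have st2 : 0 < t ^+ 2 - s ^+ 2 by rewrite subr_sqr mulr_gt0; lra.
  have : H * (1 - (s / t) ^+ 2) * (t ^+ 2 * (H / 8)^-1) <= t `^ (2 * H) - s `^ (2 * H).
    rewrite sE -{1}[t `^ _]mul1r -mulrBl; apply: ler_pM => //; last by lra.
      rewrite mulr_ge0 ?ltW// subr_gt0 expr_lt1// ?ltW//.
      by rewrite ltr_pdivrMr// mul1r.
    by rewrite mulr_ge0 ?sqr_ge0// invr_ge0; lra.
  rewrite (_ : H * _ * _ = 8 * (t ^+ 2 - s ^+ 2)); last first.
    by field; rewrite !gt_eqF.
  move=> h; have : 8^-1 * (t `^ (2 * H) - s `^ (2 * H)) <= k1 * (t `^ (2 * H) - s `^ (2 * H)).
    by rewrite ler_wpM2r//; lra.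
  lra.
case: (ltgtP x1 x2) => // x12.
- by have := incr x1 x2; rewrite E ltxx x10 x12 x2d => /(_ isT isT).
- by have := incr x2 x1; rewrite E ltxx x20 x12 x1d => /(_ isT isT).
Qed.

(** With a common xi both variograms are read at x. For H < H', w = e + W where e = k t^(2H) - k'
    t^(2H') is positive by [variogram_eq_k_compare], so w(x) >= e(x) > 0. *)
Lemma variogram_eq_drift_known H1 k1 A1 B1 H2 k2 A2 B2 x :
  0 < H1 -> 0 < H2 -> 0 < x <= expR (- 2) ->
  variogram_eq H1 k1 A1 B1 -> variogram_eq H2 k2 A2 B2 ->
  k1 * x `^ (2 * H1) - A1 x = k2 * x `^ (2 * H2) - A2 x -> H1 = H2.
Proof.
suff lt12 H k A B H' k' A' B' : 0 < H < H' -> 0 < x <= expR (- 2) ->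
    variogram_eq H k A B -> variogram_eq H' k' A' B' ->
    k' * x `^ (2 * H') - A' x < k * x `^ (2 * H) - A x.
  move=> H10 H20 x0 s1 s2 E; case: (ltgtP H1 H2) => // HH.
  - by have := lt12 _ _ _ _ _ _ _ _ _ x0 s1 s2; rewrite E ltxx H10 HH => /(_ isT).
  - by have := lt12 _ _ _ _ _ _ _ _ _ x0 s2 s1; rewrite E ltxx H20 HH => /(_ isT).
move=> HH /andP[x0 x2] s1 s2; case/andP: (HH) => H0 HH'.
have H0' := lt_trans H0 HH'.
have x1 : x < 1 by rewrite (le_lt_trans x2)// expR_lt1 oppr_lt0.
have epos t : 0 < t <= x -> 0 < k * t `^ (2 * H) - k' * t `^ (2 * H').
  move=> /andP[t0 tx]; rewrite subr_gt0.
  by apply: (variogram_eq_k_compare HH _ s1 s2); rewrite t0 (le_trans tx).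
have c1 := within_continuous_variogram1 H0 x0 s1.
have c2 := within_continuous_variogram1 H0' x0 s2.
case: s1 => A0 B0 dA dB _; case: s2 => A0' B0' dA' dB' _.
rewrite -subr_gt0.
apply: (@lt_le_trans _ _ (k * x `^ (2 * H) - k' * x `^ (2 * H'))).
  by apply: epos; rewrite x0 lexx.
apply: (@volterra_pos (fun t => A' t - A t) (fun t => B' t - B t)
  (fun t => k * t `^ (2 * H) - A t - (k' * t `^ (2 * H') - A' t))
  (fun t => k * t `^ (2 * H) - k' * t `^ (2 * H')) 1 x) => //.
- have : x ^+ 2 < 1 by rewrite expr_lt1// ltW.
  lra.
- by rewrite A0 A0' subrr.
- by rewrite B0 B0' subrr.
- by move=> t /andP[t0 _]; exact: (is_derive_fB (dA' t t0) (dA t t0)).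
- move=> t /andP[t0 _]; have := is_derive_fB (dB' t t0) (dB t t0).
  by move/is_derive_eq; apply; ring.
- by move=> t; apply: cvgB; [exact: c1|exact: c2].
- by move=> t _; lra.
- move=> t /andP[]; rewrite le_eqVlt => /predU1P[<- _|t0 tx].
    by rewrite !powR0 ?gt_eqF ?mulr_gt0// !mulr0 subrr.
  by rewrite ltW// epos// t0.
- by rewrite (ltW x0) lexx.
Qed.

End identifiability.

(** * Injectivity of the variogram, with sigma known *)

Section diffusion_known.
Context {R : realType}.

(** The equality of the k xi^(2H) expresses equal variances for a common sigma. Its logarithm,
    together with ln k_2 - ln k_1 < 4 (H_2 - H_1), bounds ln xi_1 - ln xi_2 by a multiple of H_2 -
    H_1. *)
Lemma drift_lipschitz (a be H1 H2 k1 k2 xi1 xi2 : R) (A1 B1 A2 B2 : R -> R) :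
  0 < a <= H1 -> H1 < H2 -> 0 < xi2 < xi1 -> xi1 <= be ->
  variogram_eq H1 k1 A1 B1 -> variogram_eq H2 k2 A2 B2 ->
  k1 * xi1 `^ (2 * H1) = k2 * xi2 `^ (2 * H2) ->
  xi1 ^+ 2 - xi2 ^+ 2 <= be ^+ 2 * (2 * (H2 - H1)) * ((2 + ln be) / a).
Proof.
move=> /andP[a0 aH1] H12 /andP[x20 x21] x1be s1 s2 kE.
have H10 := lt_le_trans a0 aH1; have H20 := lt_trans H10 H12.
have x10 := lt_trans x20 x21.
have be0 := lt_le_trans x10 x1be.
have k10 : 0 < k1 by have := variogram_eq_k_bounds H10 s1; lra.
have k20 : 0 < k2 by have := variogram_eq_k_bounds H20 s2; lra.
(* The comparison at the single point r = e^(-2), where ln r = -2, bounds the ratio of the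
   constants. *)
have kc : ln k2 - 4 * H2 < ln k1 - 4 * H1.
  have e2 : 0 < expR (- 2 : R) <= expR (- 2) by rewrite expR_gt0 lexx.
  have H120 : 0 < H1 < H2 by rewrite H10.
  have := variogram_eq_k_compare H120 e2 s1 s2.
  rewrite -ltr_ln ?posrE ?mulr_gt0 ?powR_gt0 ?expR_gt0//.
  rewrite !lnM ?posrE ?powR_gt0 ?expR_gt0// !ln_powR expRK.
  by move=> h; lra.
have lE : ln k1 + 2 * H1 * ln xi1 = ln k2 + 2 * H2 * ln xi2.
  by rewrite -!ln_powR -!lnM ?posrE ?powR_gt0// kE.
have l2 : ln xi2 <= ln be by rewrite ler_ln ?posrE// (le_trans (ltW x21)).
have l12 : 0 < ln xi1 - ln xi2 by rewrite subr_gt0 ltr_ln.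
have D : ln xi1 - ln xi2 <= (H2 - H1) * ((2 + ln be) / a).
  rewrite mulrA ler_pdivlMr//.
  have : (H2 - H1) * ln xi2 <= (H2 - H1) * ln be by rewrite ler_wpM2l// subr_ge0 ltW.
  have : (ln xi1 - ln xi2) * a <= (ln xi1 - ln xi2) * H1 by rewrite ler_wpM2l// ltW.
  by lra.
have -> : xi1 ^+ 2 - xi2 ^+ 2 = xi1 ^+ 2 * (1 - (xi2 / xi1) ^+ 2).
  by field; rewrite gt_eqF.
rewrite -mulrA; apply: ler_pM.
- exact: sqr_ge0.
- by rewrite subr_ge0 expr_le1 ?divr_ge0 ?(ltW x20) ?(ltW x10)// ler_pdivrMr// mul1r ltW.
- by rewrite lerXn2r ?nnegrE ?(ltW x10) ?(ltW x20) ?(ltW be0) ?(ltW x21)//.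
have -> : (xi2 / xi1) ^+ 2 = expR (- (2 * (ln xi1 - ln xi2))).
  rewrite -[in LHS](lnK (_ : xi2 / xi1 \is Num.pos)) ?posrE ?divr_gt0//.
  by rewrite -expRM_natl ln_div ?posrE//; congr expR; ring.
have := expR_ge1Dx (- (2 * (ln xi1 - ln xi2))); lra.
Qed.

(** In the time variable u, put w(u) = y_1(xi_1 u) - y_2(xi_2 u) and W(u) = A_2(xi_2 u) / xi_2^2 -
    A_1(xi_1 u) / xi_1^2, so that W'' = w and w = e + xi_2^2 W. The kernel argument reduces the
    claim to e > 0. There the drift term, when negative, is of order (H_2 - H_1) u^2, while the
    Hurst term carries an additional |ln u|. *)
Lemma variogram_eq_diffusion_known (a al be : R) : 0 < a -> 0 < al <= 1 -> 1 <= be ->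
  exists2 T : R, 0 < T &
  forall H1 H2 xi1 xi2 k1 A1 B1 k2 A2 B2 t, a <= H1 < 1 -> a <= H2 < 1 ->
    al <= xi1 <= be -> al <= xi2 <= be ->
    variogram_eq H1 k1 A1 B1 -> variogram_eq H2 k2 A2 B2 ->
    k1 * xi1 `^ (2 * H1) = k2 * xi2 `^ (2 * H2) -> 0 < t < T ->
    k1 * (xi1 * t) `^ (2 * H1) - A1 (xi1 * t) =
      k2 * (xi2 * t) `^ (2 * H2) - A2 (xi2 * t) -> H1 = H2.
Proof.
move=> a0 /andP[al0 al1] be1; have be0 : 0 < be := lt_le_trans ltr01 be1.
pose C := (2 + ln be) / a.
have C0 : 0 < C by rewrite divr_gt0// ltr_wpDr// ln_ge0.
(* [T1] makes y_1 <= 3 be^2 u^(2a) <= 1, the bound [be^-1] keeps xi u <= 1, and [T3] makes |ln u|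
   large enough for the Hurst term to win. *)
pose T1 : R := ((3 * be ^+ 2)^-1) `^ (2 * a)^-1.
pose T3 := expR (- (4 * be ^+ 2 * C / al ^+ 2 + 1)).
have b30 : 0 < (3 * be ^+ 2)^-1 by rewrite invr_gt0 mulr_gt0 ?exprn_gt0.
have T10 : 0 < T1 by apply: powR_gt0.
pose T := Num.min T1 (Num.min be^-1 T3).
have T0 : 0 < T by rewrite !lt_min T10 invr_gt0 be0 expR_gt0.
exists T => //.
suff lt12 H1 H2 xi1 xi2 k1 A1 B1 k2 A2 B2 t : a <= H1 -> H1 < H2 < 1 ->
    al <= xi1 <= be -> al <= xi2 <= be ->
    variogram_eq H1 k1 A1 B1 -> variogram_eq H2 k2 A2 B2 ->
    k1 * xi1 `^ (2 * H1) = k2 * xi2 `^ (2 * H2) -> 0 < t < T ->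
    k2 * (xi2 * t) `^ (2 * H2) - A2 (xi2 * t) <
    k1 * (xi1 * t) `^ (2 * H1) - A1 (xi1 * t).
  move=> H1 H2 xi1 xi2 k1 A1 B1 k2 A2 B2 t /andP[aH1 H11] /andP[aH2 H21] x1 x2 s1 s2 kE tT E.
  case: (ltgtP H1 H2) => // HH.
  - have := lt12 _ _ _ _ _ _ _ _ _ _ _ aH1 _ x1 x2 s1 s2 kE tT.
    by rewrite E ltxx HH H21 => /(_ isT).
  - have := lt12 _ _ _ _ _ _ _ _ _ _ _ aH2 _ x2 x1 s2 s1 (esym kE) tT.
    by rewrite E ltxx HH H11 => /(_ isT).
move=> aH1 /andP[H12 H21] /andP[alx1 x1be] /andP[alx2 x2be] s1 s2 kE /andP[t0 tT].
have H10 := lt_le_trans a0 aH1; have H20 := lt_trans H10 H12.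
have x10 := lt_le_trans al0 alx1; have x20 := lt_le_trans al0 alx2.
have H11 : H1 < 1 := lt_trans H12 H21.
have [k18 k152] : 8^-1 <= k1 /\ k1 <= 5 / 2 by apply/andP; exact: variogram_eq_k_bounds s1.
have uT u : 0 < u <= t -> [/\ u < 1, u * be <= 1, u `^ (2 * a) <= (3 * be ^+ 2)^-1
    & 4 * be ^+ 2 * C / al ^+ 2 < - ln u].
  move=> /andP[u0 ut]; have : u < T := le_lt_trans ut tT.
  rewrite !lt_min => /andP[uT1 /andP[ube uT3]]; split.
  - by rewrite (lt_le_trans ube)// invf_le1.
  - by rewrite -ler_pdivlMr// div1r ltW.
  - apply: (@le_trans _ _ (T1 `^ (2 * a))).
      apply: ge0_ler_powR; rewrite ?nnegrE; [|exact: ltW..].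
      by rewrite mulr_ge0// ltW.
    by rewrite /T1 -powRrM mulVf ?gt_eqF ?mulr_gt0// powRr1// ltW.
  - have : ln u < ln T3 by rewrite ltr_ln ?posrE ?expR_gt0.
    by rewrite /T3 expRK; lra.
pose k := k1 * xi1 `^ (2 * H1).
have kx u : 0 <= u -> k1 * (xi1 * u) `^ (2 * H1) = k * u `^ (2 * H1).
  by move=> u0; rewrite powRM ?(ltW x10)// mulrA.
have kx2 u : 0 <= u -> k2 * (xi2 * u) `^ (2 * H2) = k * u `^ (2 * H2).
  by move=> u0; rewrite powRM ?(ltW x20)// mulrA -kE.
have p1 : al ^+ 2 <= xi1 `^ (2 * H1).
  apply: (@le_trans _ _ (al `^ (2 * H1))).
    rewrite -powR_mulrn ?(ltW al0)//; apply: ger_powR; first by rewrite al0.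
    by rewrite ger_pMr// ltW.
  by apply: ge0_ler_powR; rewrite ?nnegrE ?mulr_ge0// ltW.
have p2 : xi1 `^ (2 * H1) <= be ^+ 2.
  apply: (@le_trans _ _ (be `^ (2 * H1))).
    by apply: ge0_ler_powR; rewrite ?nnegrE ?mulr_ge0// ltW.
  by rewrite -powR_mulrn ?(ltW be0)//; apply: ler_powR => //; rewrite ger_pMr// ltW.
have al20 : 0 < al ^+ 2 by rewrite exprn_gt0.
have be20 : 0 < be ^+ 2 by rewrite exprn_gt0.
have k_lb : al ^+ 2 / 8 <= k by rewrite /k; nra.
have k_ub : k <= 5 / 2 * be ^+ 2 by rewrite /k; nra.
have k0 : 0 < k by apply: lt_le_trans k_lb; rewrite divr_gt0.
have [_ _ dA1 dB1 _] := s1; have [_ _ dA2 dB2 _] := s2.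
(* As y_1 <= 1 up to time t, u |-> A_1(xi_1 u) is convex with vanishing value and slope at 0, hence
   nonnegative ([A1pos]). *)
have y1 u : 0 <= u <= t -> 0 <= xi1 * (xi1 * (1 - (k1 * (xi1 * u) `^ (2 * H1) - A1 (xi1 * u)))).
  move=> /andP[u0 ut]; rewrite !mulr_ge0 ?(ltW x10)// subr_ge0.
  have := u0; rewrite le_eqVlt => /predU1P[<-|u00].
    by rewrite mulr0 powR0 ?gt_eqF ?mulr_gt0//; case: s1 => ->; rewrite mulr0 subrr ler01.
  rewrite kx//; have [] := uT u; first by rewrite u00.
  move=> u1 ube ua _.
  have /(variogram_eq_A_bound s1) /andP[Alb _] : 0 <= xi1 * u by rewrite mulr_ge0// ltW.
  have u01 : 0 < u <= 1 by rewrite u00 ltW.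
  have ua1 : u `^ (2 * H1) <= u `^ (2 * a) by apply: ger_powR => //; rewrite ler_pM2l.
  have u2 : u ^+ 2 <= u `^ (2 * a).
    rewrite -powR_mulrn//; apply: ger_powR => //; rewrite ger_pMr//.
    by rewrite (le_trans aH1)// ltW.
  have : k * u `^ (2 * H1) <= 5 / 2 * be ^+ 2 * u `^ (2 * a).
    by apply: ler_pM; rewrite ?powR_ge0// ltW.
  have : (xi1 * u) ^+ 2 <= be ^+ 2 * u `^ (2 * a).
    rewrite exprMn; apply: ler_pM; rewrite ?sqr_ge0//.
    by rewrite lerXn2r ?nnegrE ?(ltW x10) ?(ltW be0)//.
  have : 3 * be ^+ 2 * u `^ (2 * a) <= 1.
    by rewrite mulrC -ler_pdivlMr ?mulr_gt0// mul1r.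
  by lra.
have A1_0 : A1 (xi1 * 0) = 0 by rewrite mulr0; case: s1.
have B1_0 : B1 (xi1 * 0) = 0 by rewrite mulr0; case: s1.
have A2_0 : A2 (xi2 * 0) = 0 by rewrite mulr0; case: s2.
have B2_0 : B2 (xi2 * 0) = 0 by rewrite mulr0; case: s2.
have x1u u : 0 <= u <= t -> 0 <= xi1 * u by move=> /andP[? _]; rewrite mulr_ge0// ltW.
have x2u u : 0 <= u <= t -> 0 <= xi2 * u by move=> /andP[? _]; rewrite mulr_ge0// ltW.
have dA1t u : 0 <= u <= t -> is_derive u 1 (fun v => A1 (xi1 * v)) (xi1 * B1 (xi1 * u)).
  by move=> uT'; apply: is_derive_rescale; apply: dA1; exact: x1u.
have dA2t u : 0 <= u <= t -> is_derive u 1 (fun v => A2 (xi2 * v)) (xi2 * B2 (xi2 * u)).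
  by move=> uT'; apply: is_derive_rescale; apply: dA2; exact: x2u.
have dB1t u : 0 <= u <= t -> is_derive u 1 (fun v => B1 (xi1 * v))
    (xi1 * (1 - (k1 * (xi1 * u) `^ (2 * H1) - A1 (xi1 * u)))).
  move=> uT'; apply: (@is_derive_rescale _ xi1 B1
    (fun x => 1 - (k1 * x `^ (2 * H1) - A1 x))); apply: dB1; exact: x1u.
have dB2t u : 0 <= u <= t -> is_derive u 1 (fun v => B2 (xi2 * v))
    (xi2 * (1 - (k2 * (xi2 * u) `^ (2 * H2) - A2 (xi2 * u)))).
  move=> uT'; apply: (@is_derive_rescale _ xi2 B2
    (fun x => 1 - (k2 * x `^ (2 * H2) - A2 x))); apply: dB2; exact: x2u.
have A1pos u : 0 <= u <= t -> 0 <= A1 (xi1 * u).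
  move=> uT'; have DW0 : xi1 * B1 (xi1 * 0) = 0 by rewrite B1_0 mulr0.
  have := @convex_lower_bound _ (fun v => A1 (xi1 * v))
    (fun v => xi1 * B1 (xi1 * v))
    (fun v => xi1 * (xi1 * (1 - (k1 * (xi1 * v) `^ (2 * H1) - A1 (xi1 * v)))))
    0 t A1_0 DW0 dA1t (fun v vT => is_derive_fZ _ (dB1t v vT)) y1 u uT'.
  by rewrite mul0r.
pose q := 2 * (H2 - H1).
have q0 : 0 < q by rewrite mulr_gt0// subr_gt0.
(* What is left of w once xi_2^2 W is subtracted: the difference of the powers, and a multiple of
   A_1 due to the two different drifts. *)
pose e u := k * (u `^ (2 * H1) - u `^ (2 * H2)) + (xi2 ^+ 2 / xi1 ^+ 2 - 1) * A1 (xi1 * u).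
have epos u : 0 < u <= t -> 0 < e u.
  move=> ut; have [u1 ube _ lu] := uT u ut; case/andP: ut => u0 ut.
  have x1u0 : 0 <= xi1 * u by rewrite mulr_ge0// ltW.
  have /(variogram_eq_A_bound s1) /andP[_ Aub] := x1u0.
  have u2 : u ^+ 2 <= u `^ (2 * H2).
    by rewrite -powR_mulrn ?(ltW u0)//; apply: ger_powR; rewrite ?u0 ?(ltW u1)// ger_pMr// ltW.
  have L0 : 0 < - ln u by apply: le_lt_trans lu; apply: ltW; rewrite divr_gt0// mulr_gt0// mulr_gt0.
  (* u^(2 H_1) = u^(2 H_2) u^(-q), and u^(-q) >= 1 + q |ln u|. *)
  have gap : u `^ (2 * H2) * (q * - ln u) <= u `^ (2 * H1) - u `^ (2 * H2).
    have -> : u `^ (2 * H1) = u `^ (2 * H2) * u^-1 `^ q.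
      rewrite -powR_inv1 ?ltW// -powRrM -powRD_gt0//; congr powR; rewrite /q; ring.
    rewrite -{3}[u `^ (2 * H2)]mulr1 -mulrBr ler_wpM2l ?powR_ge0//.
    have := @powR_ge1Dln _ u^-1 q; rewrite invr_gt0 => /(_ u0).
    by rewrite lnV ?posrE//; lra.
  have qL : 0 < q * - ln u by rewrite mulr_gt0.
  have g0 : u ^+ 2 * (q * - ln u) <= u `^ (2 * H1) - u `^ (2 * H2).
    by apply: le_trans gap; rewrite ler_wpM2r// ltW.
  have u20 : 0 < u ^+ 2 by rewrite exprn_gt0.
  have A1u : 0 <= A1 (xi1 * u) by apply: A1pos; rewrite ltW.
  have g1 : 0 < k * (u `^ (2 * H1) - u `^ (2 * H2)).
    by rewrite mulr_gt0// (lt_le_trans _ g0)// mulr_gt0.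
  (* If xi_1 <= xi_2 the drift term of e is nonnegative; otherwise [drift_lipschitz] bounds its size
     by a multiple of q u^2. *)
  have [x12|x21] := leP xi1 xi2.
    rewrite /e ltr_wpDr// mulr_ge0// subr_ge0 ler_pdivlMr ?exprn_gt0// mul1r.
    by rewrite lerXn2r ?nnegrE ?(ltW x10) ?(ltW x20)//.
  have D := @drift_lipschitz a be H1 H2 k1 k2 xi1 xi2 A1 B1 A2 B2.
  have {D} := D _ H12 _ x1be s1 s2 kE.
  rewrite a0 aH1 x20 x21 => /(_ isT isT); rewrite -/q -/C => D.
  have : (1 - xi2 ^+ 2 / xi1 ^+ 2) * A1 (xi1 * u) <= (xi1 ^+ 2 - xi2 ^+ 2) * (u ^+ 2 / 2).
    rewrite (_ : (xi1 ^+ 2 - _) * _ = (1 - xi2 ^+ 2 / xi1 ^+ 2) * ((xi1 * u) ^+ 2 / 2)).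
      by rewrite ler_wpM2l// subr_ge0 ler_pdivrMr ?exprn_gt0// mul1r lerXn2r ?nnegrE ?(ltW x10) ?(ltW x20) ?(ltW be0) ?(ltW x21)//.
    by field; rewrite gt_eqF.
  have : (xi1 ^+ 2 - xi2 ^+ 2) * (u ^+ 2 / 2) <= be ^+ 2 * q * C * (u ^+ 2 / 2).
    by rewrite ler_wpM2r// divr_ge0// ltW.
  have : k * (u ^+ 2 * (q * - ln u)) <= k * (u `^ (2 * H1) - u `^ (2 * H2)).
    by rewrite ler_wpM2l// ltW.
  (* Both sides contain the factor q u^2; the rest follows from k >= al^2 / 8 and the choice of
     [T3]. *)
  have : be ^+ 2 * q * C * (u ^+ 2 / 2) < k * (u ^+ 2 * (q * - ln u)).
    rewrite (_ : be ^+ 2 * _ * _ * _ = (be ^+ 2 * C / 2) * (u ^+ 2 * q)); last by ring.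
    rewrite (_ : k * _ = (k * - ln u) * (u ^+ 2 * q)); last by ring.
    rewrite (ltr_pM2r (mulr_gt0 u20 q0)).
    have : al ^+ 2 / 8 * - ln u <= k * - ln u by rewrite ler_wpM2r// ltW.
    apply: lt_le_trans; move: lu; rewrite ltr_pdivrMr//; lra.
  rewrite /e; lra.
rewrite -subr_gt0.
have tt : 0 < t <= t by rewrite t0 lexx.
apply: lt_le_trans (epos t tt) _.
have [t1 tbe _ _] := uT t tt.
apply: (@volterra_pos _
  (fun u => (xi2 ^+ 2)^-1 * A2 (xi2 * u) - (xi1 ^+ 2)^-1 * A1 (xi1 * u))
  (fun u => xi2^-1 * B2 (xi2 * u) - xi1^-1 * B1 (xi1 * u))
  (fun u => k1 * (xi1 * u) `^ (2 * H1) - A1 (xi1 * u) -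
            (k2 * (xi2 * u) `^ (2 * H2) - A2 (xi2 * u))) e (xi2 ^+ 2) t) => //.
- exact: sqr_ge0.
- rewrite -exprMn; apply: (@le_lt_trans _ _ 1); last by rewrite ltr1n.
  rewrite expr_le1 ?mulr_ge0 ?(ltW x20) ?(ltW t0)//.
  by apply: le_trans tbe; rewrite mulrC ler_wpM2l// ltW.
- by rewrite A1_0 A2_0; ring.
- by rewrite B1_0 B2_0; ring.
- move=> u ut; have := is_derive_fB (is_derive_fZ (xi2 ^+ 2)^-1 (dA2t u ut))
    (is_derive_fZ (xi1 ^+ 2)^-1 (dA1t u ut)).
  by move/is_derive_eq; apply; field; rewrite !gt_eqF.
- move=> u ut; have := is_derive_fB (is_derive_fZ xi2^-1 (dB2t u ut))
    (is_derive_fZ xi1^-1 (dB1t u ut)).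
  by move/is_derive_eq; apply; field; rewrite !gt_eqF.
- move=> u; apply: cvgB.
    exact: (within_continuous_variogram H10 x10 t0 s1).
  exact: (within_continuous_variogram H20 x20 t0 s2).
- move=> u /andP[u0 ut]; rewrite kx// kx2// /e.
  rewrite le_eqVlt; apply/orP; left; apply/eqP; field; rewrite !gt_eqF//.
- move=> u /andP[]; rewrite le_eqVlt => /predU1P[<- _|u0 ut].
    by rewrite /e A1_0 !powR0 ?gt_eqF ?mulr_gt0// subrr !mulr0 addr0.
  by rewrite ltW// epos// u0.
- by rewrite (ltW t0) lexx.
Qed.

End diffusion_known.

(** * The cosine transform of Gaussian laws *)

Section integral_tools.
Context d (T : measurableType d) {R : realType}.
Variable mu : {measure set T -> \bar R}.

Lemma Rdominated_cvg (f_ : nat -> T -> R) (f g : T -> R) :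
  (forall n, measurable_fun setT (f_ n)) -> measurable_fun setT f ->
  {ae mu, forall x, f_ ^~ x @ \oo --> f x} ->
  mu.-integrable setT (EFin \o g) ->
  (forall n x, `|f_ n x| <= g x) ->
  \int[mu]_x f_ n x @[n --> \oo] --> \int[mu]_x f x.
Proof.
move=> mf_ mf cf ig fg.
have [] := @dominated_convergence _ _ _ mu setT measurableT
  (fun n x => (f_ n x)%:E) (fun x => (f x)%:E) (fun x => (g x)%:E).
- by move=> n; exact/measurable_EFinP.
- exact/measurable_EFinP.
- apply: filterS cf => x + _.
  by move=> cfx; apply: cvg_EFin => //; exact: nearW.
- exact: ig.
- by apply: aeW => x n _; rewrite lee_fin.
move=> fi _ h.
have fin : (\int[mu]_x (f x)%:E)%E \is a fin_num by exact: integrable_fin_num.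
apply: fine_cvg; rewrite fineK//.
Qed.

Lemma is_derive_Rintegral (f f' : R -> T -> R) (G : T -> R) (a : R) :
  (forall x, mu.-integrable setT (EFin \o f x)) ->
  (forall (x : R) y, is_derive x (1 : R) (f ^~ y) (f' x y)) ->
  (forall x y, `|f' x y| <= G y) -> mu.-integrable setT (EFin \o G) ->
  is_derive a 1 (fun x => \int[mu]_y f x y) (\int[mu]_y f' a y).
Proof.
move=> fi df bf Gi.
have fE x y : partial1of2 f x y = f' x y.
  by rewrite partial1of2E; apply: derive_val.
have aI : `]a - 1, a + 1[%classic a by rewrite /= in_itv/=; apply/andP; split; lra.
have fi' (x : R) : `]a - 1, a + 1[%classic x -> mu.-integrable setT (EFin \o f x) by [].
have df' (x : R) (y : T) : `]a - 1, a + 1[%classic x -> [set: T] y -> derivable (f ^~ y) x 1.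
  by move=> _ _; apply: ex_derive.
have G0 y : 0 <= G y by exact: le_trans (bf 0 y).
have bf' (x : R) (y : T) : `]a - 1, a + 1[%classic x -> [set: T] y -> `|partial1of2 f x y| <= G y.
  by move=> _ _; rewrite fE.
split; first exact: (derivable_under_integral measurableT aI fi' df' G0 Gi bf').
rewrite -derive1E (differentiation_under_integral measurableT aI fi' df' G0 Gi bf').
by apply: eq_Rintegral => y _; rewrite fE.
Qed.

Lemma integrable_bounded_mul (h g : T -> R) (M : R) :
  measurable_fun setT h -> (forall x, `|h x| <= M) ->
  mu.-integrable setT (EFin \o g) -> mu.-integrable setT (EFin \o (fun x => h x * g x)).
Proof.
move=> mh hM gi.
have := integrableMr measurableT mh _ gi; apply.
exists M; split; first by rewrite num_real.
by move=> r Mr x _ /=; apply: le_trans (hM x) (ltW Mr).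
Qed.

End integral_tools.

Section whole_line.
Context {R : realType}.
Local Notation leb := (@lebesgue_measure R).

(** Fundamental theorem of calculus on [-n, n], then dominated convergence. Applied to the
    derivative of a product it is integration by parts without boundary terms. *)
Lemma Rintegral_derivative_eq0 (F f : R -> R) :
  (forall x : R, is_derive x (1 : R) F (f x)) -> continuous f ->
  leb.-integrable setT (EFin \o f) ->
  F n%:R @[n --> \oo] --> (0 : R) -> F (- n%:R) @[n --> \oo] --> (0 : R) ->
  \int[leb]_x f x = 0.
Proof.
move=> dF cf fi F1 F2.
pose D (n : nat) : set R := `[- n.+1%:R, n.+1%:R]%classic.
have mf : measurable_fun setT f by case/integrableP : fi => /measurable_EFinP.
have lim1 : \int[leb]_x (f \_ (D n)) x @[n --> \oo] --> \int[leb]_x f x.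
  apply: (@Rdominated_cvg _ _ _ leb (fun n => f \_ (D n)) f (fun x => `|f x|)) => //.
  - by move=> n; apply/(measurable_restrictT f (measurable_itv _)); exact: measurable_funTS.
  - apply: aeW => x; apply: cvg_near_cst.
    near=> n; rewrite patchE mem_set// /D/= in_itv/=.
    rewrite -ler_norml; apply: ltW; apply: (@lt_le_trans _ _ n%:R); last by rewrite ler_nat.
    by near: n; exact: nbhs_infty_gtr.
  - exact: integrable_norm fi.
  - by move=> n x; rewrite patchE; case: ifPn => _ //; rewrite normr0.
have E n : \int[leb]_x (f \_ (D n)) x = F n.+1%:R - F (- n.+1%:R).
  have nn : - n.+1%:R < n.+1%:R :> R by rewrite gtrN// ltr0n.
  rewrite -Rintegral_mkcond /Rintegral (@continuous_FTC2 _ _ F) //.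
  - exact: continuous_subspaceT.
  - by split=> [x _||]; [exact: ex_derive
      |apply: cvg_at_right_filter; exact: is_derive_continuous
      |apply: cvg_at_left_filter; exact: is_derive_continuous].
  - by move=> x _; rewrite derive1E; exact: derive_val.
have lim2 : \int[leb]_x (f \_ (D n)) x @[n --> \oo] --> (0 - 0 : R).
  under eq_fun do rewrite E.
  by apply: cvgB; [move: F1|move: F2]; rewrite -cvg_shiftS.
rewrite subr0 in lim2.
exact: (cvg_unique _ lim1 lim2).
Unshelve. all: by end_near. Qed.

End whole_line.

Section normal_cosine.
Context {R : realType}.
Local Notation leb := (@lebesgue_measure R).
Variables (m s : R).
Hypothesis s0 : s != 0.

Lemma normal_pdf_expE x :
  normal_pdf m s x = normal_peak s * expR (- (x - m) ^+ 2 / (s ^+ 2 *+ 2)).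
Proof. by rewrite normal_pdfE. Qed.

Lemma is_derive_normal_pdf (x : R) :
  is_derive x 1 (normal_pdf m s) (- (x - m) / s ^+ 2 * normal_pdf m s x).
Proof.
have -> : normal_pdf m s = fun x =>
    normal_peak s * expR (- (s ^+ 2 *+ 2)^-1 * (x - m) ^+ 2).
  by apply/funext => y; rewrite normal_pdf_expE; congr (_ * expR _); ring.
have dB : is_derive x (1 : R) (fun y => y - m) (1 - 0).
  exact: (is_derive_fB (is_derive_fid x) (is_derive_fcst m x)).
have := is_derive_fZ (normal_peak s) (is_derive_fcomp (is_derive_expR _)
  (is_derive_fZ (- (s ^+ 2 *+ 2)^-1) (is_derive_fM dB dB))).
by move/is_derive_eq; apply; rewrite -expr2; field.
Qed.

(** From e^x >= 1 + x; this rational decay is enough for the boundary terms. *)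
Lemma normal_pdf_le (x : R) :
  normal_pdf m s x <= normal_peak s / (1 + (x - m) ^+ 2 / (s ^+ 2 *+ 2)).
Proof.
rewrite normal_pdf_expE ler_wpM2l ?normal_peak_ge0// mulNr expRN.
have e0 : 0 <= (x - m) ^+ 2 / (s ^+ 2 *+ 2).
  by rewrite divr_ge0 ?sqr_ge0// mulrn_wge0// sqr_ge0.
by rewrite lef_pV2 ?posrE ?expR_gt0 ?expR_ge1Dx//; lra.
Qed.

Lemma normal_pdf_tail (u : nat -> R) : (forall n, n%:R <= `|u n|) ->
  normal_pdf m s (u n) @[n --> \oo] --> (0 : R).
Proof.
move=> hu; apply/cvgrPdist_le => e e0; near=> n.
rewrite sub0r normrN ger0_norm ?normal_pdf_ge0//.
apply: le_trans (normal_pdf_le _) _.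
have s20 : 0 < s ^+ 2 *+ 2 by rewrite mulrn_wgt0// exprn_even_gt0.
have pk := normal_peak_gt0 s0.
have [n1 n2] : `|m| + 1 <= n%:R /\ normal_peak s / e * (s ^+ 2 *+ 2) + `|m| <= n%:R.
  split; near: n; exact: nbhs_infty_ger.
have um : n%:R - `|m| <= `|u n - m| by have := hu n; have := lerB_dist (u n) m; lra.
have u1 : `|u n - m| <= (u n - m) ^+ 2.
  by rewrite -real_normK ?num_real// expr2 ler_peMl//; lra.
have : normal_peak s / e <= (u n - m) ^+ 2 / (s ^+ 2 *+ 2).
  by rewrite ler_pdivlMr//; lra.
set Q := _ / (s ^+ 2 *+ 2) => h.
have Q0 : 0 <= Q by apply: le_trans h; rewrite divr_ge0// ltW.
rewrite ler_pdivrMr; last by lra.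
rewrite ler_pdivrMr// in h.
by lra.
Unshelve. all: by end_near. Qed.

Lemma integrable_bounded_normal (h : R -> R) (M : R) :
  measurable_fun setT h -> (forall x, `|h x| <= M) ->
  leb.-integrable setT (EFin \o (fun x => h x * normal_pdf m s x)).
Proof.
move=> mh hM; apply: (@integrable_bounded_mul _ _ _ leb h _ M) => //.
exact: integrable_normal_pdf.
Qed.

(** With z = |x - m| / |s|, z <= 1 + z^2 / 4 <= e^(z^2 / 4): the factor x - m is absorbed by
    doubling the variance. *)
Lemma integrable_centered_normal :
  leb.-integrable setT (EFin \o (fun x => (x - m) * normal_pdf m s x)).
Proof.
pose s' := s * Num.sqrt 2.
have s'0 : s' != 0 by rewrite mulf_neq0// sqrtr_eq0 -ltNge.
pose K := normal_peak s * `|s| * 2 / normal_peak s'.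
have mf : measurable_fun setT (fun x : R => (x - m) * normal_pdf m s x).
  apply: measurable_funM; last exact: measurable_normal_pdf.
  exact: measurable_funB.
apply: (@le_integrable _ _ _ leb _ measurableT _
    (EFin \o (fun x : R => K * normal_pdf m s' x))).
- exact/measurable_EFinP.
- move=> x _ /=; rewrite lee_fin normrM (ger0_norm (normal_pdf_ge0 _ _ _)).
  rewrite [leRHS]ger0_norm; last first.
    by rewrite mulr_ge0 ?normal_pdf_ge0// /K divr_ge0 ?normal_peak_ge0// !mulr_ge0 ?normal_peak_ge0.
  rewrite (normal_pdfE m s'0) /normal_fun normal_pdf_expE /K.
  have pk := normal_peak_gt0 s'0.
  rewrite (_ : _ / _ * _ = normal_peak s * (`|s| * 2 * expR (- (x - m) ^+ 2 / (s' ^+ 2 *+ 2)))); last first.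
    by field; rewrite gt_eqF.
  rewrite mulrCA ler_wpM2l ?normal_peak_ge0//.
  have -> : s' ^+ 2 = s ^+ 2 * 2 by rewrite exprMn sqr_sqrtr.
  pose z := `|(x - m) / s|.
  have xz : `|x - m| = `|s| * z by rewrite /z normrM normfV mulrCA divff ?mulr1// normr_eq0.
  have z2 : (x - m) ^+ 2 = s ^+ 2 * z ^+ 2 by rewrite -real_normK ?num_real// xz exprMn real_normK ?num_real.
  rewrite xz -!mulrA ler_pM2l ?normr_gt0//.
  rewrite (_ : - _ / _ = - (z ^+ 2 / 4) + - (z ^+ 2 / 4)); last by rewrite z2; field.
  rewrite (_ : - _ / _ = - (z ^+ 2 / 4)); last by rewrite z2; field.
  rewrite expRD mulrA ler_wpM2r ?expR_ge0//.
  rewrite expRN ler_pdivrMr ?expR_gt0//.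
  have := expR_ge1Dx (z ^+ 2 / 4).
  have : 0 <= (z / 2 - 1) ^+ 2 by exact: sqr_ge0.
  have : (z / 2 - 1) ^+ 2 = z ^+ 2 / 4 - z + 1 by field.
  have : 0 <= z ^+ 2 by exact: sqr_ge0.
  lra.
- have := integrableZl measurableT K (integrable_normal_pdf m s'); exact.
Qed.

Let th (l k x : R) := l * (x - m) + k.

Let dth l k (x : R) : is_derive x (1 : R) (th l k) l.
Proof.
have := is_derive_fD (is_derive_fZ l (is_derive_fB (is_derive_fid x) (is_derive_fcst m x)))
  (is_derive_fcst k x).
by move/is_derive_eq; apply; ring.
Qed.

Let dthl k (x l : R) : is_derive l (1 : R) (fun l => th l k x) (x - m).
Proof.
have := is_derive_fD (is_derive_fM (is_derive_fid l) (is_derive_fcst (x - m) l))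
  (is_derive_fcst k l).
by move/is_derive_eq; apply; ring.
Qed.

Let cth l k : continuous (th l k).
Proof. by move=> x; exact: is_derive_continuous (dth l k x). Qed.

Let ccos l k : continuous (fun x => cos (th l k x)).
Proof. by move=> x; apply: continuous_comp; [exact: cth|exact: continuous_cos]. Qed.

Let csin l k : continuous (fun x => sin (th l k x)).
Proof. by move=> x; apply: continuous_comp; [exact: cth|exact: continuous_sin]. Qed.

Lemma norm_cos_le1 (x : R) : `|cos x| <= 1.
Proof. by rewrite ler_norml cos_geN1 cos_le1. Qed.

Lemma norm_sin_le1 (x : R) : `|sin x| <= 1.
Proof. by rewrite ler_norml sin_geN1 sin_le1. Qed.

Let int_cos l k :
  leb.-integrable setT (EFin \o (fun x => cos (th l k x) * normal_pdf m s x)).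
Proof.
apply: (@integrable_bounded_normal _ 1); last by move=> x; exact: norm_cos_le1.
exact: continuous_measurable_fun.
Qed.

Let int_xsin l k : leb.-integrable setT
  (EFin \o (fun x => sin (th l k x) * ((x - m) * normal_pdf m s x))).
Proof.
apply: (@integrable_bounded_mul _ _ _ leb _ _ 1).
- exact: continuous_measurable_fun.
- by move=> x; exact: norm_sin_le1.
- exact: integrable_centered_normal.
Qed.

(** Stein's identity: the derivative of - s^2 sin(l (x - m) + k) times the density has integral 0.
    The phase k treats sine and cosine at once. *)
Lemma normal_stein l k :
  \int[leb]_x (sin (l * (x - m) + k) * ((x - m) * normal_pdf m s x)) =
  s ^+ 2 * l * \int[leb]_x (cos (l * (x - m) + k) * normal_pdf m s x).
Proof.
pose F x := - s ^+ 2 * (sin (th l k x) * normal_pdf m s x).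
pose f x := sin (th l k x) * ((x - m) * normal_pdf m s x) -
  s ^+ 2 * l * (cos (th l k x) * normal_pdf m s x).
have dF (x : R) : is_derive x (1 : R) F (f x).
  have := is_derive_fZ (- s ^+ 2) (is_derive_fM
    (is_derive_fcomp (is_derive_sin _) (dth l k x)) (is_derive_normal_pdf x)).
  by move/is_derive_eq; apply; rewrite /f; field.
have cf : continuous f.
  have cp : continuous (normal_pdf m s) by exact: continuous_normal_pdf.
  move=> x; apply: cvgB.
    apply: cvgM; first exact: csin.
    by apply: cvgM; [apply: cvgB; [exact: cvg_id|exact: cvg_cst]|exact: cp].
  by apply: cvgM; [exact: cvg_cst|apply: cvgM; [exact: ccos|exact: cp]].
have i2 : leb.-integrable setT
    (EFin \o (fun x => s ^+ 2 * l * (cos (th l k x) * normal_pdf m s x))).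
  by have := integrableZl measurableT (s ^+ 2 * l) (int_cos l k); exact.
have fi : leb.-integrable setT (EFin \o f).
  by have := integrableB measurableT (int_xsin l k) i2; exact.
have tail (u : nat -> R) : (forall n, n%:R <= `|u n|) -> F (u n) @[n --> \oo] --> (0 : R).
  move=> hu; apply: norm_cvg0.
  apply: (@squeeze_cvgr _ _ _ _ (fun=> 0) (fun n => s ^+ 2 * normal_pdf m s (u n))).
  - near=> n; rewrite normr_ge0/= /F normrM normrN (ger0_norm (sqr_ge0 s)).
    rewrite ler_wpM2l ?sqr_ge0// normrM (ger0_norm (normal_pdf_ge0 _ _ _)).
    by rewrite -[leRHS]mul1r ler_wpM2r ?normal_pdf_ge0 ?norm_sin_le1.
  - exact: cvg_cst.
  - rewrite -(mulr0 (s ^+ 2)); apply: cvgM; first exact: cvg_cst.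
    exact: normal_pdf_tail.
have := Rintegral_derivative_eq0 dF cf fi (tail _ _) (tail _ _).
rewrite (RintegralB measurableT (int_xsin l k) i2).
rewrite (RintegralZl _ measurableT (int_cos l k)).
move=> H; apply/eqP; rewrite -subr_eq0; apply/eqP; apply: H => n.
- by rewrite normr_nat.
- by rewrite normrN normr_nat.
Unshelve. all: by end_near. Qed.

(** By [normal_stein] the transform solves phi'(l) = - s^2 l phi(l), so phi(l) e^(s^2 l^2 / 2) is
    constant, equal to cos k. *)
Lemma normal_cos_transform l k :
  \int[leb]_x (cos (l * (x - m) + k) * normal_pdf m s x) =
  cos k * expR (- (l ^+ 2 * s ^+ 2 / 2)).
Proof.
pose phi l := \int[leb]_x (cos (th l k x) * normal_pdf m s x).
have dphi (l' : R) : is_derive l' (1 : R) phi (- (s ^+ 2 * l' * phi l')).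
  have := @is_derive_Rintegral _ _ _ leb
    (fun l x => cos (th l k x) * normal_pdf m s x)
    (fun l x => - (sin (th l k x) * ((x - m) * normal_pdf m s x)))
    (fun x => `|(x - m) * normal_pdf m s x|) l'.
  have -> : \int[leb]_y (- (sin (th l' k y) * ((y - m) * normal_pdf m s y))) =
      - (s ^+ 2 * l' * phi l').
    rewrite -normal_stein -[RHS]mulN1r -(RintegralZl (-1) measurableT (int_xsin l' k)).
    by apply: eq_Rintegral => x _; rewrite mulN1r.
  apply.
  - by move=> x; exact: int_cos.
  - move=> x y; have := is_derive_fM (is_derive_fcomp (is_derive_cos _) (dthl k y x))
      (is_derive_fcst (normal_pdf m s y) x).
    by move/is_derive_eq; apply; rewrite mulr0; ring.
  - move=> x y; rewrite normrN normrM -[leRHS]mul1r ler_wpM2r//.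
    exact: norm_sin_le1.
  - exact: (integrable_norm integrable_centered_normal).
pose G l := phi l * expR (s ^+ 2 / 2 * l ^+ 2).
have dG (l' : R) : is_derive l' (1 : R) G 0.
  have := is_derive_fM (dphi l') (is_derive_fcomp (is_derive_expR _)
    (is_derive_fZ (s ^+ 2 / 2) (is_derive_fM (is_derive_fid l') (is_derive_fid l')))).
  by move/is_derive_eq; apply; rewrite expr2; field.
have := is_derive_0_is_cst l 0 dG.
rewrite /G expr0n/= mulr0 expR0 mulr1.
have -> : phi 0 = cos k.
  rewrite /phi (_ : (fun x => _) = (fun x => cos k * normal_pdf m s x)); last first.
    by apply/funext => x; rewrite /th mul0r add0r.
  rewrite RintegralZl//; last exact: integrable_normal_pdf.
  by rewrite /Rintegral integral_normal_pdf/= mulr1.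
move=> <-; rewrite -[RHS]mulrA -expRD (_ : _ + _ = 0); first by rewrite expR0 mulr1.
by field.
Qed.

Lemma normal_centered_mean : \int[leb]_x ((x - m) * normal_pdf m s x) = 0.
Proof.
have := normal_stein 0 (pi / 2); rewrite mulr0 mul0r => {1}<-.
by apply: eq_Rintegral => x _; rewrite mul0r add0r sin_pihalf mul1r.
Qed.

End normal_cosine.

(** * Change of variables along a law known on measurable sets *)

Section laws.
Context d d' (T : measurableType d) (T' : measurableType d') {R : realType}.
Variables (P : probability T R) (nu : {measure set T' -> \bar R}) (X : T -> T').
Hypothesis mX : measurable_fun setT X.
Hypothesis nuX : forall A, measurable A -> nu A = P (X @^-1` A).

Let X' : {mfun T >-> T'} := mfun_Sub (mem_set mX).

Lemma ge0_integral_law (f : T' -> \bar R) : measurable_fun setT f ->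
  (forall y, (0 <= f y)%E) -> (\int[nu]_y f y = \int[P]_w f (X w))%E.
Proof.
move=> mf f0; rewrite -(@ge0_integral_distribution _ _ _ _ _ P X' f mf f0).
by apply: eq_measure_integral => A mA _; rewrite nuX.
Qed.

Lemma integral_law (f : T' -> \bar R) : measurable_fun setT f ->
  P.-integrable setT (f \o X) -> (\int[nu]_y f y = \int[P]_w f (X w))%E.
Proof.
move=> mf fi; rewrite -(@integral_distribution _ _ _ _ _ P X' f mf fi).
by apply: eq_measure_integral => A mA _; rewrite nuX.
Qed.

Lemma Rintegral_law (f : T' -> R) : measurable_fun setT f ->
  P.-integrable setT (fun w => (f (X w))%:E) -> \int[nu]_y f y = \int[P]_w f (X w).
Proof.
by move=> mf fi; rewrite /Rintegral integral_law//; exact/measurable_EFinP.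
Qed.

Lemma integrable_law (f : T' -> \bar R) : measurable_fun setT f ->
  nu.-integrable setT f <-> P.-integrable setT (f \o X).
Proof.
move=> mf; have E : (\int[nu]_y `|f y| = \int[P]_w `|f (X w)|)%E.
  by rewrite ge0_integral_law//; exact: measurableT_comp.
by split=> /integrableP[m1 i1]; apply/integrableP; split => //;
  [exact: measurableT_comp|rewrite -E|rewrite E].
Qed.

End laws.

Section normal_density_integral.
Context {R : realType}.
Local Notation leb := (@lebesgue_measure R).

(** The Radon-Nikodym derivative of the normal law and [normal_pdf] have the same integral over each
    measurable set, hence agree almost everywhere. *)
Lemma normal_prob_integral (m s : R) (f : R -> \bar R) : measurable_fun setT f ->
  (normal_prob m s).-integrable setT f ->
  (\int[normal_prob m s]_x f x = \int[leb]_x (f x * (normal_pdf m s x)%:E))%E.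
Proof.
move=> mf fi.
rewrite -(Radon_Nikodym_change_of_variables (normal_prob_dominates m s))//=.
apply: ae_eq_integral => //.
- apply: emeasurable_funM => //; apply: (measurable_int leb).
  by apply: Radon_Nikodym_integrable; exact: normal_prob_dominates.
- by apply: emeasurable_funM => //=; apply/measurable_EFinP; exact: measurable_normal_pdf.
- apply: ae_eqe_mul2l => /=.
  rewrite Radon_NikodymE//=; first exact: normal_prob_dominates.
  move=> dom; case: cid => /= h [h1 h2 h3].
  apply: integral_ae_eq => //=.
    by apply/measurable_EFinP; exact: measurable_normal_pdf.
  by move=> E _ mE; rewrite -h3.
Qed.

Lemma normal_prob_Rintegral (m s : R) (f : R -> R) : measurable_fun setT f ->
  (normal_prob m s).-integrable setT (EFin \o f) ->
  \int[normal_prob m s]_x f x = \int[leb]_x (f x * normal_pdf m s x).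
Proof.
by move=> mf fi; rewrite /Rintegral normal_prob_integral//; exact/measurable_EFinP.
Qed.

End normal_density_integral.

Section gaussian_law_cos.
Context d (T : measurableType d) {R : realType} (P : probability T R).

Lemma integrable_bounded (h : T -> R) (M : R) : measurable_fun setT h ->
  (forall w, `|h w| <= M) -> P.-integrable setT (EFin \o h).
Proof.
move=> mh hM; apply: measurable_bounded_integrable => //.
  by rewrite (le_lt_trans (probability_le1 _ _))// ltry.
exists M; split; first by rewrite num_real.
by move=> r Mr x _ /=; apply: le_trans (hM x) (ltW Mr).
Qed.

Lemma Rintegral_prob_cst (c : R) : \int[P]_w c = c.
Proof.
rewrite Rintegral_cst//; transitivity (c * fine 1%E); last by rewrite mulr1.
by congr (_ * fine _); exact: probability_setT.
Qed.

Lemma Rintegral_dirac (a : R) (f : R -> R) : measurable_fun setT f ->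
  \int[dirac a]_x f x = f a.
Proof.
move=> mf; rewrite /Rintegral integral_dirac//=; last exact/measurable_EFinP.
by rewrite indicT mul1r.
Qed.

(** Mean zero forces m = 0, both in the Dirac case, where v = 0, and in the normal case, where v =
    s^2. From here on Gaussianity is used only through this formula. *)
Lemma gaussian_law_cos (X : T -> R) : measurable_fun setT X ->
  gaussian_law (pushforward P X) -> P.-integrable setT (EFin \o X) ->
  \int[P]_w X w = 0 ->
  exists2 v : R, 0 <= v & forall l k,
    \int[P]_w cos (l * X w + k) = cos k * expR (- (l ^+ 2 * v / 2)).
Proof.
move=> mX [m [s law]] Xi EX0.
have mcos (l k : R) : measurable_fun setT (fun x : R => cos (l * x + k)).
  apply: continuous_measurable_fun => x; apply: continuous_comp; last exact: continuous_cos.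
  by apply: cvgD; [apply: cvgM; [exact: cvg_cst|exact: cvg_id]|exact: cvg_cst].
have icos (l k : R) : P.-integrable setT (EFin \o (fun w => cos (l * X w + k))).
  apply: (@integrable_bounded _ 1) => [|w]; last by exact: norm_cos_le1.
  exact: (measurableT_comp (mcos l k) mX).
have mid : measurable_fun setT (@id R) by exact: measurable_id.
have [s0|s0] := eqVneq s 0.
  have nuX (A : set R) : measurable A -> \d_m A = P (X @^-1` A).
    by move=> mA; have := law A mA; rewrite s0 eqxx => <-.
  have mE : m = 0.
    rewrite -EX0 -(@Rintegral_law _ _ _ _ _ P (dirac m) X mX nuX id)//.
    by rewrite Rintegral_dirac.
  exists 0 => // l k; rewrite mulr0 mul0r oppr0 expR0 mulr1.
  rewrite -(@Rintegral_law _ _ _ _ _ P (dirac m) X mX nuX _ (mcos l k) (icos l k)).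
  by rewrite Rintegral_dirac; [rewrite mE mulr0 add0r|exact: mcos].
have nuX (A : set R) : measurable A -> normal_prob m s A = P (X @^-1` A).
  by move=> mA; have := law A mA; rewrite (negbTE s0) => <-.
have transfer (f : R -> R) : measurable_fun setT f ->
    P.-integrable setT (EFin \o (fun w => f (X w))) ->
    \int[P]_w f (X w) = \int[@lebesgue_measure R]_x (f x * normal_pdf m s x).
  move=> mf fi; rewrite -(@Rintegral_law _ _ _ _ _ P (normal_prob m s) X mX nuX f)//.
  apply: normal_prob_Rintegral => //.
  by apply/(@integrable_law _ _ _ _ _ P (normal_prob m s) X mX nuX) => //; exact/measurable_EFinP.
have mE : m = 0.
  have ci : P.-integrable setT (EFin \o (fun=> m)).
    by apply: (@integrable_bounded _ `|m|).
  have Xmi : P.-integrable setT (EFin \o (fun w => X w - m)).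
    by have := integrableB measurableT Xi ci; exact.
  have mxm : measurable_fun setT (fun x : R => x - m) by exact: measurable_funB.
  have := transfer _ mxm Xmi; rewrite normal_centered_mean//.
  rewrite (RintegralB measurableT Xi ci) EX0 Rintegral_prob_cst sub0r.
  by move/eqP; rewrite oppr_eq0 => /eqP.
exists (s ^+ 2); first exact: sqr_ge0.
move=> l k; rewrite (transfer _ (mcos l k) (icos l k)).
rewrite -(normal_cos_transform m s0); apply: eq_Rintegral => x _.
by rewrite mE subr0.
Qed.

End gaussian_law_cos.

(** * Closed Gaussian spaces *)

Section trigonometric_bounds.
Context {R : realType}.

Lemma cos_lipschitz (a b : R) : `|cos a - cos b| <= `|a - b|.
Proof.
wlog ab : a b / a <= b => [H|].
  by case: (leP a b) => [/H//|/ltW/H]; rewrite distrC (distrC a).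
have h1 : a + cos a <= b + cos b.
  by apply: (@le_of_derive_cc _ (fun t => t + cos t) (fun t => 1 + - sin t)).
have h2 : a - cos a <= b - cos b.
  by apply: (@le_of_derive_cc _ (fun t => t - cos t) (fun t => 1 - - sin t)).
by rewrite distrC (ler0_norm (_ : a - b <= 0)) ?subr_le0// ler_norml; apply/andP; split; lra.
Qed.

Lemma norm_sin_le (x : R) : `|sin x| <= `|x|.
Proof.
have := cos_lipschitz (x - pi / 2) (0 - pi / 2).
by rewrite !cosBpihalf sin0 subr0 (_ : _ - _ = x); last ring.
Qed.

Lemma one_sub_cos (x : R) : 1 - cos x = 2 * sin (x / 2) ^+ 2.
Proof.
have {1}-> : x = (x / 2) *+ 2 by rewrite -mulr_natr divfK.
by rewrite cos_mulr2n sin2cos2; ring.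
Qed.

Lemma is_derive_seq (f : R -> R) (x df : R) (u : nat -> R) :
  is_derive x (1 : R) f df -> (forall n, u n != 0) -> u @ \oo --> (0 : R) ->
  (u n)^-1 * (f (x + u n) - f x) @[n --> \oo] --> df.
Proof.
move=> [fx dfE] u0 ul.
have : h^-1 *: (f (h *: 1 + x) - f x) @[h --> (0 : R)^'] --> df.
  by rewrite -dfE; exact: fx.
move=> /cvgr_dnbhsP /(_ u (conj u0 ul)) h.
apply: cvg_trans h; apply: near_eq_cvg; apply: nearW => n.
by rewrite /GRing.scale/= mulr1 (addrC x).
Qed.

End trigonometric_bounds.

Section gaussian_closure.
Context d (T : measurableType d) {R : realType} (P : probability T R).
Implicit Types (X Y Z : T -> R).

(* Metrizes convergence in probability. *)
Definition d0 X Y : R := \int[P]_w Num.min 1 `|X w - Y w|.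

Lemma measurable_min1 X Y : measurable_fun setT X -> measurable_fun setT Y ->
  measurable_fun setT (fun w => Num.min 1 `|X w - Y w|).
Proof.
move=> mX mY; apply: measurable_minr => //.
by apply: measurableT_comp => //; exact: measurable_funB.
Qed.

Lemma min1_bound X Y w : `|Num.min 1 (`|X w - Y w|) | <= 1.
Proof. by rewrite ger0_norm ?ge_min ?lexx// le_min ler01 normr_ge0. Qed.

Lemma integrable_min1 X Y : measurable_fun setT X -> measurable_fun setT Y ->
  P.-integrable setT (EFin \o (fun w => Num.min 1 `|X w - Y w|)).
Proof.
by move=> mX mY; apply: (@integrable_bounded _ _ _ P _ 1);
  [exact: measurable_min1|exact: min1_bound].
Qed.

Lemma d0_ge0 X Y : 0 <= d0 X Y.
Proof. by apply: Rintegral_ge0 => w _; rewrite le_min ler01 normr_ge0. Qed.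

Lemma d0C X Y : d0 X Y = d0 Y X.
Proof. by apply: eq_Rintegral => w _; rewrite distrC. Qed.

Lemma le_d0 X Y (f : T -> R) (M : R) : measurable_fun setT X -> measurable_fun setT Y ->
  P.-integrable setT (EFin \o f) ->
  (forall w, f w <= M * Num.min 1 `|X w - Y w|) -> \int[P]_w f w <= M * d0 X Y.
Proof.
move=> mX mY fi fM; have i1 := integrable_min1 mX mY.
rewrite -(RintegralZl M measurableT i1).
apply: le_Rintegral => //; have := integrableZl measurableT M i1; exact.
Qed.

Lemma min1_add (x y : R) : 0 <= x -> 0 <= y -> Num.min 1 (x + y) <= Num.min 1 x + Num.min 1 y.
Proof. by move=> x0 y0; rewrite !minEle; do 3 case: ifP; lra. Qed.

Lemma min1_le (x y : R) : x <= y -> Num.min 1 x <= Num.min 1 y.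
Proof. by move=> xy; rewrite !minEle; do 2 case: ifP; lra. Qed.

Lemma le_d0D X Y X1 Y1 X2 Y2 :
  measurable_fun setT X -> measurable_fun setT Y ->
  measurable_fun setT X1 -> measurable_fun setT Y1 ->
  measurable_fun setT X2 -> measurable_fun setT Y2 ->
  (forall w, `|X w - Y w| <= `|X1 w - Y1 w| + `|X2 w - Y2 w|) ->
  d0 X Y <= d0 X1 Y1 + d0 X2 Y2.
Proof.
move=> mX mY mX1 mY1 mX2 mY2 h.
have i1 := integrable_min1 mX1 mY1; have i2 := integrable_min1 mX2 mY2.
rewrite /d0 -(RintegralD measurableT i1 i2).
apply: le_Rintegral => //.
- exact: integrable_min1.
- have := integrableD measurableT i1 i2; exact.
- by move=> w _; apply: le_trans (min1_add _ _) => //; exact: min1_le.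
Qed.

Lemma d0_scale (a : R) X Y : measurable_fun setT X -> measurable_fun setT Y ->
  d0 (fun w => a * X w) (fun w => a * Y w) <= Num.max 1 `|a| * d0 X Y.
Proof.
move=> mX mY; apply: le_d0 => //.
  by apply: integrable_min1; exact: measurable_funM.
move=> w; rewrite -mulrBr normrM.
set y := `|_ - _|; have y0 : 0 <= y by exact: normr_ge0.
have a0 : 0 <= `|a| by exact: normr_ge0.
by rewrite maxEle !minEle; do 3 case: ifP; nra.
Qed.

Lemma measurable_cos_affine (l k : R) X : measurable_fun setT X ->
  measurable_fun setT (fun w => cos (l * X w + k)).
Proof.
move=> mX; have : measurable_fun setT (fun x : R => cos (l * x + k)).
  apply: continuous_measurable_fun => x; apply: continuous_comp; last exact: continuous_cos.
  by apply: cvgD; [apply: cvgM; [exact: cvg_cst|exact: cvg_id]|exact: cvg_cst].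
by move=> mc; exact: (measurableT_comp mc mX).
Qed.

Lemma integrable_cos_affine (l k : R) X : measurable_fun setT X ->
  P.-integrable setT (EFin \o (fun w => cos (l * X w + k))).
Proof.
move=> mX; apply: (@integrable_bounded _ _ _ P _ 1) => [|w]; last exact: norm_cos_le1.
exact: measurable_cos_affine.
Qed.

(** The difference of the cosines is bounded both by 2 and by |l| |X - Y|. *)
Lemma cos_integral_d0 (l k : R) X Y : measurable_fun setT X -> measurable_fun setT Y ->
  `|\int[P]_w cos (l * X w + k) - \int[P]_w cos (l * Y w + k)| <=
  Num.max 2 `|l| * d0 X Y.
Proof.
move=> mX mY.
have iX := integrable_cos_affine l k mX; have iY := integrable_cos_affine l k mY.
rewrite -(RintegralB measurableT iX iY).
have iXY : P.-integrable setT (EFin \o (fun w => cos (l * X w + k) - cos (l * Y w + k))).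
  have := integrableB measurableT iX iY; exact.
apply: le_trans (le_normr_Rintegral measurableT iXY) _.
apply: le_d0 => //; first exact: integrable_norm iXY.
move=> w /=; have h1 := cos_lipschitz (l * X w + k) (l * Y w + k).
have h2 : `|cos (l * X w + k) - cos (l * Y w + k)| <= 2.
  apply: le_trans (ler_normB _ _) _.
  by rewrite -[leRHS]/(1 + 1) lerD ?norm_cos_le1.
have lE : l * X w + k - (l * Y w + k) = l * (X w - Y w) by ring.
rewrite lE normrM in h1; move: h1 h2.
set y := `|X w - Y w|; have y0 : 0 <= y by exact: normr_ge0.
have a0 : 0 <= `|l| by exact: normr_ge0.
by rewrite maxEle !minEle; do 2 case: ifP; nra.
Qed.

Lemma d0_cvg_ae (X_ : nat -> T -> R) X : (forall n, measurable_fun setT (X_ n)) ->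
  measurable_fun setT X -> {ae P, forall w, X_ ^~ w @ \oo --> X w} ->
  d0 (X_ n) X @[n --> \oo] --> (0 : R).
Proof.
move=> mX_ mX cX.
rewrite -(Rintegral_prob_cst P 0).
apply: (@Rdominated_cvg _ _ _ P (fun n w => Num.min 1 `|X_ n w - X w|) (fun=> 0) (fun=> 1)).
- by move=> n; exact: measurable_min1.
- exact: measurable_cst.
- apply: filterS cX => w h; have h0 : `|X_ n w - X w| @[n --> \oo] --> (0 : R).
    by apply/norm_cvg0P/subr_cvg0.
  apply: (@squeeze_cvgr _ _ _ _ (fun=> 0) (fun n => `|X_ n w - X w|)) => //; last exact: cvg_cst.
  by apply: nearW => n; rewrite le_min ler01 normr_ge0/= ge_min lexx orbT.
- by apply: (@integrable_bounded _ _ _ P _ 1) => // w; rewrite normr1.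
- by move=> n w; exact: min1_bound.
Qed.

(** The law N(0, v) through its characteristic function: the phases k = 0 and k = - pi / 2 give the
    real and imaginary parts. This form includes v = 0 and passes to limits in probability. *)
Definition centered_gaussian X (v : R) : Prop :=
  forall l k, \int[P]_w cos (l * X w + k) = cos k * expR (- (l ^+ 2 * v / 2)).

(** The cosine transforms converge, and v_n is recovered by a logarithm from the transform at a
    single l <> 0 where the limit is positive. *)
Lemma centered_gaussian_limit (X_ : nat -> T -> R) (v_ : nat -> R) X :
  (forall n, measurable_fun setT (X_ n)) -> measurable_fun setT X ->
  (forall n, 0 <= v_ n) -> (forall n, centered_gaussian (X_ n) (v_ n)) ->
  d0 (X_ n) X @[n --> \oo] --> (0 : R) ->
  exists v, [/\ 0 <= v, centered_gaussian X v & v_ @ \oo --> v].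
Proof.
move=> mX_ mX v0 gX dX.
have lim l k : cos k * expR (- (l ^+ 2 * v_ n / 2)) @[n --> \oo] -->
    \int[P]_w cos (l * X w + k).
  under eq_fun do rewrite -gX.
  apply/cvgrPdist_le => e e0; near=> n; rewrite distrC.
  apply: le_trans (cos_integral_d0 l k (mX_ n) mX) _.
  have m0 : 0 < Num.max 2 `|l| by rewrite lt_max ltr0n.
  rewrite -ler_pdivlMl// mulrC -[d0 _ _]ger0_norm ?d0_ge0// -[X in `|X|]subr0.
  near: n; apply: cvgr_distC_le => //.
  by rewrite divr_gt0.
pose phi l := \int[P]_w cos (l * X w + 0).
have lim0 l : expR (- (l ^+ 2 * v_ n / 2)) @[n --> \oo] --> phi l.
  by have := lim l 0; under eq_fun do rewrite cos0 mul1r.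
(* The limit transform tends to 1 as l -> 0, so it is positive at some small l; this prevents v_n
   from escaping to infinity. *)
have [l l0 phil] : exists2 l, l != 0 & 0 < phi l.
  have : phi (harmonic n) @[n --> \oo] --> (1 : R).
    rewrite -(Rintegral_prob_cst P 1).
    apply: (@Rdominated_cvg _ _ _ P (fun n w => cos (harmonic n * X w + 0)) (fun=> 1) (fun=> 1)).
    - by move=> n; exact: measurable_cos_affine.
    - exact: measurable_cst.
    - apply: aeW => w; rewrite -(@cos0 R).
      apply: continuous_cvg; first exact: continuous_cos.
      rewrite -[X in _ --> X]addr0; apply: cvgD; last exact: cvg_cst.
      rewrite -(mul0r (X w)); apply: cvgM; last exact: cvg_cst.
      exact: cvg_harmonic.
    - by apply: (@integrable_bounded _ _ _ P _ 1) => // w; rewrite normr1.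
    - by move=> n w; exact: norm_cos_le1.
  move=> /cvgr_gt /(_ 0 ltr01) [N _ /(_ N (leqnn N)) h].
  by exists (harmonic N) => //; rewrite gt_eqF// harmonic_gt0.
pose v := - (2 / l ^+ 2 * ln (phi l)).
have l20 : l ^+ 2 != 0 by rewrite expf_eq0.
have vv : v_ @ \oo --> v.
  have -> : v_ = (fun n => - (2 / l ^+ 2 * ln (expR (- (l ^+ 2 * v_ n / 2))))).
    by apply/funext => n; rewrite expRK; field.
  apply: cvgN; apply: cvgM; first exact: cvg_cst.
  by apply: continuous_cvg; [exact: continuous_ln|exact: lim0].
exists v; split => //.
- by apply: (cvgr_to_ge vv); exact: nearW.
- move=> l' k.
  have h : cos k * expR (- (l' ^+ 2 * v_ n / 2)) @[n --> \oo] -->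
      cos k * expR (- (l' ^+ 2 * v / 2)).
    apply: cvgM; first exact: cvg_cst.
    apply: continuous_cvg; first exact: continuous_expR.
    apply: cvgN; apply: cvgM; last exact: cvg_cst.
    by apply: cvgM; first exact: cvg_cst.
  exact: (cvg_unique _ (lim l' k) h).
Unshelve. all: by end_near. Qed.

(** (1 - cos(l X)) / l^2 tends to X^2 / 2 as l -> 0, and its mean to v / 2. Fatou's lemma first
    makes X^2 integrable; then X^2 / 2 dominates the quotients, which identifies the mean. *)
Lemma centered_gaussian_second_moment X (v : R) : measurable_fun setT X ->
  centered_gaussian X v ->
  P.-integrable setT (EFin \o (fun w => X w ^+ 2)) /\ \int[P]_w (X w ^+ 2) = v.
Proof.
move=> mX gX.
pose l n : R := harmonic n.
have l0 n : l n != 0 by rewrite gt_eqF// harmonic_gt0.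
have ll : l @ \oo --> (0 : R) by exact: cvg_harmonic.
pose f n w := 2 * ((l n)^-1 * sin (l n * X w / 2)) ^+ 2.
have fE n w : f n w = (l n ^+ 2)^-1 * (1 - cos (l n * X w + 0)).
  rewrite addr0 one_sub_cos /f; field; exact: l0.
have mf n : measurable_fun setT (f n).
  rewrite (_ : f n = (fun w => (l n ^+ 2)^-1 * (1 - cos (l n * X w + 0)))); last first.
    by apply/funext => w; exact: fE.
  apply: measurable_funM => //; apply: measurable_funB => //.
  exact: measurable_cos_affine.
have mX2 : measurable_fun setT (fun w => X w ^+ 2) by exact: measurable_funX.
have f0 n w : 0 <= f n w by rewrite mulr_ge0// sqr_ge0.
have ic n := integrable_cos_affine (l n) 0 mX.
have i1 : P.-integrable setT (EFin \o (fun=> (1 : R))).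
  by apply: (@integrable_bounded _ _ _ P _ 1) => // w; rewrite normr1.
have i1c n : P.-integrable setT (EFin \o (fun w => 1 - cos (l n * X w + 0))).
  by have := integrableB measurableT i1 (ic n); exact.
have fi n : P.-integrable setT (EFin \o f n).
  rewrite (_ : f n = (fun w => (l n ^+ 2)^-1 * (1 - cos (l n * X w + 0)))); last first.
    by apply/funext => w; exact: fE.
  by have := integrableZl measurableT (l n ^+ 2)^-1 (i1c n); exact.
have Ef n : \int[P]_w f n w = (l n ^+ 2)^-1 * (1 - expR (- (l n ^+ 2 * v / 2))).
  rewrite (_ : f n = (fun w => (l n ^+ 2)^-1 * (1 - cos (l n * X w + 0)))); last first.
    by apply/funext => w; exact: fE.
  rewrite (RintegralZl _ measurableT (i1c n)) (RintegralB measurableT i1 (ic n)).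
  by rewrite Rintegral_prob_cst gX cos0 mul1r.
have Elim : \int[P]_w f n w @[n --> \oo] --> v / 2.
  under eq_fun do rewrite Ef.
  have dE : is_derive 0 (1 : R) (fun t : R => - expR (- t * (v / 2))) (v / 2).
    have := is_derive_fN (is_derive_fcomp (is_derive_expR _)
      (is_derive_fM (is_derive_fN (is_derive_fid 0)) (is_derive_fcst (v / 2) 0))).
    by move/is_derive_eq; apply; rewrite oppr0 mul0r expR0; ring.
  have l2 n : l n ^+ 2 != 0 by rewrite expf_neq0.
  have l2l : l n ^+ 2 @[n --> \oo] --> (0 : R).
    under eq_fun do rewrite expr2.
    by rewrite -(mul0r 0); apply: cvgM.
  have := is_derive_seq dE l2 l2l.
  apply: cvg_trans; apply: near_eq_cvg; apply: nearW => n.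
  rewrite add0r oppr0 mul0r expR0; congr (_ * _).
  rewrite opprK addrC; congr (_ - expR _); ring.
have flim w : f n w @[n --> \oo] --> X w ^+ 2 / 2.
  have ds : is_derive 0 (1 : R) (fun t : R => sin (t * X w / 2)) (X w / 2).
    have := is_derive_fcomp (is_derive_sin _)
      (is_derive_fM (is_derive_fM (is_derive_fid 0) (is_derive_fcst (X w) 0)) (is_derive_fcst 2^-1 0)).
    by move/is_derive_eq; apply; rewrite !mul0r cos0; ring.
  have := is_derive_seq ds l0 ll; rewrite !mul0r sin0 => h.
  rewrite (_ : X w ^+ 2 / 2 = 2 * (X w / 2 * (X w / 2))); last by field.
  rewrite /f; apply: cvgM; first exact: cvg_cst.
  under eq_fun do rewrite expr2.
  by apply: cvgM; move: h; under eq_fun do rewrite add0r subr0.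
have X2i : P.-integrable setT (EFin \o (fun w => X w ^+ 2)).
  have X2i2 : P.-integrable setT (EFin \o (fun w => X w ^+ 2 / 2)).
    apply/integrableP; split.
      by apply/measurable_EFinP; apply: measurable_funM.
    have := @fatou _ _ _ P setT measurableT (fun n w => (f n w)%:E).
    have mfE n : measurable_fun setT (fun w => (f n w)%:E) by exact/measurable_EFinP.
    move=> /(_ mfE (fun n w _ => f0 n w)).
    have -> : (\int[P]_w limn_einf (fun n => (f n w)%:E) = \int[P]_w `|(X w ^+ 2 / 2)%:E|)%E.
      apply: eq_integral => w _.
      have h : (f n w)%:E @[n --> \oo] --> (X w ^+ 2 / 2)%:E.
        by apply: cvg_EFin; [exact: nearW|exact: flim].
      rewrite (is_cvg_limn_einfE (cvgP _ h)) (cvg_lim _ h)//=.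
      by rewrite ger0_norm// divr_ge0 ?sqr_ge0.
    have -> : limn_einf (fun n => \int[P]_w (f n w)%:E)%E = (v / 2)%:E.
      have h : (\int[P]_w (f n w)%:E)%E @[n --> \oo] --> (v / 2)%:E.
        apply: cvg_EFin; last exact: Elim.
        by apply: nearW => n; exact: (integrable_fin_num measurableT (fi n)).
      by rewrite (is_cvg_limn_einfE (cvgP _ h)) (cvg_lim _ h).
    by move=> h; apply: le_lt_trans h _; rewrite ltry.
  have := integrableZl measurableT 2 X2i2.
  by apply: eq_integrable => // w _ /=; rewrite -EFinM; congr EFin; field.
split => //.
have lim2 : \int[P]_w f n w @[n --> \oo] --> \int[P]_w (X w ^+ 2 / 2).
  apply: (@Rdominated_cvg _ _ _ P f (fun w => X w ^+ 2 / 2) (fun w => X w ^+ 2 / 2)) => //.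
  - exact: measurable_funM.
  - exact: aeW.
  - have := integrableZl measurableT 2^-1 X2i.
    by apply: eq_integrable => // w _ /=; rewrite -EFinM mulrC.
  - move=> n w; rewrite ger0_norm// /f exprMn.
    have : sin (l n * X w / 2) ^+ 2 <= (l n * X w / 2) ^+ 2.
      rewrite -[leLHS]real_normK ?num_real// -[leRHS]real_normK ?num_real//.
      by rewrite lerXn2r ?nnegrE ?normr_ge0// norm_sin_le.
    move=> h; have l20 : 0 <= (l n)^-1 ^+ 2 by exact: sqr_ge0.
    have := ler_wpM2l l20 h.
    rewrite (_ : (l n)^-1 ^+ 2 * (l n * X w / 2) ^+ 2 = X w ^+ 2 / 4); last by field; exact: l0.
    lra.
have E : \int[P]_w (X w ^+ 2 / 2) = v / 2 by exact: (cvg_unique _ lim2 Elim).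
by move: E; rewrite (RintegralZr _ measurableT X2i); lra.
Unshelve. all: by end_near. Qed.

End gaussian_closure.

(** * The span of a Gaussian process and its closure in probability *)

Section gaussian_span.
Context d (T : measurableType d) {R : realType} (P : probability T R).
Implicit Types (B : R -> T -> R) (X Y : T -> R) (c : seq (R * R)).

(** A combination is a list of pairs (coefficient, time), so that addition is concatenation. *)
Definition lincomb B c (w : T) : R := \sum_(p <- c) p.1 * B p.2 w.

Definition gaussian_base B : Prop := (forall t, measurable_fun setT (B t)) /\
  (forall c, exists2 v : R, 0 <= v & centered_gaussian P (lincomb B c) v).

(* The closure in probability of the linear span of B. *)
Definition gaussian_span B X : Prop := measurable_fun setT X /\
  forall e : R, 0 < e -> exists c, d0 P X (lincomb B c) <= e.

Lemma measurable_lincomb B c : (forall t, measurable_fun setT (B t)) ->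
  measurable_fun setT (lincomb B c).
Proof.
by move=> mB; apply: measurable_sum => p; apply: measurable_funM.
Qed.

Lemma lincomb_cat B c1 c2 w : lincomb B (c1 ++ c2) w = lincomb B c1 w + lincomb B c2 w.
Proof. by rewrite /lincomb big_cat. Qed.

Lemma lincomb_scale B (a : R) c w :
  lincomb B [seq (a * p.1, p.2) | p <- c] w = a * lincomb B c w.
Proof.
by rewrite /lincomb big_map mulr_sumr; apply: eq_bigr => p _; rewrite mulrA.
Qed.

Section fixed_base.
Variable B : R -> T -> R.
Hypothesis gB : gaussian_base B.

Let mB t : measurable_fun setT (B t). Proof. by case: gB => + _; exact. Qed.

Lemma gaussian_span_lincomb c : gaussian_span B (lincomb B c).
Proof.
split; first exact: measurable_lincomb.
move=> e e0; exists c; rewrite /d0 (_ : (fun w => _) = (fun=> 0)).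
  by rewrite Rintegral_prob_cst ltW.
by apply/funext => w; rewrite subrr normr0 minEle; case: ifPn => //; lra.
Qed.

Lemma gaussian_span_base t : gaussian_span B (B t).
Proof.
have -> : B t = lincomb B [:: (1, t)].
  by apply/funext => w; rewrite /lincomb big_seq1 mul1r.
exact: gaussian_span_lincomb.
Qed.

Lemma gaussian_spanD X Y : gaussian_span B X -> gaussian_span B Y ->
  gaussian_span B (fun w => X w + Y w).
Proof.
move=> [mX hX] [mY hY]; split; first exact: measurable_funD.
move=> e e0; have e20 : 0 < e / 2 by rewrite divr_gt0.
have [c1 h1] := hX _ e20; have [c2 h2] := hY _ e20.
exists (c1 ++ c2); rewrite -[e](divfK (_ : 2 != 0))// mulr_natr mulr2n.
apply: (le_trans _ (lerD h1 h2)); apply: le_d0D => //.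
- exact: measurable_funD.
- exact: measurable_lincomb.
- exact: measurable_lincomb.
- exact: measurable_lincomb.
- move=> w; rewrite lincomb_cat.
  rewrite (_ : _ - _ = (X w - lincomb B c1 w) + (Y w - lincomb B c2 w)); last by ring.
  exact: ler_normD.
Qed.

Lemma gaussian_spanZ (a : R) X : gaussian_span B X -> gaussian_span B (fun w => a * X w).
Proof.
move=> [mX hX]; split; first exact: measurable_funM.
move=> e e0; have m0 : 0 < Num.max 1 `|a| by rewrite lt_max ltr01.
have e20 : 0 < e / Num.max 1 `|a| by rewrite divr_gt0.
have [c hc] := hX _ e20; exists [seq (a * p.1, p.2) | p <- c].
have -> : lincomb B [seq (a * p.1, p.2) | p <- c] = (fun w => a * lincomb B c w).
  by apply/funext => w; rewrite lincomb_scale.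
apply: le_trans (d0_scale _ _ _ _) _ => //; first exact: measurable_lincomb.
by rewrite mulrC -ler_pdivlMr.
Qed.

Lemma gaussian_span_sum (I : Type) (r : seq I) (X : I -> T -> R) :
  (forall i, gaussian_span B (X i)) -> gaussian_span B (fun w => \sum_(i <- r) X i w).
Proof.
move=> gX; elim: r => [|i r ih].
  have -> : (fun w => \sum_(i <- [::]) X i w) = lincomb B [::].
    by apply/funext => w; rewrite /lincomb !big_nil.
  exact: gaussian_span_lincomb.
have -> : (fun w => \sum_(j <- i :: r) X j w) = (fun w => X i w + \sum_(j <- r) X j w).
  by apply/funext => w; rewrite big_cons.
exact: gaussian_spanD.
Qed.

Lemma gaussian_span_limit (X_ : nat -> T -> R) X : (forall n, gaussian_span B (X_ n)) ->
  measurable_fun setT X -> d0 P (X_ n) X @[n --> \oo] --> (0 : R) ->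
  gaussian_span B X.
Proof.
move=> gX mX dX; split => // e e0; have e20 : 0 < e / 2 by rewrite divr_gt0.
have [N _ /(_ N (leqnn N))] := cvgr_lt _ dX _ e20.
move=> /ltW hN; have [mN /(_ _ e20) [c hc]] := gX N.
exists c; rewrite -[e](divfK (_ : 2 != 0))// mulr_natr mulr2n.
apply: (le_trans _ (lerD hN hc)); apply: le_d0D => //.
- exact: measurable_lincomb.
- exact: measurable_lincomb.
- move=> w; rewrite (distrC (X_ N w) (X w)).
  rewrite (_ : X w - _ = (X w - X_ N w) + (X_ N w - lincomb B c w)); last by ring.
  exact: ler_normD.
Qed.

Lemma gaussian_span_gaussian X : gaussian_span B X ->
  P.-integrable setT (EFin \o (fun w => X w ^+ 2)) /\
  centered_gaussian P X (\int[P]_w (X w ^+ 2)).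
Proof.
move=> [mX hX].
have /choice[c hc] : forall n : nat, exists c, d0 P X (lincomb B c) <= harmonic n.
  by move=> n; apply: hX; exact: harmonic_gt0.
have /choice[v hv] : forall n : nat, exists v : R, 0 <= v /\ centered_gaussian P (lincomb B (c n)) v.
  by move=> n; have [v v0 hv] := gB.2 (c n); exists v.
have dc : d0 P (lincomb B (c n)) X @[n --> \oo] --> (0 : R).
  apply: (@squeeze_cvgr _ _ _ _ (fun=> 0) (@harmonic R)).
  - by apply: nearW => n; rewrite d0_ge0/= d0C hc.
  - exact: cvg_cst.
  - exact: cvg_harmonic.
have [v' [_ gX _]] := centered_gaussian_limit (fun n => measurable_lincomb (c n) mB) mX
  (fun n => (hv n).1) (fun n => (hv n).2) dc.
by have [i2 ->] := centered_gaussian_second_moment mX gX.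
Qed.

(** Convergence in probability upgrades to convergence of the variances because all the variables
    are Gaussian; this stands in for uniform integrability. *)
Lemma gaussian_span_moment_cvg (X_ : nat -> T -> R) X : (forall n, gaussian_span B (X_ n)) ->
  measurable_fun setT X -> d0 P (X_ n) X @[n --> \oo] --> (0 : R) ->
  \int[P]_w (X_ n w ^+ 2) @[n --> \oo] --> \int[P]_w (X w ^+ 2).
Proof.
move=> gX mX dX.
have E0 n : 0 <= \int[P]_w (X_ n w ^+ 2) by apply: Rintegral_ge0 => w _; exact: sqr_ge0.
have [v [_ gv vl]] := centered_gaussian_limit (fun n => (gX n).1) mX
  E0 (fun n => (gaussian_span_gaussian (gX n)).2) dX.
by have [_ ->] := centered_gaussian_second_moment mX gv.
Qed.

End fixed_base.

(** If the positive or the negative part had infinite integral, their difference in the extended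
    reals would be infinite, even as oo - oo. The centring of B thus contains its integrability. *)
Lemma integrable_of_integral_eq0 X : measurable_fun setT X ->
  (\int[P]_w (X w)%:E = 0)%E -> P.-integrable setT (EFin \o X).
Proof.
move=> mX; have mE : measurable_fun setT (EFin \o X) by exact/measurable_EFinP.
rewrite -[fun w => (X w)%:E]/(EFin \o X) integralE => h.
have p0 : (0 <= \int[P]_w (EFin \o X)^\+ w)%E by exact: integral_ge0.
have n0 : (0 <= \int[P]_w (EFin \o X)^\- w)%E by exact: integral_ge0.
have [pf nf] : (\int[P]_w (EFin \o X)^\+ w < +oo)%E /\ (\int[P]_w (EFin \o X)^\- w < +oo)%E.
  move: h p0 n0; case: (\int[P]_w _^\+ w)%E => [r| |]; case: (\int[P]_w _^\- w)%E => [s| |] //=;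
  by rewrite ?ltry.
apply/integrableP; split => //.
rewrite -[fun w => _]/(abse \o (EFin \o X)) fune_abse ge0_integralD//.
- by rewrite lte_add_pinfty.
- exact: measurable_funepos.
- exact: measurable_funeneg.
Qed.

Lemma gaussian_base_fbm H (B : R -> {RV P >-> R}) : fractional_brownian_motion H B ->
  gaussian_base (fun t => B t : T -> R).
Proof.
move=> [gB EB _ _]; split => [t|c]; first exact: measurable_funP.
have iB t : P.-integrable setT (EFin \o B t).
  apply: integrable_of_integral_eq0; first exact: measurable_funP.
  by rewrite -expectation_def; exact: EB.
have iB0 t : \int[P]_w B t w = 0.
  by rewrite /Rintegral -expectation_def EB.
have [ic Ec] : P.-integrable setT (EFin \o lincomb (fun t => B t : T -> R) c) /\
    \int[P]_w lincomb (fun t => B t : T -> R) c w = 0.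
  elim: c => [|p c [ih1 ih2]].
    rewrite (_ : lincomb _ [::] = (fun=> 0)); last by apply/funext => w; rewrite /lincomb big_nil.
    by split; [apply: (@integrable_bounded _ _ _ P _ 0) => // w; rewrite normr0
              |rewrite Rintegral_prob_cst].
  rewrite (_ : lincomb _ (p :: c) = (fun w => p.1 * B p.2 w + lincomb (fun t => B t : T -> R) c w)); last first.
    by apply/funext => w; rewrite /lincomb big_cons.
  have i1 : P.-integrable setT (EFin \o (fun w => p.1 * B p.2 w)).
    by have := integrableZl measurableT p.1 (iB p.2); exact.
  split; first by have := integrableD measurableT i1 ih1; exact.
  by rewrite (RintegralD measurableT i1 ih1) (RintegralZl _ measurableT (iB p.2)) iB0 mulr0 ih2 addr0.
apply: gaussian_law_cos => //.
  by apply: measurable_lincomb => t; exact: measurable_funP.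
have := gB (size c) (fun i => (nth (0, 0) c i).1) (fun i => (nth (0, 0) c i).2).
congr (gaussian_law (pushforward P _)); apply/funext => w.
by rewrite /lincomb (big_nth (0, 0)) big_mkord.
Qed.

End gaussian_span.

(** * The stationary fractional Ornstein-Uhlenbeck process *)

Section riemann_sums.
Context {R : realType}.
Implicit Types (f F u b : R -> R).

Lemma continuous_unif_itv f (a b e : R) : continuous f -> 0 < e ->
  exists2 d : R, 0 < d & forall x y, a <= x <= b -> `|y - x| < d -> `|f y - f x| <= e.
Proof.
move=> cf e0.
have /compact_near_coveringP/(_ R (0 : R)^'+
    (fun d x => forall y, `|y - x| < d -> `|f y - f x| <= e)) := @segment_compact R a b.
move=> /(_ _)[x _|d0 /= d00 hd].
  have e20 : 0 < e / 2 by rewrite divr_gt0.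
  have /cvgrPdist_lt/(_ _ e20) [eta /= eta0 heta] := cf x.
  have near_x : \forall x' \near x, `|x - x'| < eta / 2.
    by exists (eta / 2); rewrite //= divr_gt0.
  have near_d : \forall d \near (0 : R)^'+, d < eta / 2.
    by apply: nbhs_right_lt; rewrite divr_gt0.
  exists ([set x' | `|x - x'| < eta / 2], [set d | d < eta / 2]) => // -[x' d]/= [xx' dd] y yx'.
  have h1 : `|f x - f x'| < e / 2.
    by apply: heta => /=; apply: lt_trans xx' _; rewrite ltr_pdivrMr// ltr_pMr// ltr1n.
  have h2 : `|f x - f y| < e / 2.
    apply: heta => /=; apply: le_lt_trans (ler_distD x' x y) _.
    by rewrite [ltRHS]splitr ltrD// distrC (lt_trans yx').
  apply: le_trans (ler_distD (f x) (f y) (f x')) _.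
  by rewrite [leRHS]splitr lerD// ltW// distrC.
exists (d0 / 2); first by rewrite divr_gt0.
move=> x y xab; have d02 : 0 < d0 / 2 by rewrite divr_gt0.
apply: hd => /=; last by rewrite in_itv.
  by rewrite sub0r normrN gtr0_norm// ltr_pdivrMr// ltr_pMr// ltr1n.
by [].
Qed.

(** The limit is expressed by a primitive F, and each cell is compared with it by the mean value
    theorem. *)
Lemma riemann_sum_cvg F f (a b : R) : a <= b -> continuous f ->
  (forall x, a <= x <= b -> is_derive x 1 F (f x)) ->
  (b - a) / n.+1%:R * \sum_(i < n.+1) f (a + (b - a) / n.+1%:R * i%:R) @[n --> \oo] -->
  F b - F a.
Proof.
move=> ab cf dF; apply/cvgrPdist_le => e e0.
(* The denominator is 1 + (b - a) because a = b is allowed. *)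
have e'0 : 0 < e / (1 + (b - a)) by rewrite divr_gt0//; lra.
have [d d0 hd] := continuous_unif_itv a b cf e'0.
near=> n.
pose h := (b - a) / n.+1%:R; pose x i := a + h * i%:R.
have n0 : 0 < n.+1%:R :> R by rewrite ltr0n.
have h0 : 0 <= h by rewrite divr_ge0 ?subr_ge0// ltW.
have hdd : h < d.
  rewrite /h ltr_pdivrMr// mulrC -ltr_pdivrMr//.
  apply: (@lt_trans _ _ n%:R); last by rewrite ltr_nat.
  by near: n; exact: nbhs_infty_gtr.
have xb i : (i <= n.+1)%N -> a <= x i <= b.
  move=> ni; rewrite /x lerDl mulr_ge0//= -lerBrDl.
  by rewrite /h mulrAC ler_pdivrMr// ler_wpM2l ?subr_ge0// ler_nat.
have step i : (i < n.+1)%N -> `|F (x i.+1) - F (x i) - h * f (x i)| <= h * (e / (1 + (b - a))).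
  move=> ni; have /andP[ax xb1] := xb i (ltnW ni); have /andP[ax' xb'] := xb i.+1 ni.
  have xx : x i.+1 - x i = h by rewrite /x -natr1; ring.
  have xle : x i <= x i.+1 by rewrite -subr_ge0 xx.
  have dF' y : y \in `]x i, x i.+1[ -> is_derive y (1 : R) F (f y).
    rewrite in_itv/= => /andP[y1 y2]; apply: dF.
    by rewrite (le_trans ax (ltW y1)) (le_trans (ltW y2)).
  have cF : {within `[x i, x i.+1], continuous F}.
    apply: continuous_in_subspaceT => y; rewrite inE/= in_itv/= => /andP[y1 y2].
    by apply: is_derive_continuous (dF y _); rewrite (le_trans ax y1) (le_trans y2).
  have [c /[!in_itv]/= /andP[c1 c2] ->] := MVT_segment xle dF' cF.
  rewrite xx mulrC -mulrBr normrM ger0_norm// ler_wpM2l// hd ?ax ?xb1//.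
  by rewrite ger0_norm ?subr_ge0//; lra.
have -> : F b - F a = \sum_(0 <= i < n.+1) (F (x i.+1) - F (x i)).
  rewrite telescope_sumr// /x mulr0 addr0; congr (F _ - _).
  by rewrite /h divfK ?gt_eqF//; ring.
rewrite big_mkord mulr_sumr -sumrB.
apply: le_trans (ler_norm_sum _ _ _) _.
apply: (@le_trans _ _ (\sum_(i < n.+1) h * (e / (1 + (b - a))))).
  by apply: ler_sum => i _; apply: step.
rewrite sumr_const card_ord -mulr_natl mulrA.
rewrite (_ : n.+1%:R * h = b - a); last by rewrite /h mulrC divfK ?gt_eqF.
rewrite mulrA ler_pdivrMr; last by lra.
by rewrite mulrC ler_wpM2l ?(ltW e0)//; lra.
Unshelve. all: by end_near. Qed.

Lemma is_derive_primitive f (c x : R) : (forall y, c <= y -> {for y, continuous f}) ->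
  c < x ->
  is_derive x (1 : R) (fun t => \int[@lebesgue_measure R]_(r in `[c, t]) f r) (f x).
Proof.
move=> cf cx; have xx : x < x + 1 by rewrite ltrDl.
have fi : (@lebesgue_measure R).-integrable `[c, x + 1] (EFin \o f).
  apply: continuous_compact_integrable; first exact: segment_compact.
  apply: continuous_in_subspaceT => y; rewrite inE/= in_itv/= => /andP[cy _].
  exact: cf.
have [h1 h2] := continuous_FTC1_closed xx fi cx (cf x (ltW cx)).
by split; [exact: h1|rewrite -derive1E; exact: h2].
Qed.

Section langevin_path.
Variables (u b : R -> R) (xi sigma : R).
Hypotheses (cu : continuous u) (cb : continuous b).
Hypothesis langevin : forall s t : R, s <= t ->
  u t - u s = - xi * (\int[@lebesgue_measure R]_(r in `[s, t]) u r) + sigma * (b t - b s).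

(** Neither u nor b need be differentiable, but u - sigma b is a primitive of - xi u; the pathwise
    calculus goes through it. *)
Lemma langevin_derive (x : R) :
  is_derive x (1 : R) (fun t => u t - sigma * b t) (- xi * u x).
Proof.
pose c := x - 1; have cx : c < x by rewrite /c; lra.
have cu' (y : R) : c <= y -> {for y, continuous u} by move=> _; exact: cu.
have := is_derive_fD (is_derive_fcst (u c - sigma * b c) x)
  (is_derive_fZ (- xi) (@is_derive_primitive u c x cu' cx)).
rewrite add0r; apply: near_eq_is_derive; near=> y.
have cy : c <= y by apply: ltW; near: y; exact: lt_nbhsr.
by have := langevin cy; lra.
Unshelve. all: by end_near. Qed.

(** The sums approximate xi times the time integral of u, and are finite combinations of values of
    u, so they stay in the Gaussian space. *)
Lemma langevin_riemann (s t : R) : s <= t ->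
  xi * ((t - s) / n.+1%:R * \sum_(i < n.+1) u (s + (t - s) / n.+1%:R * i%:R)) @[n --> \oo] -->
  sigma * (b t - b s) - (u t - u s).
Proof.
move=> st.
have cf : continuous (fun x => - xi * u x).
  by move=> x; apply: cvgM; [exact: cvg_cst|exact: cu].
rewrite (_ : sigma * (b t - b s) - _ =
  - (u t - sigma * b t - (u s - sigma * b s))); last by ring.
rewrite (_ : (fun n => _) = (fun n => - ((t - s) / n.+1%:R *
    \sum_(i < n.+1) (- xi * u (s + (t - s) / n.+1%:R * i%:R))))); last first.
  by apply/funext => n; rewrite -mulr_sumr; ring.
by apply: cvgN; exact: (riemann_sum_cvg st cf (fun x _ => langevin_derive x)).
Qed.

(** Variation of constants after integration by parts: e^(xi r) (u - sigma b) has the continuous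
    derivative - xi sigma e^(xi r) b, so no stochastic integral appears. *)
Lemma langevin_duhamel (s t : R) : s <= t ->
  - (xi * sigma) * expR (- xi * t) * ((t - s) / n.+1%:R *
    \sum_(i < n.+1) expR (xi * (s + (t - s) / n.+1%:R * i%:R)) *
       b (s + (t - s) / n.+1%:R * i%:R)) @[n --> \oo] -->
  u t - sigma * b t - expR (- xi * (t - s)) * (u s - sigma * b s).
Proof.
move=> st.
have cf : continuous (fun x => expR (xi * x) * b x).
  move=> x; apply: cvgM; last exact: cb.
  apply: continuous_cvg; first exact: continuous_expR.
  by apply: cvgM; [exact: cvg_cst|exact: cvg_id].
have cf' : continuous (fun x => - (xi * sigma) * (expR (xi * x) * b x)).
  by move=> x; apply: cvgM; [exact: cvg_cst|exact: cf].
have dz (x : R) : is_derive x (1 : R) (fun r => expR (xi * r) * (u r - sigma * b r))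
    (- (xi * sigma) * (expR (xi * x) * b x)).
  have := is_derive_fM (is_derive_fcomp (is_derive_expR _) (is_derive_fZ xi (is_derive_fid x)))
    (langevin_derive x).
  by move/is_derive_eq; apply; ring.
rewrite (_ : (fun n => _) = (fun n => expR (- xi * t) * ((t - s) / n.+1%:R *
    \sum_(i < n.+1) (- (xi * sigma) * (expR (xi * (s + (t - s) / n.+1%:R * i%:R)) *
       b (s + (t - s) / n.+1%:R * i%:R)))))); last first.
  by apply/funext => n; rewrite -mulr_sumr; ring.
rewrite (_ : u t - sigma * b t - expR (- xi * (t - s)) * (u s - sigma * b s) =
    expR (- xi * t) * (expR (xi * t) * (u t - sigma * b t) - expR (xi * s) * (u s - sigma * b s))); last first.
  have e1 : expR (- xi * t) * expR (xi * t) = 1.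
    by rewrite -expRD (_ : _ + _ = 0) ?expR0//; ring.
  have e2 : expR (- xi * t) * expR (xi * s) = expR (- xi * (t - s)).
    by rewrite -expRD; congr expR; ring.
  by rewrite [RHS]mulrBr [X in _ = X - _]mulrA e1 mul1r [X in _ = _ - X]mulrA e2.
by apply: cvgM; [exact: cvg_cst|exact: (riemann_sum_cvg st cf' (fun x _ => dz x))].
Qed.

End langevin_path.
End riemann_sums.

(** * Transfer by stationarity, and Gaussianity of the solution *)

Section stationarity.
Context d (T : measurableType d) {R : realType} (P : probability T R).
Variable U : R -> {RV P >-> R}.
Hypothesis statU : stationary_process U.

Lemma stationary_Rintegral (n : nat) (t : 'I_n -> R) (tau : R) (f : n.-tuple R -> R) :
  measurable_fun setT f ->
  P.-integrable setT (fun w => (f [tuple U (t i + tau) w | i < n])%:E) ->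
  P.-integrable setT (fun w => (f [tuple U (t i) w | i < n])%:E) ->
  \int[P]_w f [tuple U (t i + tau) w | i < n] = \int[P]_w f [tuple U (t i) w | i < n].
Proof.
move=> mf i1 i2.
have mtup (s : 'I_n -> R) : measurable_fun setT (fun w => [tuple U (s i) w | i < n]).
  apply/measurable_fun_tnthP => i.
  rewrite (_ : _ \o _ = U (s i)); first exact: measurable_funP.
  by apply/funext => w /=; rewrite tnth_mktuple.
pose X : {mfun T >-> n.-tuple R} := mfun_Sub (mem_set (mtup t)).
have lawX A : measurable A ->
  distribution P X A = P ((fun w => [tuple U (t i) w | i < n]) @^-1` A) by [].
have lawS A : measurable A ->
    distribution P X A = P ((fun w => [tuple U (t i + tau) w | i < n]) @^-1` A).
  by move=> mA; have := statU t tau mA; rewrite /pushforward => ->.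
rewrite -(Rintegral_law (mtup _) lawS mf i1).
by rewrite -(Rintegral_law (mtup _) lawX mf i2).
Qed.

Lemma stationary_Rintegral1 (t : R) (f : R -> R) : measurable_fun setT f ->
  P.-integrable setT (fun w => (f (U t w))%:E) ->
  P.-integrable setT (fun w => (f (U 0 w))%:E) ->
  \int[P]_w f (U t w) = \int[P]_w f (U 0 w).
Proof.
move=> mf i1 i2.
have := @stationary_Rintegral 1 (fun=> 0) t (fun x => f (tnth x ord0)).
have E s w : f (tnth [tuple U s w | _ < 1] ord0) = f (U s w) by rewrite tnth_mktuple.
under [X in _ -> _ -> _ -> X = _]eq_Rintegral do rewrite E.
under [X in _ -> _ -> _ -> _ = X]eq_Rintegral do rewrite E.
rewrite add0r; apply.
- by apply: measurableT_comp => //; exact: measurable_tnth.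
- by under eq_fun do rewrite E.
- by under eq_fun do rewrite E.
Qed.

Lemma stationary_Rintegral2 (s t tau : R) (f : R -> R) : measurable_fun setT f ->
  P.-integrable setT (fun w => (f (U (s + tau) w - U (t + tau) w))%:E) ->
  P.-integrable setT (fun w => (f (U s w - U t w))%:E) ->
  \int[P]_w f (U (s + tau) w - U (t + tau) w) = \int[P]_w f (U s w - U t w).
Proof.
move=> mf i1 i2.
pose st (i : 'I_2) : R := if i == ord0 then s else t.
have := @stationary_Rintegral 2 st tau (fun x => f (tnth x ord0 - tnth x ord_max)).
have E1 w : f (tnth [tuple U (st i + tau) w | i < 2] ord0 -
    tnth [tuple U (st i + tau) w | i < 2] ord_max) = f (U (s + tau) w - U (t + tau) w).
  by rewrite !tnth_mktuple.
have E2 w : f (tnth [tuple U (st i) w | i < 2] ord0 -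
    tnth [tuple U (st i) w | i < 2] ord_max) = f (U s w - U t w).
  by rewrite !tnth_mktuple.
under [X in _ -> _ -> _ -> X = _]eq_Rintegral do rewrite E1.
under [X in _ -> _ -> _ -> _ = X]eq_Rintegral do rewrite E2.
apply.
- by apply: measurableT_comp => //; apply: measurable_funB; exact: measurable_tnth.
- by under eq_fun do rewrite E1.
- by under eq_fun do rewrite E2.
Qed.

End stationarity.

Section fOU_gaussian.
Context d (T : measurableType d) {R : realType} (P : probability T R).
Variables (xi sigma H : R) (B U : R -> {RV P >-> R}).
Hypotheses (xi0 : 0 < xi) (fbm : fractional_brownian_motion H B)
  (sol : fOU_solution xi sigma B U) (statU : stationary_process U).

Let Bf : R -> T -> R := fun t => B t.
Let gB : gaussian_base P Bf := gaussian_base_fbm fbm.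
Let mU t : measurable_fun setT (U t : T -> R). Proof. exact: measurable_funP. Qed.
Let mB t : measurable_fun setT (B t : T -> R). Proof. exact: measurable_funP. Qed.

Lemma fOU_paths : {ae P, forall w, [/\ continuous (fun t => U t w), continuous (fun t => B t w) &
  forall s t : R, s <= t -> U t w - U s w =
    - xi * (\int[@lebesgue_measure R]_(r in `[s, t]) U r w) + sigma * (B t w - B s w)]}.
Proof.
case: fbm => _ _ _ cB; apply: filterS2 sol cB.
by move=> w [cu e] cb; split.
Qed.

(** By [langevin_duhamel] this variable is an almost sure limit of finite combinations of values of
    B. *)
Lemma fOU_increment_span (m : nat) (t : R) :
  gaussian_span P Bf (fun w => U t w - expR (- xi * m%:R) * U (t - m%:R) w).
Proof.
pose s := t - m%:R; have st : s <= t by rewrite gerBl.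
pose h n : R := (t - s) / n.+1%:R.
pose Y n w := sigma * B t w + (- (expR (- xi * (t - s)) * sigma) * B s w +
  - (xi * sigma) * expR (- xi * t) * h n *
    \sum_(i < n.+1) expR (xi * (s + h n * i%:R)) * B (s + h n * i%:R) w).
have gY n : gaussian_span P Bf (Y n).
  apply: (gaussian_spanD gB).
    exact: (gaussian_spanZ gB _ (gaussian_span_base gB t)).
  apply: (gaussian_spanD gB).
    exact: (gaussian_spanZ gB _ (gaussian_span_base gB s)).
  apply: (gaussian_spanZ gB); apply: (gaussian_span_sum gB) => i.
  exact: (gaussian_spanZ gB _ (gaussian_span_base gB _)).
have mX : measurable_fun setT (fun w => U t w - expR (- xi * m%:R) * U s w).
  by apply: measurable_funB => //; exact: measurable_funM.
apply: (gaussian_span_limit gB gY mX); apply: d0_cvg_ae => //.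
  by move=> n; case: (gY n).
apply: filterS fOU_paths => w [cu cb lan].
have ms : m%:R = t - s by rewrite /s; ring.
rewrite ms (_ : U t w - _ = sigma * B t w + (- (expR (- xi * (t - s)) * sigma) * B s w +
    (U t w - sigma * B t w - expR (- xi * (t - s)) * (U s w - sigma * B s w)))); last by ring.
apply: cvgD; first exact: cvg_cst.
apply: cvgD; first exact: cvg_cst.
have := langevin_duhamel cu cb lan st.
by apply: cvg_trans; apply: near_eq_cvg; apply: nearW => n; rewrite mulrA.
Qed.

(** The error e^(-xi m) U_(t-m) has the law of e^(-xi m) U_0, which tends to 0 pointwise; [d0]
    depends on that law only. *)
Lemma fOU_span (t : R) : gaussian_span P Bf (U t).
Proof.
apply: (gaussian_span_limit gB (fun m => fOU_increment_span m t) (mU t)).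
have mf (c : R) : measurable_fun setT (fun x : R => Num.min 1 `|c * x|).
  apply: measurable_minr; first exact: measurable_cst.
  apply: measurableT_comp; first exact: normr_measurable.
  by apply: measurable_funM; [exact: measurable_cst|exact: measurable_id].
have mcU (c : R) s : measurable_fun setT (fun w => c * U s w) by exact: measurable_funM.
have z0 : measurable_fun setT (fun _ : T => 0 : R) by exact: measurable_cst.
have ii (c : R) s : P.-integrable setT (fun w => (Num.min 1 `|c * U s w|)%:E).
  have := integrable_min1 P (mcU c s) z0; apply: eq_integrable => // w _ /=.
  by rewrite subr0.
have E (m : nat) : d0 P (fun w => U t w - expR (- xi * m%:R) * U (t - m%:R) w) (U t) =
    d0 P (fun w => expR (- xi * m%:R) * U 0 w) (fun=> 0).
  rewrite /d0.
  transitivity (\int[P]_w Num.min 1 `|expR (- xi * m%:R) * U (t - m%:R) w|).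
    apply: eq_Rintegral => w _; congr Num.min.
    by rewrite addrAC subrr add0r normrN.
  rewrite (stationary_Rintegral1 statU (mf (expR (- xi * m%:R))) (ii _ _) (ii _ _)).
  by apply: eq_Rintegral => w _; rewrite subr0.
under eq_fun do rewrite E.
apply: d0_cvg_ae => [m|//|]; first exact: mcU.
have e0 : 0 < expR (- xi) by exact: expR_gt0.
have e1 : `|expR (- xi)| < 1 by rewrite ger0_norm ?ltW// expR_lt1 oppr_lt0.
have lim : expR (- xi * m%:R) @[m --> \oo] --> (0 : R).
  have := cvg_expr e1; apply: cvg_trans; apply: near_eq_cvg; apply: nearW => m.
  by rewrite -expRM_natr.
by apply: aeW => w; have := cvgM lim (cvg_cst (U 0 w)); rewrite mul0r; exact.
Qed.

End fOU_gaussian.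

Section discrete_sums.
Context {R : realType}.

(** Summation along diagonals: |i - j| = k occurs 2 (N - k) times for k > 0, and N times for k =
    0. *)
Lemma sum_toeplitz (f : nat -> R) (N : nat) :
  \sum_(i < N) \sum_(j < N) f (`|i - j|)%N =
  2 * \sum_(k < N) (N%:R - k%:R) * f k - N%:R * f 0%N.
Proof.
elim: N => [|N ih]; first by rewrite !big_ord0; ring.
rewrite big_ord_recr/=.
under eq_bigr do rewrite big_ord_recr/=.
rewrite big_split/= ih [X in _ + X]big_ord_recr/= distnn.
have rev g : \sum_(i < N) g (`|N - i|)%N = \sum_(k < N) g k.+1 :> R.
  rewrite (reindex_inj rev_ord_inj)/=; apply: eq_bigr => i _; congr g.
  by rewrite distnEl ?leq_subr// subKn.
under [X in _ + X + _]eq_bigr do rewrite distnC.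
rewrite !rev.
rewrite [in RHS]big_ord_recr/=.
have -> : \sum_(i < N) (N.+1%:R - i%:R) * f i = \sum_(i < N) (N%:R - i%:R) * f i + \sum_(i < N) f i.
  by rewrite -big_split/=; apply: eq_bigr => i _; rewrite -natr1; ring.
have -> : \sum_(k < N) f k.+1 = \sum_(k < N) f k + f N - f 0%N.
  have : \sum_(k < N.+1) f k = \sum_(k < N) f k + f N by rewrite big_ord_recr.
  by rewrite big_ord_recl/= /bump/=; under eq_bigr do rewrite add1n; move=> <-; ring.
rewrite -natr1; ring.
Qed.

End discrete_sums.

(** * Covariances inside the Gaussian space *)

Section span_inner_product.
Context d (T : measurableType d) {R : realType} (P : probability T R).
Variable B : R -> T -> R.
Hypothesis gB : gaussian_base P B.
Implicit Types X Y : T -> R.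
Local Notation S := (gaussian_span P B).

Definition inner X Y : R := \int[P]_w (X w * Y w).

Lemma integrable_prod X Y : S X -> S Y -> P.-integrable setT (EFin \o (fun w => X w * Y w)).
Proof.
move=> sX sY; have [iX _] := gaussian_span_gaussian gB sX.
have [iY _] := gaussian_span_gaussian gB sY.
have mXY : measurable_fun setT (fun w => X w * Y w).
  by apply: measurable_funM; [case: sX|case: sY].
have iXY := integrableD measurableT iX iY.
apply: (le_integrable measurableT _ _ iXY); first exact/measurable_EFinP.
move=> w _ /=; rewrite lee_fin [leRHS]ger0_norm ?addr_ge0 ?sqr_ge0//.
rewrite ler_norml; have := sqr_ge0 (X w - Y w); have := sqr_ge0 (X w + Y w).
rewrite sqrrD sqrrB => h1 h2; have := sqr_ge0 (X w); have := sqr_ge0 (Y w).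
by move=> h3 h4; apply/andP; split; lra.
Qed.

Lemma innerC X Y : inner X Y = inner Y X.
Proof. by apply: eq_Rintegral => w _; rewrite mulrC. Qed.

Lemma innerDl X Y Z : S X -> S Y -> S Z ->
  inner (fun w => X w + Y w) Z = inner X Z + inner Y Z.
Proof.
move=> sX sY sZ; rewrite /inner.
rewrite -(RintegralD measurableT (integrable_prod sX sZ) (integrable_prod sY sZ)).
by apply: eq_Rintegral => w _; rewrite mulrDl.
Qed.

Lemma innerZl (a : R) X Z : S X -> S Z -> inner (fun w => a * X w) Z = a * inner X Z.
Proof.
move=> sX sZ; rewrite /inner -(RintegralZl _ measurableT (integrable_prod sX sZ)).
by apply: eq_Rintegral => w _; rewrite mulrA.
Qed.

Lemma innerDr X Y Z : S X -> S Y -> S Z ->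
  inner Z (fun w => X w + Y w) = inner Z X + inner Z Y.
Proof. by move=> *; rewrite !(innerC Z) innerDl. Qed.

Lemma innerZr (a : R) X Z : S X -> S Z -> inner Z (fun w => a * X w) = a * inner Z X.
Proof. by move=> *; rewrite !(innerC Z) innerZl. Qed.

Lemma gaussian_spanB X Y : S X -> S Y -> S (fun w => X w - Y w).
Proof.
move=> sX sY; have := gaussian_spanD gB sX (gaussian_spanZ gB (-1) sY).
by under eq_fun do rewrite mulN1r.
Qed.

Lemma innerBl X Y Z : S X -> S Y -> S Z ->
  inner (fun w => X w - Y w) Z = inner X Z - inner Y Z.
Proof.
move=> sX sY sZ; rewrite -mulN1r -innerZl// -innerDl//; last exact: gaussian_spanZ.
by apply: eq_Rintegral => w _; rewrite mulN1r.
Qed.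

Lemma innerBr X Y Z : S X -> S Y -> S Z ->
  inner Z (fun w => X w - Y w) = inner Z X - inner Z Y.
Proof. by move=> *; rewrite !(innerC Z) innerBl. Qed.

Lemma inner_suml n (X : 'I_n -> T -> R) Z : (forall i, S (X i)) -> S Z ->
  inner (fun w => \sum_(i < n) X i w) Z = \sum_(i < n) inner (X i) Z.
Proof.
move=> sX sZ; elim: n X sX => [|n ih] X sX.
  rewrite big_ord0 /inner -[RHS](Rintegral_prob_cst P); apply: eq_Rintegral => w _.
  by rewrite big_ord0 mul0r.
rewrite big_ord_recl -ih// -innerDl//; last first.
  by apply: (gaussian_span_sum gB) => i.
by apply: eq_Rintegral => w _; rewrite big_ord_recl.
Qed.

Lemma inner_sumr n (X : 'I_n -> T -> R) Z : (forall i, S (X i)) -> S Z ->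
  inner Z (fun w => \sum_(i < n) X i w) = \sum_(i < n) inner Z (X i).
Proof. by move=> *; rewrite innerC inner_suml//; apply: eq_bigr => i _; exact: innerC. Qed.

Lemma innerXX X : inner X X = \int[P]_w (X w ^+ 2).
Proof. by apply: eq_Rintegral => w _; rewrite expr2. Qed.

Lemma innerXX_ge0 X : 0 <= inner X X.
Proof. by rewrite innerXX; apply: Rintegral_ge0 => w _; exact: sqr_ge0. Qed.

End span_inner_product.

(** * The integral equation of the covariance *)

Section fOU_variogram.
Context d (T : measurableType d) {R : realType} (P : probability T R).
Variables (xi sigma H : R) (B U : R -> {RV P >-> R}).
Hypotheses (xi0 : 0 < xi) (H0 : 0 < H).
Hypotheses (fbm : fractional_brownian_motion H B)
  (sol : fOU_solution xi sigma B U) (statU : stationary_process U).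

Let Bf : R -> T -> R := fun t => B t.
Let gB : gaussian_base P Bf := gaussian_base_fbm fbm.
Let sU t : gaussian_span P Bf (U t) := fOU_span xi0 fbm sol statU t.
Let sB t : gaussian_span P Bf (B t) := gaussian_span_base gB t.
Local Notation "'<' X , Y '>'" := (inner P X Y).

Lemma fbm_increment (t : R) : 0 <= t ->
  \int[P]_w ((B t w - B 0 w) ^+ 2) = t `^ (2 * H).
Proof.
move=> t0; case: fbm => _ EB cov _.
have iB r s : inner P (B r) (B s) =
    (`|r| `^ (2 * H) + `|s| `^ (2 * H) - `|s - r| `^ (2 * H)) / 2.
  have := cov r s; rewrite covariance.unlock !EB.
  rewrite unlock => h; rewrite /inner /Rintegral.
  rewrite -[RHS]/(fine ((`|r| `^ (2 * H) + `|s| `^ (2 * H) - `|s - r| `^ (2 * H)) / 2)%:E).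
  rewrite -h; congr fine; apply: eq_integral => w _; congr EFin.
  change (B r w * B s w = (B r w - fine 0%E) * (B s w - fine 0%E)).
  by rewrite /= !subr0.
rewrite -(innerXX P (fun w => B t w - B 0 w)).
rewrite (innerBl gB (sB t) (sB 0) (gaussian_spanB gB (sB t) (sB 0))).
rewrite (innerBr gB (sB t) (sB 0) (sB t)) (innerBr gB (sB t) (sB 0) (sB 0)) !iB.
have H20 : 2 * H != 0 by rewrite mulf_neq0// gt_eqF.
rewrite !subrr sub0r subr0 !normr0 normrN powR0// ger0_norm//.
by field.
Qed.

Definition fOU_var : R := inner P (U 0) (U 0).
Definition fOU_incr (t : R) : R := \int[P]_w ((U t w - U 0 w) ^+ 2).
(** Defined by polarization from the variance of the increments, which depends on the lag only;
    [fOU_covE] identifies it with the covariance. *)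
Definition fOU_cov (t : R) : R := fOU_var - fOU_incr t / 2.

Lemma fOU_var_stat (t : R) : inner P (U t) (U t) = fOU_var.
Proof.
rewrite /fOU_var !innerXX.
have mf : measurable_fun setT (fun x : R => x ^+ 2).
  by apply: measurable_funX; exact: measurable_id.
by apply: (stationary_Rintegral1 statU mf); exact: (gaussian_span_gaussian gB (sU _)).1.
Qed.

Lemma fOU_incr_stat (s t : R) :
  \int[P]_w ((U s w - U t w) ^+ 2) = fOU_incr (s - t).
Proof.
have mf : measurable_fun setT (fun x : R => x ^+ 2).
  by apply: measurable_funX; exact: measurable_id.
have := @stationary_Rintegral2 _ _ _ _ _ statU (s - t) 0 t _ mf.
rewrite subrK add0r; apply.
  exact: (gaussian_span_gaussian gB (gaussian_spanB gB (sU s) (sU t))).1.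
exact: (gaussian_span_gaussian gB (gaussian_spanB gB (sU (s - t)) (sU 0))).1.
Qed.

Lemma fOU_covE (s t : R) : inner P (U s) (U t) = fOU_cov (s - t).
Proof.
rewrite /fOU_cov -fOU_incr_stat -(innerXX P (fun w => U s w - U t w)).
rewrite (innerBl gB (sU s) (sU t) (gaussian_spanB gB (sU s) (sU t))).
rewrite (innerBr gB (sU s) (sU t) (sU s)) (innerBr gB (sU s) (sU t) (sU t)).
rewrite !fOU_var_stat (innerC P (U t) (U s)); lra.
Qed.

Lemma fOU_cov_even (t : R) : fOU_cov (- t) = fOU_cov t.
Proof.
by have := fOU_covE 0 t; have := fOU_covE t 0; rewrite innerC sub0r subr0 => -> ->.
Qed.

Lemma fOU_cov0 : fOU_cov 0 = fOU_var.
Proof. by have := fOU_covE 0 0; rewrite subrr => <-. Qed.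

Lemma fOU_incrE (t : R) : fOU_incr t = 2 * (fOU_var - fOU_cov t).
Proof. rewrite /fOU_cov; lra. Qed.

Lemma fOU_cov_bound (t : R) : - fOU_var <= fOU_cov t <= fOU_var.
Proof.
have sD : gaussian_span P Bf (fun w => U t w + U 0 w) by exact: gaussian_spanD.
have : 0 <= fOU_incr t by apply: Rintegral_ge0 => w _; exact: sqr_ge0.
have := innerXX_ge0 P (fun w => U t w + U 0 w).
rewrite (innerDl gB (sU t) (sU 0) sD).
rewrite (innerDr gB (sU t) (sU 0) (sU t)) (innerDr gB (sU t) (sU 0) (sU 0)).
rewrite !fOU_covE !subr0 subrr sub0r fOU_cov_even fOU_cov0 fOU_incrE => *.
by apply/andP; split; lra.
Qed.

(** Along a sequence u_n -> t, continuity of the paths gives almost sure convergence of U, and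
    [gaussian_span_moment_cvg] turns it into convergence of the second moments. *)
Lemma fOU_cov_continuous : continuous fOU_cov.
Proof.
move=> t; apply: cvgB; first exact: cvg_cst.
apply: cvgM; last exact: cvg_cst.
apply/(@cvg_nbhsP _ R^o) => u ut.
apply: (@gaussian_span_moment_cvg _ _ _ _ _ gB (fun n w => U (u n) w - U 0 w)).
- by move=> n; exact: gaussian_spanB.
- by apply: measurable_funB; exact: measurable_funP.
- apply: d0_cvg_ae.
  + by move=> n; apply: measurable_funB; exact: measurable_funP.
  + by apply: measurable_funB; exact: measurable_funP.
  + apply: filterS (fOU_paths fbm sol) => w [cu _ _].
    apply: cvgB; last exact: cvg_cst.
    by move/(@cvg_nbhsP _ R^o): (cu t); apply.
Qed.

(* The cross term of the expansion telescopes: E[(U_t - U_0) U_s] is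
   C (t - s) - C s, and s |-> t - s permutes the partition. *)
Lemma fOU_euler_moment (t : R) (n : nat) : 0 <= t ->
  let h := t / n.+1%:R in
  \int[P]_w ((U t w - U 0 w + xi * (h * \sum_(i < n.+1) U (h * i%:R) w)) ^+ 2) =
  fOU_incr t + 2 * xi * h * (fOU_cov t - fOU_var) +
  xi ^+ 2 * (2 * (h * \sum_(i < n.+1) (t - h * i%:R) * fOU_cov (h * i%:R)) - h * t * fOU_var).
Proof.
move=> t0 h.
pose D w := U t w - U 0 w; pose S w := \sum_(i < n.+1) U (h * i%:R) w.
have sD : gaussian_span P Bf D by exact: gaussian_spanB.
have sS : gaussian_span P Bf S.
  by apply: (gaussian_span_sum gB) => i; exact: sU.
have sxS : gaussian_span P Bf (fun w => xi * h * S w) by exact: gaussian_spanZ.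
have sDS := gaussian_spanD gB sD sxS.
have N0 : n.+1%:R != 0 :> R by rewrite pnatr_eq0.
have hN : h * n.+1%:R = t by rewrite /h divfK.
clearbody h.
transitivity (inner P (fun w => D w + xi * h * S w) (fun w => D w + xi * h * S w)).
  by rewrite innerXX; apply: eq_Rintegral => w _; rewrite /D /S mulrA.
rewrite (innerDl gB sD sxS sDS) (innerDr gB sD sxS sD) (innerDr gB sD sxS sxS).
rewrite (innerZl gB _ sS sD) (innerZr gB _ sS sD) (innerZl gB _ sS sxS) (innerZr gB _ sS sS).
rewrite (innerC P S D).
have -> : inner P D D = fOU_incr t by rewrite innerXX.
have -> : inner P D S = fOU_cov t - fOU_var.
  rewrite (inner_sumr gB (X := fun i w => U (h * i%:R) w))//.
  under eq_bigr => i _ do rewrite (innerBl gB (sU t) (sU 0) (sU _)) !fOU_covE sub0r fOU_cov_even.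
  rewrite sumrB (reindex_inj rev_ord_inj)/=.
  under eq_bigr => i _.
    rewrite (_ : t - _ = h * i.+1%:R); first over.
    by rewrite subSS natrB -1?ltnS// -hN -!natr1; ring.
  rewrite -sumrB -(big_mkord xpredT (fun i => fOU_cov (h * i.+1%:R) - fOU_cov (h * i%:R))).
  by rewrite (telescope_sumr (fun i => fOU_cov (h * i%:R)))// hN mulr0 fOU_cov0.
have -> : inner P S S = 2 * \sum_(k < n.+1) (n.+1%:R - k%:R) * fOU_cov (h * k%:R) - n.+1%:R * fOU_var.
  rewrite (inner_suml gB (X := fun i w => U (h * i%:R) w))//.
  have := sum_toeplitz (fun k => fOU_cov (h * k%:R)) n.+1.
  rewrite mulr0 fOU_cov0 => <-; apply: eq_bigr => i _.
  rewrite (inner_sumr gB (X := fun i w => U (h * i%:R) w))//; apply: eq_bigr => j _.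
  rewrite fOU_covE -mulrBr.
  have [ij|ij] := leqP i j.
    by rewrite distnEr// natrB// -fOU_cov_even; congr fOU_cov; ring.
  by rewrite distnEl ?(ltnW ij)// natrB ?(ltnW ij).
have -> : h * \sum_(i < n.+1) (t - h * i%:R) * fOU_cov (h * i%:R) =
    h ^+ 2 * \sum_(k < n.+1) (n.+1%:R - k%:R) * fOU_cov (h * k%:R).
  rewrite !mulr_sumr; apply: eq_bigr => i _.
  by rewrite -{1}hN; ring.
have -> : h * t = h ^+ 2 * n.+1%:R by rewrite expr2 -mulrA hN.
by ring.
Qed.

(** Limit of [fOU_euler_moment], with C = [fOU_cov]: the left side tends to sigma^2 t^(2H), the
    cross term vanishes with the mesh, and the sum h sum_i (t - h i) C(h i) tends to int_0^t (t - r)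
    C(r) dr = A(t). *)
Lemma fOU_variogram_eq (A A1 : R -> R) : A 0 = 0 -> A1 0 = 0 ->
  (forall x : R, 0 <= x -> is_derive x (1 : R) A (A1 x)) ->
  (forall x : R, 0 <= x -> is_derive x (1 : R) A1 (fOU_cov x)) ->
  forall t : R, 0 <= t -> fOU_incr t = sigma ^+ 2 * t `^ (2 * H) - 2 * xi ^+ 2 * A t.
Proof.
move=> A0 A10 dA dA1 t t0.
pose h (n : nat) : R := t / n.+1%:R.
pose Y n w := U t w - U 0 w + xi * (h n * \sum_(i < n.+1) U (h n * i%:R) w).
have sY n : gaussian_span P Bf (Y n).
  apply: gaussian_spanD => //; first exact: gaussian_spanB.
  apply: gaussian_spanZ => //; apply: gaussian_spanZ => //.
  by apply: (gaussian_span_sum gB) => i; exact: sU.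
have mZ : measurable_fun setT (fun w => sigma * (B t w - B 0 w)).
  by apply: measurable_funM => //; apply: measurable_funB; exact: measurable_funP.
have dYZ : d0 P (Y n) (fun w => sigma * (B t w - B 0 w)) @[n --> \oo] --> (0 : R).
  apply: d0_cvg_ae => //; first by move=> n; case: (sY n).
  apply: filterS (fOU_paths fbm sol) => w [cu cb lan].
  have := langevin_riemann cu lan t0.
  rewrite subr0 => /(cvgD (cvg_cst (U t w - U 0 w))).
  rewrite (addrC _ (_ - _)) subrK; apply: cvg_trans; apply: near_eq_cvg; apply: nearW => n.
  by rewrite /Y; congr (_ + _ * (_ * _)); apply: eq_bigr => i _; rewrite add0r.
have lim1 := gaussian_span_moment_cvg gB sY mZ dYZ.
have EZ : \int[P]_w ((sigma * (B t w - B 0 w)) ^+ 2) = sigma ^+ 2 * t `^ (2 * H).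
  rewrite -fbm_increment// -RintegralZl//; last first.
    exact: (gaussian_span_gaussian gB (gaussian_spanB gB (sB t) (sB 0))).1.
  by apply: eq_Rintegral => w _; rewrite exprMn.
rewrite EZ in lim1.
have h0 : h @ \oo --> (0 : R).
  rewrite -(mulr0 t); apply: cvgM; first exact: cvg_cst.
  exact: cvg_harmonic.
(* A primitive of (t - r) C(r) that is 0 at r = 0 and A(t) at r = t. *)
have dG (x : R) : 0 <= x <= t -> is_derive x (1 : R) (fun r => (t - r) * A1 r + A r) ((t - x) * fOU_cov x).
  move=> /andP[x0 _].
  have := is_derive_fD (is_derive_fM (is_derive_fB (is_derive_fcst t x) (is_derive_fid x))
    (dA1 x x0)) (dA x x0).
  by move/is_derive_eq; apply; ring.
have cf : continuous (fun x => (t - x) * fOU_cov x).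
  move=> x; apply: cvgM; last exact: fOU_cov_continuous.
  by apply: cvgB; [exact: cvg_cst|exact: cvg_id].
have := riemann_sum_cvg t0 cf dG.
rewrite subrr mul0r add0r A10 mulr0 A0 addr0 !subr0 => lim2.
have lim3 : \int[P]_w (Y n w ^+ 2) @[n --> \oo] --> fOU_incr t + 2 * xi * 0 * (fOU_cov t - fOU_var) +
    xi ^+ 2 * (2 * A t - 0 * t * fOU_var).
  under eq_fun do rewrite /Y fOU_euler_moment//.
  apply: cvgD; first apply: cvgD; first exact: cvg_cst.
    by apply: cvgM; last exact: cvg_cst; apply: cvgM; first exact: cvg_cst.
  apply: cvgM; first exact: cvg_cst.
  apply: cvgB.
    apply: cvgM; first exact: cvg_cst.
    move: lim2; apply: cvg_trans; apply: near_eq_cvg; apply: nearW => n.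
    by congr (_ * _); apply: eq_bigr => i _; rewrite add0r.
  by apply: cvgM; last exact: cvg_cst; apply: cvgM; last exact: cvg_cst.
have E : sigma ^+ 2 * t `^ (2 * H) = fOU_incr t + 2 * xi * 0 * (fOU_cov t - fOU_var) +
    xi ^+ 2 * (2 * A t - 0 * t * fOU_var) by exact: (cvg_unique _ lim1 lim3).
by rewrite E; ring.
Qed.

End fOU_variogram.

(** * The Gaussian law of (U_0, U_h - U_0) *)

Section fOU_structure.
Context d (T : measurableType d) {R : realType} (P : probability T R).
Variables (xi sigma H : R) (B U : R -> {RV P >-> R}).
Hypotheses (xi0 : 0 < xi) (sigma0 : 0 < sigma) (H0 : 0 < H).
Hypotheses (fbm : fractional_brownian_motion H B)
  (sol : fOU_solution xi sigma B U) (statU : stationary_process U).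

Let R0 := fOU_var U.

(** The base points -2 and -1 lie to the left of 0, so that the derivatives at 0 are two-sided, as
    [variogram_eq] requires. *)
Lemma double_primitive (f : R -> R) : continuous f -> exists A A1 : R -> R,
  [/\ A 0 = 0, A1 0 = 0,
      forall x : R, 0 <= x -> is_derive x (1 : R) A (A1 x)
    & forall x : R, 0 <= x -> is_derive x (1 : R) A1 (f x)].
Proof.
move=> cf.
pose I1 t := \int[@lebesgue_measure R]_(r in `[- 2, t]) f r.
pose A1 t := I1 t - I1 0.
have cf' (y : R) : - 2 <= y -> {for y, continuous f} by move=> _; exact: cf.
have dA1 (x : R) : - 2 < x -> is_derive x (1 : R) A1 (f x).
  move=> x2; have := is_derive_fB (is_derive_primitive cf' x2)
    (is_derive_fcst (I1 0) x).
  by move/is_derive_eq; apply; rewrite subr0.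
pose I2 t := \int[@lebesgue_measure R]_(r in `[- 1, t]) A1 r.
pose A t := I2 t - I2 0.
have cA1 (y : R) : - 1 <= y -> {for y, continuous A1}.
  by move=> y1; apply: is_derive_continuous (dA1 y _); lra.
have dA (x : R) : - 1 < x -> is_derive x (1 : R) A (A1 x).
  move=> x1; have := is_derive_fB (is_derive_primitive cA1 x1) (is_derive_fcst (I2 0) x).
  by move/is_derive_eq; apply; rewrite subr0.
exists A, A1; split; rewrite /A /A1 ?subrr//.
- by move=> x x0; apply: dA; lra.
- by move=> x x0; apply: dA1; lra.
Qed.

(** If R0 = 0, all covariances vanish and the equation at t = 1 reads 0 = sigma^2. *)
Lemma fOU_var_gt0 : 0 < R0.
Proof.
rewrite lt_neqAle innerXX_ge0 andbT; apply/eqP => R00.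
have c0 x : fOU_cov U x = 0.
  by have := fOU_cov_bound xi0 fbm sol statU x; rewrite -/R0 -R00; lra.
have dz (x : R) : 0 <= x -> is_derive x (1 : R) (fun=> (0 : R)) (fOU_cov U x).
  by move=> _; rewrite c0; exact: is_derive_fcst.
have dz0 (x : R) : 0 <= x -> is_derive x (1 : R) (fun=> (0 : R)) 0.
  by move=> _; exact: is_derive_fcst.
have := fOU_variogram_eq xi0 H0 fbm sol statU (A := fun=> 0) (A1 := fun=> 0)
  erefl erefl dz0 dz ler01.
rewrite (fOU_incrE U 1) c0 -/R0 -R00 powR1 mulr1 mulr0 subrr mulr0 subr0.
by move=> /esym/eqP; rewrite sqrf_eq0 gt_eqF.
Qed.

(** Scaling time by xi and dividing by 2 R0 leaves an equation in H and k alone. The quadratic form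
    in the exponent is the variance of a U_0 + b (U_h - U_0), since E[U_0 (U_h - U_0)] = - R0 y and
    E[(U_h - U_0)^2] = 2 R0 y. *)
Lemma fOU_structure : exists k A A1, [/\ variogram_eq H k A A1,
    k * xi `^ (2 * H) * (2 * R0) = sigma ^+ 2
  & forall h a b c, 0 <= h -> let y := k * (xi * h) `^ (2 * H) - A (xi * h) in
    \int[P]_w cos (a * U 0 w + b * (U h w - U 0 w) + c) =
    cos c * expR (- (R0 * (a ^+ 2 - 2 * a * b * y + 2 * b ^+ 2 * y) / 2))].
Proof.
have R00 := fOU_var_gt0.
have [A [A1 [A0 A10 dA dA1]]] := double_primitive (fOU_cov_continuous xi0 fbm sol statU).
have var := fOU_variogram_eq xi0 H0 fbm sol statU A0 A10 dA dA1.
have xV0 : 0 < xi^-1 by rewrite invr_gt0.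
have H20 : 2 * H != 0 by rewrite mulf_neq0// gt_eqF.
pose k := sigma ^+ 2 * xi^-1 `^ (2 * H) / (2 * R0).
pose A' x := xi ^+ 2 / R0 * A (xi^-1 * x).
pose A1' x := xi / R0 * A1 (xi^-1 * x).
have xx x : 0 <= x -> 0 <= xi^-1 * x by move=> x0; rewrite mulr_ge0// ltW.
have yE x : 0 <= x -> k * x `^ (2 * H) - A' x = fOU_incr U (xi^-1 * x) / (2 * R0).
  move=> x0; rewrite var ?xx// powRM ?(ltW xV0)// /k /A'.
  by field; rewrite gt_eqF.
exists k, A', A1'; split.
- split.
  + by rewrite /A' mulr0 A0 mulr0.
  + by rewrite /A1' mulr0 A10 mulr0.
  + move=> x x0; have := is_derive_fZ (xi ^+ 2 / R0) (is_derive_rescale (dA _ (xx x x0))).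
    by move/is_derive_eq; apply; rewrite /A1'; field; rewrite !gt_eqF.
  + move=> x x0; have := is_derive_fZ (xi / R0) (is_derive_rescale (dA1 _ (xx x x0))).
    move/is_derive_eq; apply; rewrite yE// (fOU_incrE U) -/R0.
    by field; rewrite !gt_eqF.
  + move=> x x0; rewrite yE//.
    have := fOU_cov_bound xi0 fbm sol statU (xi^-1 * x).
    rewrite (fOU_incrE U) -/R0 => /andP[b1 b2].
    rewrite divr_ge0/= ?mulr_ge0 ?subr_ge0 ?(ltW R00)//.
    by rewrite ler_pdivrMr ?mulr_gt0//; lra.
- rewrite (_ : k * _ * _ = sigma ^+ 2 * (xi^-1 `^ (2 * H) * xi `^ (2 * H))).
    by rewrite -powRM ?(ltW xV0) ?(ltW xi0)// mulVf ?gt_eqF// powR1 mulr1.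
  by rewrite /k; field; rewrite gt_eqF.
- move=> h a b c h0 y.
  have yh : y = fOU_incr U h / (2 * R0).
    by rewrite /y yE ?mulr_ge0 ?(ltW xi0)// mulKf ?gt_eqF.
  have gB := gaussian_base_fbm fbm.
  have sU := fOU_span xi0 fbm sol statU.
  have sD := gaussian_spanB gB (sU h) (sU 0).
  have s1 := gaussian_spanZ gB a (sU 0); have s2 := gaussian_spanZ gB b sD.
  have s3 := gaussian_spanD gB s1 s2.
  have [_ /(_ 1 c)] := gaussian_span_gaussian gB s3.
  under eq_Rintegral do rewrite mul1r.
  move=> ->; congr (_ * expR (- _)); rewrite expr1n mul1r; congr (_ / 2).
  rewrite -innerXX (innerDl gB s1 s2 s3) (innerDr gB s1 s2 s1) (innerDr gB s1 s2 s2).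
  rewrite (innerZl gB _ (sU 0) s1) (innerZr gB _ (sU 0) (sU 0)).
  rewrite (innerZl gB _ sD s1) (innerZr gB _ (sU 0) sD).
  rewrite (innerZl gB _ (sU 0) s2) (innerZr gB _ sD (sU 0)).
  rewrite (innerZl gB _ sD s2) (innerZr gB _ sD sD).
  rewrite (innerC P (U 0) (fun w => U h w - U 0 w)).
  rewrite (innerBl gB (sU h) (sU 0) (sU 0)) (innerXX P (fun w => U h w - U 0 w)).
  rewrite !(fOU_covE xi0 fbm sol statU) !subr0 (fOU_cov0 xi0 fbm sol statU).
  rewrite -/(fOU_incr U h) -/R0.
  have := fOU_incrE U h; rewrite -/R0 => incE.
  by rewrite yh incE; field; rewrite gt_eqF.
Qed.

End fOU_structure.

Section stationary_char_fun.
Context {R : realType}.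

Definition gaussian_exponent (R0 y a b : R) : R :=
  R0 * (a ^+ 2 - 2 * a * b * y + 2 * b ^+ 2 * y) / 2.

Lemma measurable_affine2 (a b c : R) :
  measurable_fun setT (fun x : R * R => cos (dotR2 (a, b) x + c)).
Proof.
have m1 : measurable_fun setT (fun x : R * R => dotR2 (a, b) x + c).
  apply: measurable_funD; last exact: measurable_cst.
  by apply: measurable_funD; apply: measurable_funM;
    [exact: measurable_cst|exact: measurable_fst|exact: measurable_cst|exact: measurable_snd].
apply: (measurableT_comp _ m1).
by apply: continuous_measurable_fun; exact: continuous_cos.
Qed.

Lemma stationary_measure_char_fun (xi sigma H h : R) (mu : probability (R * R)%type R) :
  0 < xi -> 0 < sigma -> 0 < H -> 0 <= h ->
  stationary_measure h (xi, sigma, H) mu ->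
  exists R0 k A A1, [/\ 0 < R0, variogram_eq H k A A1,
    k * xi `^ (2 * H) * (2 * R0) = sigma ^+ 2
  & forall chi, char_fun mu chi = ((expR (- gaussian_exponent R0
      (k * (xi * h) `^ (2 * H) - A (xi * h)) chi.1 chi.2)) +i* 0)%C].
Proof.
move=> xi0 sigma0 H0 h0 [d [T [P [B [U [fbm sol statU muE]]]]]].
have [k [A [A1 [sys kE chE]]]] := fOU_structure xi0 sigma0 H0 fbm sol statU.
exists (fOU_var U), k, A, A1; split => //; first exact: fOU_var_gt0 xi0 sigma0 H0 fbm sol statU.
move=> [a b].
have mX : measurable_fun setT (fun w => (U 0 w, U h w - U 0 w)).
  apply: measurable_fun_pair; first exact: measurable_funP.
  by apply: measurable_funB; exact: measurable_funP.
have law E : measurable E -> mu E = P ((fun w => (U 0 w, U h w - U 0 w)) @^-1` E).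
  by move=> mE; rewrite (muE 0 E mE) add0r.
have tr c : \int[mu]_x cos (dotR2 (a, b) x + c) =
    cos c * expR (- gaussian_exponent (fOU_var U) (k * (xi * h) `^ (2 * H) - A (xi * h)) a b).
  rewrite (Rintegral_law mX law (measurable_affine2 a b c)); first exact: chE.
  apply: (@integrable_bounded _ _ _ P _ 1); last by move=> w; exact: norm_cos_le1.
  exact: (measurableT_comp (measurable_affine2 a b c) mX).
rewrite /char_fun; congr (_ +i* _)%C.
  by have := tr 0; rewrite cos0 mul1r => <-; apply: eq_Rintegral => x _; rewrite addr0.
(* This phase turns the cosine into the sine, and cos(- pi / 2) = 0: the characteristic function is
   real. *)
have := tr (- (pi / 2)); rewrite cosN cos_pihalf mul0r => <-.
by apply: eq_Rintegral => x _; rewrite cosBpihalf.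
Qed.

End stationary_char_fun.

(** * The distance d_CF *)

Section plane_integrals.
Context {R : realType}.
Local Notation leb := (@lebesgue_measure R).
Local Notation leb2 := (@lebesgue_measureR2 R).
Implicit Types (F : R * R -> R).

Lemma integral_decay_lty (p : R) : 1 < p ->
  (\int[leb]_x ((1 + `|x|) `^ (- p))%:E < +oo)%E.
Proof.
move=> p1; pose v (x : R) := (1 + `|x|) `^ (- p).
have q0 : 0 < p - 1 by lra.
have v0 x : 0 <= v x by exact: powR_ge0.
have n1 (x : R) : 0 < 1 + `|x| by rewrite ltr_pwDl.
have cv : continuous v.
  move=> x; have c1 : {for x, continuous (fun y : R => 1 + `|y|)}.
    by apply: cvgD; [exact: cvg_cst|exact: norm_continuous].
  exact: (continuous_comp c1 (@continuous_powR _ (- p) _ (n1 x))).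
rewrite (@ge0_symfun_integralT _ v v0 cv); last by move=> x /=; rewrite /v normrN.
rewrite -set_itvcy.
pose G (x : R) := - (p - 1)^-1 * (1 + x) `^ (- (p - 1)).
have dG (x : R) : 0 <= x -> is_derive x (1 : R) G (v x).
  move=> x0; have x1 : 0 < 1 + x by lra.
  have := is_derive_fZ (- (p - 1)^-1) (is_derive_fcomp (is_derive1_powR (- (p - 1)) x1)
    (is_derive_fD (is_derive_fcst 1 x) (is_derive_fid x))).
  move/is_derive_eq; apply; rewrite /v ger0_norm// add0r mulr1 mulrA.
  rewrite (_ : - (p - 1) - 1 = - p); last by ring.
  by rewrite mulrNN mulVf ?mul1r// gt_eqF.
have G0 : G x @[x --> +oo] --> (0 : R).
  rewrite -(mulr0 (- (p - 1)^-1)); apply: cvgM; first exact: cvg_cst.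
  apply/cvgrPdist_le => e e0; near=> x.
  have xM : e^-1 `^ (p - 1)^-1 <= x by near: x; apply: nbhs_pinfty_ge; rewrite num_real.
  have x0 : 0 <= x by apply: le_trans xM; exact: powR_ge0.
  rewrite sub0r normrN ger0_norm ?powR_ge0// powRN -[leRHS]invrK lef_pV2 ?posrE ?invr_gt0//.
    have -> : e^-1 = (e^-1 `^ (p - 1)^-1) `^ (p - 1).
      by rewrite -powRrM mulVf ?gt_eqF// powRr1// invr_ge0 ltW.
    apply: ge0_ler_powR; rewrite ?nnegrE ?powR_ge0//; lra.
  by apply: powR_gt0; lra.
have -> : (\int[leb]_(x in `[0%R, +oo[) (v x)%:E = 0%:E - (G 0)%:E)%E.
  apply: ge0_continuous_FTC2y => //.
  - exact: continuous_subspaceT.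
  - by move=> x x0; apply: ex_derive; apply: dG; exact: ltW.
  - apply: cvg_at_right_filter; exact: is_derive_continuous (dG 0 (lexx 0)).
  - move=> x; rewrite in_itv/= andbT => x0; rewrite derive1E.
    by have := dG x (ltW x0) => h; exact: derive_val.
by rewrite -EFinB -EFinM ltry.
Unshelve. all: by end_near. Qed.

Definition weight (p : R) (chi : R * R) : R := (1 + dotR2 chi chi) `^ (- p).

Lemma dotR2_ge0 (x : R * R) : 0 <= dotR2 x x.
Proof. by rewrite /dotR2 -!expr2 addr_ge0 ?sqr_ge0. Qed.

Lemma weight_gt0 p chi : 0 < weight p chi.
Proof. by apply: powR_gt0; rewrite ltr_pwDl// dotR2_ge0. Qed.

Lemma measurable_weight p : measurable_fun setT (weight p).
Proof.
apply: (measurableT_comp (measurable_powR (- p))).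
apply: measurable_funD; first exact: measurable_cst.
by apply: measurable_funD; apply: measurable_funM;
  [exact: measurable_fst|exact: measurable_fst|exact: measurable_snd|exact: measurable_snd].
Qed.

Lemma continuous_weight p : continuous (weight p).
Proof.
move=> chi; have c1 : {for chi, continuous (fun x : R * R => 1 + dotR2 x x)}.
  apply: cvgD; first exact: cvg_cst.
  by apply: cvgD; apply: cvgM; [exact: cvg_fst|exact: cvg_fst|exact: cvg_snd|exact: cvg_snd].
have d0 : 0 < 1 + dotR2 chi chi by rewrite ltr_pwDl// dotR2_ge0.
exact: (continuous_comp c1 (@continuous_powR _ (- p) _ d0)).
Qed.

(** (1 + |x|) (1 + |y|) <= 2 (1 + x^2 + y^2) splits the weight into one-dimensional factors, which
    are integrable for the same range p > 1. *)
Lemma weight_le (p x y : R) : 0 < p ->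
  weight p (x, y) <= 2 `^ p * ((1 + `|x|) `^ (- p) * (1 + `|y|) `^ (- p)).
Proof.
move=> p0; have n1 (z : R) : 0 < 1 + `|z| by rewrite ltr_pwDl.
have n0 (z : R) : 0 <= `|z| by exact: normr_ge0.
have d0 : 0 < 1 + dotR2 (x, y) (x, y) by rewrite ltr_pwDl// dotR2_ge0.
have h : (1 + `|x|) * (1 + `|y|) <= 2 * (1 + dotR2 (x, y) (x, y)).
  rewrite /dotR2/= -!expr2 -(real_normK (num_real x)) -(real_normK (num_real y)).
  have := sqr_ge0 (`|x| - `|y|); have := sqr_ge0 (`|x| - 1); have := sqr_ge0 (`|y| - 1).
  rewrite !sqrrB !expr2; have := n0 x; have := n0 y.
  move: (`|x|) (`|y|) => a b; nra.
rewrite /weight !powRN -invfM -powRM ?(ltW (n1 _))//.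
set N := (1 + `|x|) * _ in h *; set D := 1 + dotR2 _ _ in h d0 *.
have N0 : 0 < N by rewrite mulr_gt0.
have p2 : 0 < 2 `^ p :> R by exact: powR_gt0.
have -> : (D `^ p)^-1 = 2 `^ p * ((2 * D) `^ p)^-1.
  by rewrite powRM ?(ltW d0)// invfM mulrA divff ?mul1r// gt_eqF.
rewrite ler_pM2l// lef_pV2 ?posrE ?powR_gt0 ?mulr_gt0//.
by apply: ge0_ler_powR; rewrite ?nnegrE ?mulr_ge0 ?(ltW p0) ?(ltW d0) ?(ltW N0).
Qed.

Lemma integral_weight_lty (p : R) : 1 < p -> (\int[leb2]_chi (weight p chi)%:E < +oo)%E.
Proof.
move=> p1; have p0 : 0 < p by lra.
pose v (x : R) := (1 + `|x|) `^ (- p).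
have mv : measurable_fun setT v.
  apply: (measurableT_comp (measurable_powR (- p))).
  by apply: measurable_funD; [exact: measurable_cst|exact: normr_measurable].
have v0 x : 0 <= v x by exact: powR_ge0.
pose K : R := 2 `^ p.
have K0 : 0 <= K by exact: powR_ge0.
have mVV : measurable_fun setT (fun chi : R * R => K * (v chi.1 * v chi.2)).
  apply: measurable_funM; first exact: measurable_cst.
  by apply: measurable_funM; apply: measurableT_comp => //.
apply: (@le_lt_trans _ _ (\int[leb2]_chi (K * (v chi.1 * v chi.2))%:E)%E).
  apply: ge0_le_integral => //.
  - by move=> chi _; rewrite lee_fin ltW// weight_gt0.
  - by apply/measurable_EFinP; exact: measurable_weight.
  - exact/measurable_EFinP.
  - by move=> [x y] _; rewrite lee_fin; exact: weight_le.
rewrite /lebesgue_measureR2 fubini_tonelli1; last 2 first.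
- exact/measurable_EFinP.
- by move=> chi; rewrite lee_fin !mulr_ge0.
have E (x : R) : (\int[leb]_y (K * (v x * v y))%:E = (K * v x)%:E * \int[leb]_y (v y)%:E)%E.
  under eq_integral do rewrite mulrA EFinM.
  rewrite ge0_integralZl//.
  - exact/measurable_EFinP.
  - by move=> y _; rewrite lee_fin.
  - by rewrite lee_fin mulr_ge0.
rewrite /fubini_F; under eq_integral do rewrite /= E.
have I0 : (0 <= \int[leb]_y (v y)%:E)%E by apply: integral_ge0 => y _; rewrite lee_fin.
have If := integral_decay_lty p1.
rewrite -/(v _) in If.
have [r rE] : exists r : R, (\int[leb]_y (v y)%:E)%E = r%:E.
  by exists (fine (\int[leb]_y (v y)%:E)%E); rewrite fineK// ge0_fin_numE.
rewrite rE; under eq_integral do rewrite -EFinM mulrAC EFinM.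
rewrite ge0_integralZl//; last 3 first.
- exact/measurable_EFinP.
- by move=> y _; rewrite lee_fin.
- by rewrite lee_fin mulr_ge0// -lee_fin -rE.
by rewrite rE -EFinM ltry.
Qed.

Lemma integral_plane_gt0 F (chi0 : R * R) : measurable_fun setT F ->
  {for chi0, continuous F} -> (forall chi, 0 <= F chi) -> 0 < F chi0 ->
  (0 < \int[leb2]_chi (F chi)%:E)%E.
Proof.
move=> mF cF F0 Fpos.
have F20 : 0 < F chi0 / 2 by rewrite divr_gt0.
have /cvgrPdist_lt/(_ _ F20) := cF.
move=> [[A1 A2] /= [/nbhs_ballP [e1 /= e10 h1] /nbhs_ballP [e2 /= e20 h2]] hA].
pose Bx1 : set R := `]chi0.1 - e1, chi0.1 + e1[%classic.
pose Bx2 : set R := `]chi0.2 - e2, chi0.2 + e2[%classic.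
have mB : measurable (Bx1 `*` Bx2) by apply: measurableX; exact: measurable_itv.
have low chi : (Bx1 `*` Bx2) chi -> F chi0 / 2 <= F chi.
  move=> [b1 b2]; have : `|F chi0 - F chi| < F chi0 / 2.
    apply: hA; split; [apply: h1|apply: h2]; rewrite ball_itv; [exact: b1|exact: b2].
  by rewrite ltr_norml => /andP[]; lra.
apply: (@lt_le_trans _ _ (\int[leb2]_(chi in Bx1 `*` Bx2) (F chi0 / 2)%:E)%E).
  rewrite integral_cst//= /lebesgue_measureR2 product_measure1E; [|exact: measurable_itv..].
  have lp (a e : R) : 0 < e -> (0 < leb `](a - e)%R, (a + e)%R[%classic)%E.
    by move=> e0; rewrite lebesgue_measure_itv/= lte_fin ifT -?EFinB ?lte_fin; lra.
  by rewrite !mule_gt0// ?lp// lte_fin.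
apply: (@le_trans _ _ (\int[leb2]_(chi in Bx1 `*` Bx2) (F chi)%:E)%E).
  apply: ge0_le_integral => //.
  - by move=> chi _; rewrite lee_fin ltW.
  - by apply/measurable_EFinP; exact: measurable_funTS.
apply: ge0_subset_integral => //; first exact/measurable_EFinP.
by move=> chi _; rewrite lee_fin.
Qed.

(** Finiteness matters as much as positivity: [fine] would turn an infinite integral into 0. *)
Lemma c_gt0 (p : R) : 1 < p -> 0 < c_ p.
Proof.
move=> p1; rewrite /c_ invr_gt0 /Rintegral.
apply: fine_gt0; apply/andP; split; last exact: integral_weight_lty.
apply: (@integral_plane_gt0 (weight p) (0, 0)).
- exact: measurable_weight.
- exact: continuous_weight.
- by move=> chi; rewrite ltW// weight_gt0.
- exact: weight_gt0.
Qed.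

(** The integrand is continuous and nonnegative, and the weight is positive, so a disagreement at
    one frequency makes the integral positive. *)
Lemma d_CF_eq0 (p : R) (mu nu : probability (R * R)%type R) (f g : R * R -> R) :
  1 < p ->
  (forall chi, char_fun mu chi = (f chi +i* 0)%C) ->
  (forall chi, char_fun nu chi = (g chi +i* 0)%C) ->
  measurable_fun setT f -> measurable_fun setT g -> continuous f -> continuous g ->
  (forall chi, `|f chi| <= 1) -> (forall chi, `|g chi| <= 1) ->
  d_CF p mu nu = 0 <-> f =1 g.
Proof.
move=> p1 muf nug mf mg cf cg f1 g1.
pose F chi := (f chi - g chi) ^+ 2 * g_ p chi.
have FE chi : Normc.normc (char_fun mu chi - char_fun nu chi) ^+ 2 * g_ p chi = F chi.
  rewrite muf nug /F; congr (_ * _).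
  by rewrite /Normc.normc/= subr0 expr0n/= addr0 sqr_sqrtr// sqr_ge0.
have cp := c_gt0 p1.
have g0 chi : 0 < g_ p chi by rewrite /g_ mulr_gt0// weight_gt0.
have F0 chi : 0 <= F chi by rewrite /F mulr_ge0 ?sqr_ge0// ltW.
have mgp : measurable_fun setT (g_ p).
  by apply: measurable_funM; [exact: measurable_cst|exact: measurable_weight].
have mF : measurable_fun setT F.
  by apply: measurable_funM => //; apply: measurable_funX; exact: measurable_funB.
rewrite /d_CF (_ : (fun chi => _) = F); last by apply/funext => chi; rewrite FE.
split=> [|fg]; last first.
  rewrite (_ : F = fun=> 0); last by apply/funext => chi; rewrite /F fg subrr expr0n mul0r.
  by rewrite /Rintegral integral0/= sqrtr0.
move=> /eqP; rewrite sqrtr_eq0 => I0 chi0; apply/eqP/negPn/negP => fg.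
have Ipos : (0 < \int[leb2]_chi (F chi)%:E)%E.
  apply: (@integral_plane_gt0 F chi0) => //.
    apply: cvgM.
      rewrite /F; under eq_fun do rewrite expr2.
      by rewrite expr2; apply: cvgM; apply: cvgB; by [exact: cf|exact: cg].
    by apply: cvgM; [exact: cvg_cst|exact: continuous_weight].
  by rewrite /F mulr_gt0// exprn_even_gt0//= subr_eq0.
(* [Rintegral] sends an infinite integral to 0, so positivity alone would not contradict [I0]. The
   dominating function comes from |f - g| <= 2. *)
have Ifin : (\int[leb2]_chi (F chi)%:E < +oo)%E.
  apply: (@le_lt_trans _ _ (\int[leb2]_chi ((4 * c_ p)%:E * (weight p chi)%:E))%E).
    apply: ge0_le_integral => //.
    - by move=> chi _; rewrite lee_fin.
    - exact/measurable_EFinP.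
    - apply: measurable_funeM; apply/measurable_EFinP; exact: measurable_weight.
    - move=> chi _; rewrite -EFinM lee_fin /F /g_ mulrA ler_wpM2r ?(ltW (weight_gt0 _ _))//.
      rewrite ler_wpM2r ?(ltW cp)//.
      have := f1 chi; have := g1 chi; rewrite !ler_norml => /andP[? ?] /andP[? ?].
      rewrite -[leLHS]real_normK ?num_real// (_ : 4 = 2 ^+ 2); last by ring.
      by rewrite lerXn2r ?nnegrE// ler_norml; apply/andP; split; lra.
  rewrite ge0_integralZl//.
  - by rewrite lte_mul_pinfty ?integral_weight_lty// lee_fin mulr_ge0// ltW.
  - by apply/measurable_EFinP; exact: measurable_weight.
  - by move=> chi _; rewrite lee_fin ltW// weight_gt0.
  - by rewrite lee_fin mulr_ge0// ltW.
by move: I0; rewrite leNgt /Rintegral fine_gt0// Ipos.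
Qed.

End plane_integrals.

(** * The distance between two stationary laws *)

Section stationary_distance.
Context {R : realType}.

Lemma gaussian_exponent_ge0 (R0 y a b : R) : 0 < R0 -> 0 <= y <= 2 ->
  0 <= gaussian_exponent R0 y a b.
Proof.
move=> R00 /andP[y0 y2]; rewrite /gaussian_exponent divr_ge0// mulr_ge0 ?(ltW R00)//.
have -> : a ^+ 2 - 2 * a * b * y + 2 * b ^+ 2 * y = (a - b * y) ^+ 2 + b ^+ 2 * (y * (2 - y)).
  by ring.
by rewrite addr_ge0 ?sqr_ge0// mulr_ge0 ?sqr_ge0// mulr_ge0// subr_ge0.
Qed.

Lemma measurable_gaussian_exponent (R0 y : R) :
  measurable_fun setT (fun chi : R * R => expR (- gaussian_exponent R0 y chi.1 chi.2)).
Proof.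
have m1 := @measurable_fst _ _ (measurableTypeR R) (measurableTypeR R).
have m2 := @measurable_snd _ _ (measurableTypeR R) (measurableTypeR R).
have mc (c : R) : measurable_fun setT (fun _ : R * R => c) by exact: measurable_cst.
apply: measurableT_comp; first exact: measurable_expR.
apply: measurableT_comp; first exact: oppr_measurable.
apply: measurable_funM; last exact: mc.
apply: measurable_funM; first exact: mc.
apply: measurable_funD; first apply: measurable_funB.
- exact: measurable_funX.
- apply: measurable_funM; last exact: mc.
  apply: measurable_funM => //; exact: measurable_funM.
- apply: measurable_funM; last exact: mc.
  apply: measurable_funM; [exact: mc|exact: measurable_funX].
Qed.

Lemma continuous_gaussian_exponent (R0 y : R) :
  continuous (fun chi : R * R => expR (- gaussian_exponent R0 y chi.1 chi.2)).
Proof.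
move=> chi; apply: continuous_cvg; first exact: continuous_expR.
have c1 : (fun x : R * R => x.1) x @[x --> chi] --> chi.1 by exact: cvg_fst.
have c2 : (fun x : R * R => x.2) x @[x --> chi] --> chi.2 by exact: cvg_snd.
have cc (c : R) : (fun _ : R * R => c) x @[x --> chi] --> c by exact: cvg_cst.
rewrite /gaussian_exponent; under eq_fun do rewrite !expr2.
rewrite !expr2; apply: cvgN; apply: cvgM => //; apply: cvgM => //.
apply: cvgD; first apply: cvgB; first exact: cvgM.
  by apply: cvgM => //; apply: cvgM => //; apply: cvgM.
by apply: cvgM => //; apply: cvgM => //; apply: cvgM.
Qed.

Lemma stationary_measures_d_CF (p h xi1 sigma1 H1 xi2 sigma2 H2 : R)
    (mu1 mu2 : probability (R * R)%type R) : 1 < p -> 0 <= h ->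
  0 < xi1 -> 0 < sigma1 -> 0 < H1 -> 0 < xi2 -> 0 < sigma2 -> 0 < H2 ->
  stationary_measure h (xi1, sigma1, H1) mu1 ->
  stationary_measure h (xi2, sigma2, H2) mu2 ->
  exists R1 k1 A1 B1 R2 k2 A2 B2,
    [/\ [/\ 0 < R1, variogram_eq H1 k1 A1 B1 & k1 * xi1 `^ (2 * H1) * (2 * R1) = sigma1 ^+ 2],
        [/\ 0 < R2, variogram_eq H2 k2 A2 B2 & k2 * xi2 `^ (2 * H2) * (2 * R2) = sigma2 ^+ 2]
      & d_CF p mu1 mu2 = 0 <-> R1 = R2 /\
          k1 * (xi1 * h) `^ (2 * H1) - A1 (xi1 * h) =
          k2 * (xi2 * h) `^ (2 * H2) - A2 (xi2 * h)].
Proof.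
move=> p1 h0 x10 sg10 H10 x20 sg20 H20 st1 st2.
have [R1 [k1 [A1 [B1 [R10 s1 e1 ch1]]]]] := stationary_measure_char_fun x10 sg10 H10 h0 st1.
have [R2 [k2 [A2 [B2 [R20 s2 e2 ch2]]]]] := stationary_measure_char_fun x20 sg20 H20 h0 st2.
exists R1, k1, A1, B1, R2, k2, A2, B2; split => //.
have y1 : 0 <= k1 * (xi1 * h) `^ (2 * H1) - A1 (xi1 * h) <= 2.
  by case: s1 => _ _ _ _; apply; rewrite mulr_ge0// ltW.
have y2 : 0 <= k2 * (xi2 * h) `^ (2 * H2) - A2 (xi2 * h) <= 2.
  by case: s2 => _ _ _ _; apply; rewrite mulr_ge0// ltW.
move: (_ - A1 _) (_ - A2 _) y1 y2 ch1 ch2 => y1 y2 y1b y2b ch1 ch2.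
have bnd (r y : R) chi : 0 < r -> 0 <= y <= 2 ->
    `|expR (- gaussian_exponent r y chi.1 chi.2)| <= 1.
  move=> r0 yb; rewrite ger0_norm ?expR_ge0// expR_le1 oppr_le0.
  exact: (gaussian_exponent_ge0 _ _ r0 yb).
rewrite (d_CF_eq0 p1 ch1 ch2); last 6 first.
- exact: measurable_gaussian_exponent.
- exact: measurable_gaussian_exponent.
- exact: continuous_gaussian_exponent.
- exact: continuous_gaussian_exponent.
- by move=> chi; exact: bnd.
- by move=> chi; exact: bnd.
split=> [E|[-> ->]]//.
(* The exponent is R0 / 2 at the frequency (1, 0) and R0 y at (0, 1). *)
have /expR_inj/oppr_inj := E (1, 0); have /expR_inj/oppr_inj := E (0, 1).
rewrite /gaussian_exponent/= => E01 E10.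
have R12 : R1 = R2 by lra.
split=> //; have R1n : R1 != 0 by rewrite gt_eqF.
apply: (mulfI R1n); move: E01; rewrite -R12; lra.
Qed.

(** For equal parameters the two solutions may still live on different probability spaces. H
    determines k and y, and R0 = sigma^2 / (2 k xi^(2H)) follows. *)
Lemma stationary_measure_unique (p h xi sigma H : R)
    (mu1 mu2 : probability (R * R)%type R) : 1 < p -> 0 <= h ->
  0 < xi -> 0 < sigma -> 0 < H -> xi * h <= 1 ->
  stationary_measure h (xi, sigma, H) mu1 ->
  stationary_measure h (xi, sigma, H) mu2 -> d_CF p mu1 mu2 = 0.
Proof.
move=> p1 h0 x0 sg0 H0 xh st1 st2.
have [R1 [k1 [A1 [B1 [R2 [k2 [A2 [B2 [[R10 s1 e1] [R20 s2 e2] ->]]]]]]]]] :=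
  stationary_measures_d_CF p1 h0 x0 sg0 H0 x0 sg0 H0 st1 st2.
split; last by apply: (variogram_eq_unique H0 s1 s2); rewrite mulr_ge0// ltW.
have k12 := variogram_eq_k_unique H0 s1 s2.
have k10 : 0 < k1 by have := variogram_eq_k_bounds H0 s1; lra.
have kx : k1 * xi `^ (2 * H) != 0 by rewrite gt_eqF// mulr_gt0// powR_gt0.
have : 2 * R1 = 2 * R2 by apply: (mulfI kx); rewrite e1 k12 e2.
lra.
Qed.

(** The normalization al <= 1 <= be gives al^2 <= xi^(2H) <= be^2 for every H in (0, 1). *)
Lemma compact_pos_bounds (K : set R) : compact K -> K `<=` `]0, +oo[ ->
  exists al be : R, [/\ 0 < al <= 1, 1 <= be & forall x, K x -> al <= x <= be].
Proof.
move=> cK Kpos.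
have [M [_ /(_ (M + 1))]] := compact_bounded cK.
rewrite ltrDl ltr01 => /(_ isT) KM.
have /compact_near_coveringP/(_ R (0 : R)^'+ (fun d x => d <= x)) := cK.
move=> /(_ _)[x /Kpos|e /= e0 he].
  rewrite /= in_itv/= andbT => x0.
  have x20 : 0 < x / 2 by rewrite divr_gt0.
  have near_x : \forall x' \near x, x / 2 < x'.
    by apply: lt_nbhsr; rewrite ltr_pdivrMr// ltr_pMr// ltr1n.
  have near_d : \forall d \near (0 : R)^'+, d < x / 2 by exact: nbhs_right_lt.
  exists ([set x' | x / 2 < x'], [set d | d < x / 2]) => // -[x' d]/= [xx' dd].
  by rewrite ltW// (lt_trans dd).
have e20 : 0 < e / 2 by rewrite divr_gt0.
have low x : K x -> e / 2 <= x.
  move=> Kx; apply: (he (e / 2)) => //=.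
  by rewrite sub0r normrN gtr0_norm// ltr_pdivrMr// ltr_pMr// ltr1n.
exists (Num.min 1 (e / 2)), (Num.max 1 (M + 1)); split.
- by rewrite lt_min ltr01 e20 ge_min lexx.
- by rewrite le_max lexx.
- move=> x Kx; rewrite ge_min low// orbT le_max/=; apply/orP; right.
  by apply: le_trans (ler_norm _) _; exact: KM.
Qed.

End stationary_distance.

Theorem proposition2p11 (R : realType) (Xi Sigma Hs : set R)
    (Xi_compact : compact Xi) (Xi_pos : Xi `<=` `]0, +oo[)
    (Sigma_compact : compact Sigma) (Sigma_pos : Sigma `<=` `]0, +oo[)
    (Hs_compact : compact Hs) (Hs_range : Hs `<=` `]0, 1[)
    (known : parameter) (c : R) (c_range : known_range Xi Sigma Hs known c)
    (p : R) (p_gt1 : 1 < p) :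
  exists2 h0 : R, 0 < h0 &
    forall h : R, 0 < h < h0 ->
    forall theta1 theta2 : R * R,
      Theta Xi Sigma Hs known theta1 -> Theta Xi Sigma Hs known theta2 ->
    forall mu1 mu2 : probability (R * R)%type R,
      stationary_measure h (full_parameter known c theta1) mu1 ->
      stationary_measure h (full_parameter known c theta2) mu2 ->
      (d_CF p mu1 mu2 = 0 <-> theta1 = theta2).
Proof.
have pos (K : set R) x : K `<=` `]0, +oo[ -> K x -> 0 < x.
  by move=> KP /KP; rewrite /= in_itv/= andbT.
have Hpos x : Hs x -> 0 < x by move=> /Hs_range; rewrite /= in_itv/= => /andP[].
have Hlt1 x : Hs x -> x < 1 by move=> /Hs_range; rewrite /= in_itv/= => /andP[].
have [al [be [al01 be1 Xib]]] := compact_pos_bounds Xi_compact Xi_pos.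
have be0 : 0 < be := lt_le_trans ltr01 be1.
have small xi h d : Xi xi -> 0 < h -> h < d / be -> xi * h <= d.
  move=> Xxi h0 hd; have /andP[_ xb] := Xib _ Xxi.
  apply: (@le_trans _ _ (be * h)); first by rewrite ler_pM2r.
  by rewrite mulrC -ler_pdivlMr// ltW.
have sq_inj (x y : R) : 0 < x -> 0 < y -> x ^+ 2 = y ^+ 2 -> x = y.
  by move=> x0 y0 /eqP; rewrite eqrXn2// ?ltW// => /eqP.
case: known c_range => /= Kc.
(* xi known: equal values of y at the common point xi h <= e^(-2) give H, hence k, and sigma^2 = 2 k
   xi^(2H) R0. *)
- have e20 : 0 < expR (- 2 : R) by exact: expR_gt0.
  have e21 : expR (- 2 : R) <= 1 by rewrite expR_le1 oppr_le0.
  exists (expR (- 2) / be) => [|h /andP[h0 hlt]]; first by rewrite divr_gt0.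
  move=> [sg1 H1] [sg2 H2] /= [/= S1 h1] [/= S2 h2] mu1 mu2 st1 st2.
  have x0 := pos _ _ Xi_pos Kc; have xh := small _ _ _ Kc h0 hlt.
  have s10 := pos _ _ Sigma_pos S1; have s20 := pos _ _ Sigma_pos S2.
  have H10 := Hpos _ h1; have H20 := Hpos _ h2.
  split=> [d0|[E1 E2]]; last first.
    rewrite -E1 -E2 in st2.
    by apply: (stationary_measure_unique p_gt1 (ltW h0) x0 s10 H10 _ st1 st2); exact: le_trans e21.
  have [R1 [k1 [A1 [B1 [R2 [k2 [A2 [B2 [[R10 v1 e1] [R20 v2 e2] dE]]]]]]]]] :=
    stationary_measures_d_CF p_gt1 (ltW h0) x0 s10 H10 x0 s20 H20 st1 st2.
  have [R12 yE] := dE.1 d0.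
  have xh0 : 0 < c * h <= expR (- 2) by rewrite mulr_gt0.
  have HE := variogram_eq_drift_known H10 H20 xh0 v1 v2 yE.
  rewrite -HE in v2 e2 *; congr pair; apply: sq_inj => //.
  by rewrite -e1 -e2 R12 (variogram_eq_k_unique H10 v1 v2).
(* sigma known: equal R0 yields k_1 xi_1^(2 H_1) = k_2 xi_2^(2 H_2), under which the points xi_1 h
   and xi_2 h can be compared. The lower bound a of [Hs] makes T uniform. *)
- have [a [b [/andP[a0 _] _ Hb]]] : exists al be : R,
      [/\ 0 < al <= 1, 1 <= be & forall x, Hs x -> al <= x <= be].
    by apply: (compact_pos_bounds Hs_compact) => x /Hpos; rewrite /= in_itv/= andbT.
  have [T T0 diffT] := variogram_eq_diffusion_known a0 al01 be1.
  exists (Num.min T (1 / be)) => [|h /andP[h0]]; first by rewrite lt_min T0 divr_gt0.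
  rewrite lt_min => /andP[hT hb].
  move=> [xi1 H1] [xi2 H2] /= [/= X1 h1] [/= X2 h2] mu1 mu2 st1 st2.
  have s0 := pos _ _ Sigma_pos Kc.
  have x10 := pos _ _ Xi_pos X1; have x20 := pos _ _ Xi_pos X2.
  have H10 := Hpos _ h1; have H20 := Hpos _ h2.
  split=> [d0|[E1 E2]]; last first.
    rewrite -E1 -E2 in st2.
    by apply: (stationary_measure_unique p_gt1 (ltW h0) x10 s0 H10 _ st1 st2); exact: small hb.
  have [R1 [k1 [A1 [B1 [R2 [k2 [A2 [B2 [[R10 v1 e1] [R20 v2 e2] dE]]]]]]]]] :=
    stationary_measures_d_CF p_gt1 (ltW h0) x10 s0 H10 x20 s0 H20 st1 st2.
  have [R12 yE] := dE.1 d0.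
  have R1n : 2 * R1 != 0 by rewrite mulf_neq0// gt_eqF.
  have kE : k1 * xi1 `^ (2 * H1) = k2 * xi2 `^ (2 * H2).
    by apply: (mulIf R1n); rewrite e1 R12 e2.
  have Hb1 : a <= H1 < 1 by rewrite Hlt1// andbT; case/andP: (Hb _ h1).
  have Hb2 : a <= H2 < 1 by rewrite Hlt1// andbT; case/andP: (Hb _ h2).
  have hT' : 0 < h < T by rewrite h0.
  have HE := diffT _ _ _ _ _ _ _ _ _ _ _ Hb1 Hb2 (Xib _ X1) (Xib _ X2) v1 v2 kE hT' yE.
  rewrite -HE in v2 kE *; congr pair.
  have k12 := variogram_eq_k_unique H10 v1 v2.
  have k10 : 0 < k1 by have := variogram_eq_k_bounds H10 v1; lra.
  have kn : k1 != 0 by rewrite gt_eqF.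
  (* With H and k common, xi^(2H) is determined, hence xi. *)
  move: kE; rewrite -k12 => /(mulfI kn).
  by apply: powR_injective; rewrite ?nnegrE ?mulr_gt0// ltW.
(* H known: y is injective on (0, d], so xi h and then xi are determined; sigma follows from R0. *)
- have H10 := Hpos _ Kc; have H11 := Hlt1 _ Kc.
  have H01 : 0 < c < 1 by rewrite H10.
  have [d d0 hurst] := variogram_eq_hurst_known H01.
  exists (Num.min d 1 / be) => [|h /andP[h0 hlt]]; first by rewrite divr_gt0// lt_min d0 ltr01.
  move=> [xi1 sg1] [xi2 sg2] /= [/= X1 S1] [/= X2 S2] mu1 mu2 st1 st2.
  have x10 := pos _ _ Xi_pos X1; have x20 := pos _ _ Xi_pos X2.
  have s10 := pos _ _ Sigma_pos S1; have s20 := pos _ _ Sigma_pos S2.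
  have := small _ _ _ X1 h0 hlt; rewrite le_min => /andP[x1d x1h].
  have := small _ _ _ X2 h0 hlt; rewrite le_min => /andP[x2d x2h].
  split=> [dCF0|[E1 E2]]; last first.
    rewrite -E1 -E2 in st2.
    exact: (stationary_measure_unique p_gt1 (ltW h0) x10 s10 H10 x1h st1 st2).
  have [R1 [k1 [A1 [B1 [R2 [k2 [A2 [B2 [[R10 v1 e1] [R20 v2 e2] dE]]]]]]]]] :=
    stationary_measures_d_CF p_gt1 (ltW h0) x10 s10 H10 x20 s20 H10 st1 st2.
  have [R12 yE] := dE.1 dCF0.
  have xh1 : 0 < xi1 * h <= d by rewrite mulr_gt0.
  have xh2 : 0 < xi2 * h <= d by rewrite mulr_gt0.
  have hn : h != 0 by rewrite gt_eqF.
  have xE : xi1 = xi2 := mulIf hn (hurst _ _ _ _ _ _ _ _ v1 v2 xh1 xh2 yE).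
  rewrite -xE in e2 *; congr pair; apply: sq_inj => //.
  by rewrite -e1 -e2 R12 (variogram_eq_k_unique H10 v1 v2).
Qed.
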